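(* Let $T=[v_1,v_2,v_3]\subset\mathbb{R}^2$ be a nondegenerate triangle with 12-split $T_{12}$, and let $\Lambda$ be the basis of the dual space of $\mathcal{S}^3_5(T_{12})$ described in the context, with dual (Hermite nodal) basis $\{\lambda^*:\lambda\in\Lambda\}$ of $\mathcal{S}^3_5(T_{12})$. With $v=v_1$, $x=v_2-v_1$, $y=v_3-v_1$, $u=v_3-v_4$, $e=[v_1,v_2]$, $q_{1,e}=\frac{3v_1+v_2}4$ and $m_e=v_4$, one has $$\begin{aligned} \varepsilon_v^*={}&\tfrac14Q_{600101}+\tfrac14(Q_{500201}+Q_{500102})+\tfrac12(Q_{410201}+Q_{401102})+Q_{411101}+\tfrac12(Q_{311201}+Q_{311102})\\ &+\tfrac12(Q_{320201}+Q_{302102})+\tfrac9{16}(Q_{211211}+Q_{211112})+\tfrac38(Q_{220211}+Q_{202112})+\tfrac3{16}(Q_{112112}+Q_{121211}),\\ (\varepsilon_vD_x)^*={}&\tfrac1{40}Q_{500201}+\tfrac1{10}Q_{410201}+\tfrac15Q_{320201}+\tfrac1{10}Q_{411101}+\tfrac3{20}Q_{311201}+\tfrac{13}{80}Q_{220211}+\tfrac1{20}Q_{311102}\\ &+\tfrac{19}{80}Q_{211211}+\tfrac1{10}Q_{121211}-\tfrac1{40}Q_{211112}-\tfrac1{40}Q_{202112}-\tfrac1{20}Q_{112112},\\ (\varepsilon_vD_x^2)^*={}&\tfrac1{160}Q_{410201}+\tfrac1{32}Q_{320201}+\tfrac1{80}Q_{311201}+\tfrac{17}{640}Q_{220211}+\tfrac{121}{3840}Q_{211211}+\tfrac{71}{3840}Q_{121211}\\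 &-\tfrac1{48}Q_{211112}+\tfrac1{480}Q_{112112},\\ (\varepsilon_vD_xD_y)^*={}&\tfrac1{80}Q_{411101}+\tfrac3{160}(Q_{311201}+Q_{311102})-\tfrac1{160}(Q_{220211}+Q_{202112})\\ &+\tfrac{17}{960}(Q_{211112}+Q_{211211})-\tfrac7{480}(Q_{112112}+Q_{121211}),\\ (\varepsilon_vD_x^3)^*={}&\tfrac1{480}Q_{320201}+\tfrac7{3840}Q_{220211}+\tfrac5{3072}Q_{211211}+\tfrac7{5120}Q_{121211},\\ (\varepsilon_vD_x^2D_y)^*={}&\tfrac1{480}Q_{311201}-\tfrac1{1920}Q_{220211}-\tfrac1{768}Q_{121211}+\tfrac{11}{3840}Q_{211211}-\tfrac{11}{3840}Q_{211112}+\tfrac1{3840}Q_{112112},\\ (\varepsilon_{q_{1,e}}D_u^2)^*={}&\tfrac7{240}Q_{211211}-\tfrac1{240}Q_{121211},\\ (\varepsilon_{m_e}D_u)^*={}&\tfrac1{10}Q_{220211}+\tfrac15(Q_{211211}+Q_{121211}). \end{aligned}$$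
   Context: **12-split.** Let $v_4=\frac{v_1+v_2}2$, $v_5=\frac{v_2+v_3}2$, $v_6=\frac{v_1+v_3}2$, $v_7=\frac{v_4+v_6}2$, $v_8=\frac{v_4+v_5}2$, $v_9=\frac{v_5+v_6}2$, $v_{10}=\frac{v_1+v_2+v_3}3$. The 12-split $T_{12}$ is the triangulation of $T$ into 12 triangles obtained by drawing the segments $[v_1,v_5],[v_2,v_6],[v_3,v_4],[v_4,v_5],[v_5,v_6],[v_4,v_6]$; its vertices are $v_1,\dots,v_{10}$. $\mathcal{S}^3_5(T_{12})$ is the (39-dimensional) space of $C^3$ functions on $T$ that are polynomials of total degree at most 5 on each of the 12 triangles. **Simplex splines.** For a finite multiset $K=\{v_1^{m_1}\cdots v_{10}^{m_{10}}\}$ let $|K|=\sum m_i$ and $[K]$ its convex hull. For $x$ not on any line through two of the points $v_1,\dots,v_{10}$, define recursively $Q[K](x)=0$ if $\mathrm{area}([K])=0$; $Q[K](x)=\mathbf 1_{[K]}(x)\,\mathrm{area}(T)/\mathrm{area}([K])$ if $\mathrm{area}([K])\ne0$ and $|K|=3$; and $Q[K](x)=\sum_{j=1}^{10}\beta_jQ[K\setminus v_j](x)$ if $\mathrm{area}([K])\neq 0$ and $|K|>3$, where $x=\sum_j\beta_jv_j$, $\sum_j\beta_j=1$, $\beta_j=0$ whenever $m_j=0$, and $K\setminus v_j$ removes one copy of $v_j$ (the value does not depend on the choice of the $\beta_j$). On $T$ the function $Q[K]$ is extended by continuity (possible for all simplex splines used here). Write $Q_{ijklmn}:=Q[v_1^iv_2^jv_3^kv_4^lv_5^mv_6^n]$.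 **Dual basis.** $\varepsilon_p$ is point evaluation at $p$ and $D_u$ the directional derivative in direction $u$. For a vertex $v$ of $T$ with opposing edge $[v_i,v_j]$ put $x_v=v_i-v$, $y_v=v_j-v$. For an edge $e=[v_i,v_j]$ of $T$ with opposing vertex $v_k$ put $q_{1,e}=\frac{3v_i+v_j}4$, $m_e=\frac{v_i+v_j}2$, $q_{2,e}=\frac{v_i+3v_j}4$, $u_e=v_k-m_e$. Then $$\Lambda=\bigcup_{v}\{\varepsilon_vD_{x_v}^iD_{y_v}^j: i,j\ge0,\ i+j\le3\}\ \cup\ \bigcup_{e}\{\varepsilon_{q_{1,e}}D_{u_e}^2,\ \varepsilon_{m_e}D_{u_e},\ \varepsilon_{q_{2,e}}D_{u_e}^2\},$$ with $v$ ranging over the three vertices and $e$ over the three edges of $T$, is a basis of the dual space of $\mathcal{S}^3_5(T_{12})$. For $\lambda\in\Lambda$, $\lambda^*\in\mathcal{S}^3_5(T_{12})$ is the spline with $\lambda(\lambda^* )=1$ and $\mu(\lambda^* )=0$ for all $\mu\in\Lambda\setminus\{\lambda\}$. *)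

(* Defs.v *)
(* MathComp-Analysis; the plane is [R * R] for an arbitrary [R : realType]. *)
From HB Require Import structures.
From mathcomp Require Import all_boot all_order all_algebra.
From mathcomp Require Import all_classical all_reals all_analysis.
Set Implicit Arguments.
Unset Strict Implicit.
Unset Printing Implicit Defensive.
Import Order.TTheory GRing.Theory Num.Theory.
Import numFieldNormedType.Exports.
Local Open Scope classical_set_scope.
Local Open Scope ring_scope.

Section Plane.
Context {R : realType}.
Implicit Types (A : set (R * R)) (p u : R * R) (f : R * R -> R).

Definition conv_hull (s : seq (R * R)) : set (R * R) :=
  [set p | exists a : 'I_(size s) -> R,
     [/\ forall i, 0 <= a i, \sum_i a i = 1 & p = \sum_i a i *: s`_i]].

Definition line p q : set (R * R) := [set r | exists t : R, r = p + t *: (q - p)].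

Definition area A : R := fine ((@lebesgue_measure R \x @lebesgue_measure R)%E A).

(* Directional derivative of a function that is only relevant on the closed
   region A: the derivative in the interior of A, extended to the boundary by
   continuity from the interior. *)
Definition dirD A u f p : R := lim ('D_u f q @[q --> within A° (nbhs p)]).

(* f is C^k on A: all iterated directional derivatives of order at most k
   exist in the interior of A and extend continuously to A.  Requiring [dirD]
   itself to be the derivative in the interior excludes the case where the
   limit in [dirD] does not exist. *)
Fixpoint Cn A (k : nat) f : Prop :=
  {within A, continuous f} /\
  (if k is k'.+1 then
     forall u, (forall p, A° p -> is_derive p u f (dirD A u f p)) /\
               Cn A k' (dirD A u f)
   else True).

Definition poly2_on A (d : nat) f : Prop :=
  exists c : nat -> nat -> R, forall p, A p ->
    f p = \sum_(i < d.+1) \sum_(j < d.+1 | (i + j <= d)%N)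
            c i j * p.1 ^+ i * p.2 ^+ j.

End Plane.

Record triangle (R : realType) :=
  Triangle { vert1 : R * R; vert2 : R * R; vert3 : R * R }.

Section TwelveSplit.
Context {R : realType}.
Variable t : triangle R.

Local Notation v1 := (vert1 t).
Local Notation v2 := (vert2 t).
Local Notation v3 := (vert3 t).

Definition nondegenerate_triangle : Prop :=
  (v2 - v1).1 * (v3 - v1).2 - (v2 - v1).2 * (v3 - v1).1 != 0.

Definition region : set (R * R) := conv_hull [:: v1; v2; v3].

Definition midpoint (p q : R * R) : R * R := 2^-1 *: (p + q).

Definition vert4 := midpoint v1 v2.
Definition vert5 := midpoint v2 v3.
Definition vert6 := midpoint v1 v3.
Definition vert7 := midpoint vert4 vert6.
Definition vert8 := midpoint vert4 vert5.
Definition vert9 := midpoint vert5 vert6.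
Definition vert10 : R * R := 3^-1 *: (v1 + v2 + v3).

(* Index j : 'I_10 stands for the vertex v_(j+1). *)
Definition vert (j : 'I_10) : R * R :=
  [:: v1; v2; v3; vert4; vert5; vert6; vert7; vert8; vert9; vert10]`_j.

(* The faces cut out of the triangle by the three medians and the three sides
   of the medial triangle: two at each corner, six around the barycentre. *)
Definition split12 : seq (set (R * R)) :=
  [:: conv_hull [:: v1; vert4; vert7]; conv_hull [:: v1; vert6; vert7];
      conv_hull [:: v2; vert4; vert8]; conv_hull [:: v2; vert5; vert8];
      conv_hull [:: v3; vert5; vert9]; conv_hull [:: v3; vert6; vert9];
      conv_hull [:: vert4; vert7; vert10]; conv_hull [:: vert6; vert7; vert10];
      conv_hull [:: vert4; vert8; vert10]; conv_hull [:: vert5; vert8; vert10];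
      conv_hull [:: vert5; vert9; vert10]; conv_hull [:: vert6; vert9; vert10]].

(* Elements are total functions on the plane of which only the values on
   [region] matter. *)
Definition S35 : set (R * R -> R) :=
  [set f | Cn region 3 f /\ forall k, (k < size split12)%N ->
     poly2_on (nth set0 split12 k) 5 f].

(* A finite multiset of vertices, given by its multiplicities. *)
Definition knots := 'I_10 -> nat.

Definition knots_card (K : knots) : nat := (\sum_j K j)%N.

Definition knots_hull (K : knots) : set (R * R) :=
  conv_hull [seq vert j | j <- enum 'I_10 & (0 < K j)%N].

Definition knots_remove (K : knots) (j : 'I_10) : knots :=
  fun i => (K i - (i == j))%N.

Definition bary_spec (K : knots) (x : R * R) : set ('I_10 -> R) :=
  [set b | [/\ x = \sum_j b j *: vert j, \sum_j b j = 1
             & forall j, K j = 0%N -> b j = 0]].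

(* An arbitrary choice of admissible coefficients. *)
Definition bary (K : knots) (x : R * R) : 'I_10 -> R :=
  xget (fun=> 0) (bary_spec K x).

(* The recursion is driven by d = |K| - 3. *)
Fixpoint Qrec (d : nat) (K : knots) (x : R * R) : R :=
  if area (knots_hull K) == 0 then 0 else
  match d with
  | 0 => \1_(knots_hull K) x * (area region / area (knots_hull K))
  | d'.+1 => \sum_j bary K x j * Qrec d' (knots_remove K j) x
  end.

Definition Qgen (K : knots) (x : R * R) : R := Qrec (knots_card K - 3) K x.

Definition generic : set (R * R) :=
  [set x | forall i j : 'I_10, i != j -> ~ line (vert i) (vert j) x].

(* Extension by continuity, from inside the triangle. *)
Definition Qext (K : knots) (p : R * R) : R :=
  lim (Qgen K x @[x --> within (region `&` generic) (nbhs p)]).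

Definition Q (i j k l m n : nat) : R * R -> R :=
  Qext (fun r => nth 0%N [:: i; j; k; l; m; n] r).

(* (a, b, c): the vertex a with opposing edge [b, c], and the edge [a, b] with
   opposing vertex c. *)
Definition corners : seq ((R * R) * (R * R) * (R * R)) :=
  [:: (v1, v2, v3); (v2, v3, v1); (v3, v1, v2)].

Definition eps_vertex (v x y : R * R) (i j : nat) : (R * R -> R) -> R :=
  fun f => iter i (dirD region x) (iter j (dirD region y) f) v.

Definition eps_point (q u : R * R) (i : nat) : (R * R -> R) -> R :=
  fun f => iter i (dirD region u) f q.

Definition Lambda : set ((R * R -> R) -> R) :=
  [set l | exists a b c, [/\ (a, b, c) \in corners &
     (exists i j : nat, (i + j <= 3)%N /\ l = eps_vertex a (b - a) (c - a) i j)
     \/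
     (let m := midpoint a b in
      let u := c - m in
      [\/ l = eps_point (4^-1 *: (3 *: a + b)) u 2,
          l = eps_point m u 1
        | l = eps_point (4^-1 *: (a + 3 *: b)) u 2])]].

Definition is_dual (l : (R * R -> R) -> R) (s : R * R -> R) : Prop :=
  [/\ S35 s, l s = 1 & forall m, Lambda m -> m <> l -> m s = 0].

(* The dual spline of l exists, is unique as a function on the triangle, and
   coincides there with g. *)
Definition dual_eq (l : (R * R -> R) -> R) (g : R * R -> R) : Prop :=
  Lambda l /\ forall s, is_dual l s <-> (forall p, region p -> s p = g p).

End TwelveSplit.

(* Main.v *)
From Stdlib Require Import ZArith.
Require Import Defs.
From mathcomp Require Import all_boot all_order all_algebra.
From mathcomp Require Import all_classical all_reals all_analysis.
From mathcomp Require Import measurable_realfun.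
From mathcomp Require Import ring lra ssrZ.

(** In barycentric coordinates X = (X1, X2, X3) with respect to T every polynomial
of degree at most 5 is a homogeneous form of degree 5, given by its
Bernstein-Bezier coefficients, here called a net.  Fixing arguments of its polar
form (blossom) is de Casteljau's linear step on nets ([step]): evaluating at X
fixes all arguments at X, and differentiating in direction u replaces one X by
the coordinates of u ([is_derive_eval]).  A spline on T12 thus becomes twelve
nets, and each claim about it becomes linear algebra on their entries.

Smoothness.  A piecewise polynomial of degree 5 is C^3 exactly when, at each
point X shared by two pieces, the two nets agree after two steps at X
([piecewise_Cn], [Cn_compat]).  Two pieces meet in the hull of their common
vertices ([piece_common]), so it suffices to take steps at these vertices
([zcompatP]).

Simplex splines.  Homogenizing the recursion shows why its value does not depend
on the coefficients: on a fixed piece let Q[K] be the form c_K of degree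
d = |K| - 3.  If step v_j c_K = c_(K - v_j) for every v_j in K, that is, if the
derivative of c_K along v_j is d times c_(K - v_j), then for whatever
coefficients b_j with x = sum_j b_j v_j one has
sum_j b_j Q[K - v_j](x) = step (sum_j b_j v_j) c_K = c_K(x).
All nets needed are integral; they are tabulated and the identities
step v_j c_K = c_(K - v_j) are checked by computation ([table_okP]), which gives
the values of the recursion at generic points ([Qrec_net]), and by density of
these points the continuous extensions ([Qext_piecewise]).  The bottom of the
recursion needs the areas of triangles, obtained from the behaviour of the
product measure under shears ([mu2_tri]).

Duality.  The smoothness conditions together with the vanishing of the 39
functionals form a homogeneous integral system in the 252 coefficients of the
twelve nets, and Gaussian elimination shows that it has full rank
([all_rows_full_rank], [unisolvent]).  Hence a function of the spline space is
determined by the values of the functionals, and a combination of simplex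
splines is the dual spline of a functional as soon as the 39 values are those
expected ([dual_eqP]); these values are polar forms of an integer net, evaluated
by computation ([dual_combination]). *)

Set Implicit Arguments.
Unset Strict Implicit.
Unset Printing Implicit Defensive.
Import Order.TTheory GRing.Theory Num.Theory.
Import numFieldNormedType.Exports.
Local Open Scope classical_set_scope.
Local Open Scope ring_scope.
Delimit Scope Z_scope with BZ.

(** * Nets of coefficients and polar forms *)

Section Nets.
Context {F : comNzRingType}.
Implicit Types (X Y : F * F * F) (c : nat -> nat -> F) (d n r i j : nat).

(** A net holds the coefficients of a form of degree d in three variables:
[c i j] is the coefficient of d! / (i! j! k!) x^i y^j z^k with k = d - i - j.
Since k is implicit the same type serves all degrees, and fixing one argument of
the polar form at X is the following linear map, de Casteljau's step. *)
Definition step X c : nat -> nat -> F :=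
  fun i j => X.1.1 * c i.+1 j + X.1.2 * c i j.+1 + X.2 * c i j.

Definition polar (s : seq (F * F * F)) c : F := foldr step c s 0%N 0%N.

Definition eval d c X : F := iter d (step X) c 0%N 0%N.

(** In degree r only the entries with i + j <= r have a meaning. *)
Definition agree r c c' := forall i j, (i + j <= r)%N -> c i j = c' i j.

Definition net_scale a c : nat -> nat -> F := fun i j => a * c i j.
Definition net_add c c' : nat -> nat -> F := fun i j => c i j + c' i j.

Lemma foldr_nseq (S T : Type) (f : S -> T -> T) n x y :
  foldr f y (nseq n x) = iter n (f x) y.
Proof. by elim: n => //= n ->. Qed.

Lemma netP c c' : (forall i j, c i j = c' i j) -> c = c'.
Proof. by move=> h; apply/funext => i; apply/funext => j. Qed.

Lemma agree_step r X c c' : agree r.+1 c c' -> agree r (step X c) (step X c').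
Proof.
move=> h i j ij; rewrite /step !h ?addSn ?addnS //; exact: (leq_trans ij).
Qed.

Lemma agree_iter n r X c c' : agree (n + r) c c' ->
  agree r (iter n (step X) c) (iter n (step X) c').
Proof.
elim: n c c' => // n IH c c' h.
by rewrite !iterSr; apply: IH; apply: agree_step.
Qed.

Lemma eval_agree d X c c' : agree d c c' -> eval d c X = eval d c' X.
Proof. by move=> h; apply: (@agree_iter d 0) => //; rewrite addn0. Qed.

Lemma eval_S d X c : eval d.+1 c X = eval d (step X c) X.
Proof. by rewrite /eval iterSr. Qed.

Lemma eval_add m d X c : eval (m + d) c X = eval d (iter m (step X) c) X.
Proof. by rewrite /eval addnC iterD. Qed.

(** The polar form is symmetric in its arguments. *)
Lemma stepC X Y c : step X (step Y c) = step Y (step X c).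
Proof. by apply/netP => i j; rewrite /step; ring. Qed.

Lemma step_iterC X Y n c :
  step X (iter n (step Y) c) = iter n (step Y) (step X c).
Proof. by elim: n c => // n IH c; rewrite iterS stepC IH. Qed.

Lemma step_scale X a c : step X (net_scale a c) = net_scale a (step X c).
Proof. by apply/netP => i j; rewrite /step /net_scale; ring. Qed.

Lemma step_plus X c c' : step X (net_add c c') = net_add (step X c) (step X c').
Proof. by apply/netP => i j; rewrite /step /net_add; ring. Qed.

Lemma iter_scale n X a c :
  iter n (step X) (net_scale a c) = net_scale a (iter n (step X) c).
Proof. by elim: n => //= n ->; rewrite step_scale. Qed.

Lemma iter_plus n X c c' :
  iter n (step X) (net_add c c') = net_add (iter n (step X) c) (iter n (step X) c').
Proof. by elim: n => //= n ->; rewrite step_plus. Qed.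

Lemma eval_scale d a c X : eval d (net_scale a c) X = a * eval d c X.
Proof. by rewrite /eval iter_scale. Qed.

Lemma eval_plus d c c' X : eval d (net_add c c') X = eval d c X + eval d c' X.
Proof. by rewrite /eval iter_plus. Qed.

Lemma polar_scale s a c : polar s (net_scale a c) = a * polar s c.
Proof.
rewrite /polar -[RHS]/(net_scale a (foldr step c s) _ _); congr (_ 0%N 0%N).
by elim: s => //= X s ->; rewrite step_scale.
Qed.

Lemma polar_plus s c c' : polar s (net_add c c') = polar s c + polar s c'.
Proof.
rewrite /polar -[RHS]/(net_add (foldr step c s) (foldr step c' s) _ _).
congr (_ 0%N 0%N).
by elim: s => //= X s ->; rewrite step_plus.
Qed.

Lemma step_addl X Y c :
  step (X + Y) c = net_add (step X c) (step Y c).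
Proof. by apply/netP => i j; rewrite /step /net_add /=; ring. Qed.

(** One argument of the polar form is expanded along the unit vectors; this
recursion on the degree carries the continuity and differentiability of forms. *)
Lemma eval_first d c X : eval d.+1 c X =
  X.1.1 * eval d (fun i => c i.+1) X + X.1.2 * eval d (fun i j => c i j.+1) X
  + X.2 * eval d c X.
Proof.
rewrite eval_S -!eval_scale -!eval_plus; congr eval.
Qed.

(** The nets [mul1 c], [mul2 c] and [mul3 d.+1%:R c] represent d + 1 times the
product of a form of degree d by a coordinate; the third one needs the degree
because k is implicit. *)
Definition mul1 c : nat -> nat -> F := fun i j => i%:R * c i.-1 j.
Definition mul2 c : nat -> nat -> F := fun i j => j%:R * c i j.-1.
Definition mul3 a c : nat -> nat -> F := fun i j => (a - i%:R - j%:R) * c i j.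

(** Leibniz rule for the polar form of a product with a linear form. *)
Lemma step_mul1 X c : step X (mul1 c) = net_add (net_scale X.1.1 c) (mul1 (step X c)).
Proof.
apply/netP => -[|i] j; rewrite /step /net_add /mul1 /net_scale /=; first by ring.
rewrite -[i.+2]addn1 -[i.+1]addn1 !natrD; ring.
Qed.

Lemma step_mul2 X c : step X (mul2 c) = net_add (net_scale X.1.2 c) (mul2 (step X c)).
Proof.
apply/netP => i [|j]; rewrite /step /net_add /mul2 /net_scale /=; first by ring.
rewrite -[j.+2]addn1 -[j.+1]addn1 !natrD; ring.
Qed.

Lemma step_mul3 X a c :
  step X (mul3 a c) = net_add (net_scale X.2 c) (mul3 (a - 1) (step X c)).
Proof.
apply/netP => i j; rewrite /step /net_add /mul3 /net_scale /=.
rewrite -[i.+1]addn1 -[j.+1]addn1 !natrD; ring.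
Qed.

Lemma eval_mul1 d c X : eval d.+1 (mul1 c) X = d.+1%:R * (X.1.1 * eval d c X).
Proof.
elim: d c => [|d IH] c; first by rewrite /eval /= /step /mul1 /=; ring.
rewrite eval_S step_mul1 eval_plus eval_scale IH -eval_S.
rewrite -[d.+2]addn1 natrD; ring.
Qed.

Lemma eval_mul2 d c X : eval d.+1 (mul2 c) X = d.+1%:R * (X.1.2 * eval d c X).
Proof.
elim: d c => [|d IH] c; first by rewrite /eval /= /step /mul2 /=; ring.
rewrite eval_S step_mul2 eval_plus eval_scale IH -eval_S.
rewrite -[d.+2]addn1 natrD; ring.
Qed.

Lemma eval_mul3 d c X :
  eval d.+1 (mul3 d.+1%:R c) X = d.+1%:R * (X.2 * eval d c X).
Proof.
elim: d c => [|d IH] c; first by rewrite /eval /= /step /mul3 /=; ring.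
rewrite eval_S step_mul3 eval_plus eval_scale.
rewrite -[d.+2%:R - 1]/(d.+2%:R - 1%:R) -natrB // subn1 IH -eval_S.
rewrite -[d.+2]addn1 natrD; ring.
Qed.

End Nets.

(** * Barycentric coordinates *)

Definition det3 {F : comNzRingType} (A B C : F * F * F) : F :=
  A.1.1 * (B.1.2 * C.2 - B.2 * C.1.2) - A.1.2 * (B.1.1 * C.2 - B.2 * C.1.1)
  + A.2 * (B.1.1 * C.1.2 - B.1.2 * C.1.1).

Definition weight {F : comNzRingType} (A : F * F * F) : F := A.1.1 + A.1.2 + A.2.

Section Coords.
Context {R : realType}.
Variables v1 v2 v3 : R * R.
Hypothesis nd : nondegenerate_triangle (Triangle v1 v2 v3).
Implicit Types (p q u : R * R) (X Y A B C U : R * R * R).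

Definition cross (p q : R * R) : R := p.1 * q.2 - p.2 * q.1.
Let D := cross (v2 - v1) (v3 - v1).

Definition pt X : R * R := X.1.1 *: v1 + X.1.2 *: v2 + X.2 *: v3.

(** Points have coordinates of weight 1 and vectors have coordinates of
weight 0; [dcoords] is the linear part of the affine map [coords]. *)
Definition dcoords u : R * R * R :=
  let s := cross u (v3 - v1) / D in
  let t := cross (v2 - v1) u / D in (- s - t, s, t).

Definition coords p : R * R * R := (1, 0, 0) + dcoords (p - v1).

Let D0 : D != 0. Proof. exact: nd. Qed.

Lemma pairE (p q : R * R) : p.1 = q.1 -> p.2 = q.2 -> p = q.
Proof. by case: p q => [? ?] [? ?] /= -> ->. Qed.

Lemma tripleE A B : A.1.1 = B.1.1 -> A.1.2 = B.1.2 -> A.2 = B.2 -> A = B.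
Proof. by case: A B => [[? ?] ?] [[? ?] ?] /= -> -> ->. Qed.

Lemma weight_coords p : weight (coords p) = 1.
Proof. by rewrite /weight /coords /dcoords /=; ring. Qed.

Lemma pt_dcoords u : pt (dcoords u) = u.
Proof.
have := D0; rewrite /pt /dcoords /D /cross => h.
by apply: pairE; rewrite /= /GRing.scale /=; field.
Qed.

Lemma dcoords_pt U : weight U = 0 -> dcoords (pt U) = U.
Proof.
have := D0; rewrite /pt /dcoords /D /cross /weight => h w.
have e1 : U.1.1 = - U.1.2 - U.2 by lra.
by apply: tripleE; rewrite /= /GRing.scale /= ?e1; field.
Qed.

Lemma pt_coords p : pt (coords p) = p.
Proof.
rewrite -[RHS](subrK v1) -[in RHS](pt_dcoords (p - v1)) /pt /coords.
by apply: pairE; rewrite /= /GRing.scale /=; ring.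
Qed.

Lemma coords_pt X : weight X = 1 -> coords (pt X) = X.
Proof.
move=> w; rewrite /coords.
have -> : pt X - v1 = pt (X - (1, 0, 0)).
  by rewrite /pt; apply: pairE; rewrite /= /GRing.scale /=; ring.
rewrite dcoords_pt; first by rewrite addrC subrK.
by move: w; rewrite /weight /=; lra.
Qed.

Lemma coords_add p u (h : R) :
  coords (p + h *: u) = coords p + h *: dcoords u.
Proof.
by rewrite /coords /dcoords /cross; apply: tripleE;
  rewrite /= /GRing.scale /=; ring.
Qed.

Lemma conv_hull3 a b c p : conv_hull [:: a; b; c] p <->
  exists x y z, [/\ 0 <= x, 0 <= y, 0 <= z, x + y + z = 1 &
    p = x *: a + y *: b + z *: c].
Proof.
split=> [[w [w0 w1 ->]]|[x [y [z [x0 y0 z0 s ->]]]]].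
  exists (w ord0), (w (lift ord0 ord0)), (w (lift ord0 (lift ord0 ord0))).
  split=> //; first by rewrite -w1 !big_ord_recl big_ord0 addr0 addrA.
  by rewrite !big_ord_recl big_ord0 addr0 addrA.
exists (fun i : 'I_3 => nth 0 [:: x; y; z] i); split.
- by move=> [[|[|[|//]]] ?].
- by rewrite !big_ord_recl big_ord0 /= addr0 addrA.
- by rewrite !big_ord_recl big_ord0 /= addr0 addrA.
Qed.

Lemma cramer A B C X (i : R * R * R -> R) :
  i = (fun Z => Z.1.1) \/ i = (fun Z => Z.1.2) \/ i = (fun Z => Z.2) ->
  det3 A B C * i X =
  det3 X B C * i A + det3 A X C * i B + det3 A B X * i C.
Proof. by rewrite /det3; move=> [->|[->|->]]; ring. Qed.

Lemma weight_det A B C X : weight A = 1 -> weight B = 1 -> weight C = 1 -> weight X = 1 ->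
  det3 X B C + det3 A X C + det3 A B X = det3 A B C.
Proof.
move=> wA wB wC wX; rewrite /weight in wA wB wC wX.
have -> : det3 A B C = det3 A B C * (X.1.1 + X.1.2 + X.2) by rewrite wX mulr1.
rewrite -[LHS]mulr1.
transitivity (det3 X B C * (A.1.1 + A.1.2 + A.2)
  + det3 A X C * (B.1.1 + B.1.2 + B.2) + det3 A B X * (C.1.1 + C.1.2 + C.2)).
  by rewrite wA wB wC; ring.
by rewrite /det3; ring.
Qed.

Lemma pt_comb3 A B C x y z :
  x *: pt A + y *: pt B + z *: pt C = pt (x *: A + y *: B + z *: C).
Proof. by rewrite /pt; apply: pairE; rewrite /= /GRing.scale /=; ring. Qed.

Lemma weight_comb3 A B C x y z : weight A = 1 -> weight B = 1 -> weight C = 1 ->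
  weight (x *: A + y *: B + z *: C) = x + y + z.
Proof.
rewrite /weight => wA wB wC; rewrite /= /GRing.scale /=.
transitivity (x * (A.1.1 + A.1.2 + A.2) + y * (B.1.1 + B.1.2 + B.2)
  + z * (C.1.1 + C.1.2 + C.2)); first by ring.
by rewrite wA wB wC; ring.
Qed.

(** The barycentric coordinates of p in the triangle A B C are quotients of
determinants by Cramer's rule. *)
Lemma hull3P A B C p : weight A = 1 -> weight B = 1 -> weight C = 1 ->
    det3 A B C != 0 ->
  conv_hull [:: pt A; pt B; pt C] p <->
  [/\ 0 <= det3 (coords p) B C / det3 A B C,
      0 <= det3 A (coords p) C / det3 A B C &
      0 <= det3 A B (coords p) / det3 A B C].
Proof.
move=> wA wB wC d0; rewrite conv_hull3; split.
  move=> [x [y [z [x0 y0 z0 s ->]]]].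
  rewrite pt_comb3 coords_pt ?weight_comb3 //.
  split.
  - rewrite (_ : _ / _ = x) //; rewrite /det3 in d0 *.
    by rewrite /= /GRing.scale /=; field.
  - rewrite (_ : _ / _ = y) //; rewrite /det3 in d0 *.
    by rewrite /= /GRing.scale /=; field.
  - rewrite (_ : _ / _ = z) //; rewrite /det3 in d0 *.
    by rewrite /= /GRing.scale /=; field.
move=> [h1 h2 h3]; set X := coords p in h1 h2 h3.
exists (det3 X B C / det3 A B C), (det3 A X C / det3 A B C),
  (det3 A B X / det3 A B C); split=> //.
  by rewrite -!mulrDl weight_det ?weight_coords // divff.
rewrite pt_comb3 -[LHS]pt_coords -/X; congr pt.
have e i h := @cramer A B C X i h.
have f x : x = det3 A B C * x / det3 A B C by rewrite mulrAC divff // mul1r.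
apply: tripleE; rewrite [LHS]f.
- by rewrite (e (fun Z => Z.1.1)); [rewrite /= /GRing.scale /=; ring|left].
- by rewrite (e (fun Z => Z.1.2)); [rewrite /= /GRing.scale /=; ring|right; left].
- by rewrite (e (fun Z => Z.2)); [rewrite /= /GRing.scale /=; ring|right; right].
Qed.

End Coords.

(** * Polynomials and triangles in the plane *)

Section Topo.
Context {R : realType}.
Variables v1 v2 v3 : R * R.
Hypothesis nd : nondegenerate_triangle (Triangle v1 v2 v3).
Implicit Types (p q u : R * R) (X Y A B C U : R * R * R).
Local Notation coords := (coords v1 v2 v3).
Local Notation dcoords := (dcoords v1 v2 v3).
Local Notation pt := (pt v1 v2 v3).

Definition lin (a X : R * R * R) : R := a.1.1 * X.1.1 + a.1.2 * X.1.2 + a.2 * X.2.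

Lemma lin_coordsE a p u (h : R) :
  lin a (coords (p + h *: u)) = lin a (coords p) + h * lin a (dcoords u).
Proof. by rewrite coords_add /lin /= /GRing.scale /=; ring. Qed.

Lemma lin_coords_continuous a : continuous (fun p => lin a (coords p)).
Proof.
pose l := lin a (coords 0).
pose x := lin a (dcoords (1, 0)); pose y := lin a (dcoords (0, 1)).
have -> : (fun p => lin a (coords p)) = (fun p => l + p.1 * x + p.2 * y).
  apply/funext => p; rewrite -!lin_coordsE; congr (lin a (coords _)).
  by apply: pairE; rewrite /= /GRing.scale /=; ring.
move=> p; apply: cvgD; first apply: cvgD; first exact: cvg_cst.
  by apply: cvgMl; exact: cvg_fst.
by apply: cvgMl; exact: cvg_snd.
Qed.

Lemma is_derive_affine (g : R * R -> R) p u l :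
  (forall h : R, g (p + h *: u) = g p + h * l) -> is_derive p u g l.
Proof.
move=> gE.
have e : (fun h : R => h^-1 *: ((g \o shift p) (h *: u) - g p)) @ 0^' --> (l : R).
  apply: (@cvg_trans _ ((fun=> l) @ 0^')); last exact: cvg_cst.
  apply: near_eq_cvg; near=> h => /=.
  rewrite addrC [h *: u + p]addrC gE addKr /GRing.scale /= mulKf //.
  near: h; exact: nbhs_dnbhs_neq.
split; first exact: cvgP e.
exact: cvg_lim e.
Unshelve. all: by end_near. Qed.

Lemma is_derive_lin a p u :
  is_derive p u (fun q => lin a (coords q)) (lin a (dcoords u)).
Proof. by apply: is_derive_affine => h; rewrite lin_coordsE. Qed.

Lemma coord1E X : X.1.1 = lin (1, 0, 0) X. Proof. by rewrite /lin /=; ring. Qed.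
Lemma coord2E X : X.1.2 = lin (0, 1, 0) X. Proof. by rewrite /lin /=; ring. Qed.
Lemma coord3E X : X.2 = lin (0, 0, 1) X. Proof. by rewrite /lin /=; ring. Qed.

Lemma eval_coordsE d c : (fun p => eval d.+1 c (coords p)) = (fun p =>
  lin (1, 0, 0) (coords p) * eval d (fun i => c i.+1) (coords p) +
  lin (0, 1, 0) (coords p) * eval d (fun i j => c i j.+1) (coords p) +
  lin (0, 0, 1) (coords p) * eval d c (coords p)).
Proof. by apply/funext => p; rewrite eval_first -coord1E -coord2E -coord3E. Qed.

Lemma eval_continuous d c : continuous (fun p => eval d c (coords p)).
Proof.
elim: d c => [|d IH] c; first by rewrite /eval /= => p; exact: cvg_cst.
rewrite eval_coordsE => p.
by apply: cvgD; [apply: cvgD|]; apply: cvgM;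
   by [exact: lin_coords_continuous|exact: IH].
Qed.

(** Leibniz rule along [eval_first]: each of the d equal arguments of the
polar form contributes the same term, with that argument replaced by the
coordinates of u. *)
Lemma is_derive_eval d c p u :
  is_derive p u (fun q => eval d c (coords q))
    (d%:R * eval d.-1 (step (dcoords u) c) (coords p)).
Proof.
elim: d c => [|d IH] c.
  by rewrite mul0r /eval /=; exact: is_derive_cst.
rewrite eval_coordsE.
have i1 := is_deriveM (is_derive_lin (1, 0, 0) p u) (IH (fun i => c i.+1)).
have i2 := is_deriveM (is_derive_lin (0, 1, 0) p u) (IH (fun i j => c i j.+1)).
have i3 := is_deriveM (is_derive_lin (0, 0, 1) p u) (IH c).
have := is_deriveD (is_deriveD i1 i2) i3.
set l := (X in is_derive _ _ _ X -> _) => H.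
have -> : d.+1%:R * eval d.+1.-1 (step (dcoords u) c) (coords p) = l; last exact: H.
rewrite /l {l H i1 i2 i3 IH}; move: (coords p) (dcoords u) => X U.
rewrite /GRing.scale /= -!coord1E -!coord2E -!coord3E.
set Q := eval d (step U c) X.
have q : Q = U.1.1 * eval d (fun i => c i.+1) X +
    U.1.2 * eval d (fun i j => c i j.+1) X + U.2 * eval d c X.
  by rewrite -!eval_scale -!eval_plus.
case: d @Q q => [|d] Q q /=; first by rewrite q; ring.
have e : Q = X.1.1 * eval d (step U (fun i => c i.+1)) X +
   X.1.2 * eval d (step U (fun i j => c i j.+1)) X + X.2 * eval d (step U c) X.
  exact: eval_first.
rewrite -[d.+2]addn1 natrD mulrDl mul1r [in X in X + _ = _]e [in LHS]q; ring.
Qed.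

(** [face1], [face2] and [face3] are the barycentric coordinates with respect to
the triangle A B C of the point with coordinates X. *)
Definition face1 A B C X := det3 X B C / det3 A B C.
Definition face2 A B C X := det3 A X C / det3 A B C.
Definition face3 A B C X := det3 A B X / det3 A B C.

Lemma face1E A B C : exists a, face1 A B C = lin a.
Proof.
exists ((B.1.2 * C.2 - B.2 * C.1.2) / det3 A B C,
  (B.2 * C.1.1 - B.1.1 * C.2) / det3 A B C,
  (B.1.1 * C.1.2 - B.1.2 * C.1.1) / det3 A B C).
by apply/funext => X; rewrite /face1 /lin; set d := det3 A B C;
  rewrite /det3 /=; ring.
Qed.

Lemma face2E A B C : exists a, face2 A B C = lin a.
Proof.
exists ((A.2 * C.1.2 - A.1.2 * C.2) / det3 A B C,
  (A.1.1 * C.2 - A.2 * C.1.1) / det3 A B C,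
  (A.1.2 * C.1.1 - A.1.1 * C.1.2) / det3 A B C).
by apply/funext => X; rewrite /face2 /lin; set d := det3 A B C;
  rewrite /det3 /=; ring.
Qed.

Lemma face3E A B C : exists a, face3 A B C = lin a.
Proof.
exists ((A.1.2 * B.2 - A.2 * B.1.2) / det3 A B C,
  (A.2 * B.1.1 - A.1.1 * B.2) / det3 A B C,
  (A.1.1 * B.1.2 - A.1.2 * B.1.1) / det3 A B C).
by apply/funext => X; rewrite /face3 /lin; set d := det3 A B C;
  rewrite /det3 /=; ring.
Qed.

Definition open_tri A B C : set (R * R) := [set p |
  [/\ 0 < face1 A B C (coords p), 0 < face2 A B C (coords p) &
      0 < face3 A B C (coords p)]].

Lemma lin_gt0_open a : open [set p | 0 < lin a (coords p)].
Proof.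
apply: (@open_comp _ _ (fun p => lin a (coords p)) [set x | 0 < x]).
  by move=> p _; exact: lin_coords_continuous.
exact: open_gt.
Qed.

Lemma lin_ge0_closed a : closed [set p | 0 <= lin a (coords p)].
Proof.
apply: (@closed_comp _ _ (fun p => lin a (coords p)) [set x | 0 <= x]).
  by move=> p _; exact: lin_coords_continuous.
exact: closed_ge.
Qed.

Lemma open_tri_open A B C : open (open_tri A B C).
Proof.
have [a ea] := face1E A B C; have [b eb] := face2E A B C.
have [c ec] := face3E A B C.
rewrite (_ : open_tri A B C = [set p | 0 < lin a (coords p)] `&`
   [set p | 0 < lin b (coords p)] `&` [set p | 0 < lin c (coords p)]).
  by do 2 ?apply: openI; exact: lin_gt0_open.
by apply/seteqP; split => p; rewrite /open_tri /= ea eb ec;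
  [case|case=> -[]].
Qed.

Section OneTriangle.
Variables A B C : R * R * R.
Hypotheses (wA : weight A = 1) (wB : weight B = 1) (wC : weight C = 1).
Hypothesis d0 : det3 A B C != 0.
Let T := conv_hull [:: pt A; pt B; pt C].

Lemma tri_closed : closed T.
Proof.
have [a ea] := face1E A B C; have [b eb] := face2E A B C.
have [c ec] := face3E A B C.
rewrite (_ : T = [set p | 0 <= lin a (coords p)] `&`
   [set p | 0 <= lin b (coords p)] `&` [set p | 0 <= lin c (coords p)]).
  by do 2 ?apply: closedI; exact: lin_ge0_closed.
apply/seteqP; split => p /=; rewrite -ea -eb -ec.
  by move=> /(hull3P nd p wA wB wC d0)[].
by move=> [[? ?] ?]; apply/(hull3P nd p wA wB wC d0).
Qed.

Lemma open_tri_sub : open_tri A B C `<=` T.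
Proof.
by move=> p [h1 h2 h3]; apply/(hull3P nd p wA wB wC d0); split; exact: ltW.
Qed.

(** The segment from a point of the triangle to the barycentre lies in the
interior, except for its origin. *)
Lemma tri_closure : T `<=` closure (open_tri A B C).
Proof.
move=> p /(hull3P nd p wA wB wC d0)[h1 h2 h3].
pose g := pt (3^-1 *: (A + B + C)).
have wg : weight (3^-1 *: (A + B + C)) = 1.
  by move: wA wB wC; rewrite /weight /= /GRing.scale /=; lra.
have [a ea] := face1E A B C; have [b eb] := face2E A B C.
have [c ec] := face3E A B C.
have seg (h : R) : 0 < h -> h <= 1 -> open_tri A B C (p + h *: (g - p)).
  move=> h0 hle1.
  have gE l : lin l (coords (p + h *: (g - p))) =
      (1 - h) * lin l (coords p) + h * lin l (3^-1 *: (A + B + C)).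
    rewrite lin_coordsE.
    rewrite (_ : lin l (dcoords (g - p)) =
       lin l (coords g) - lin l (coords p)); last first.
      by have := lin_coordsE l p (g - p) 1; rewrite scale1r subrKC => ->; ring.
    by rewrite /g coords_pt //; ring.
  rewrite /open_tri /= ea eb ec !gE -ea -eb -ec.
  have k1 : face1 A B C (3^-1 *: (A + B + C)) = 3^-1.
    by move: d0; rewrite /face1 /det3 /= /GRing.scale /= => ?; field.
  have k2 : face2 A B C (3^-1 *: (A + B + C)) = 3^-1.
    by move: d0; rewrite /face2 /det3 /= /GRing.scale /= => ?; field.
  have k3 : face3 A B C (3^-1 *: (A + B + C)) = 3^-1.
    by move: d0; rewrite /face3 /det3 /= /GRing.scale /= => ?; field.
  rewrite k1 k2 k3.
  have P x : 0 <= x -> 0 < (1 - h) * x + h * 3^-1.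
    move=> x0; apply: ltr_wpDl; first by apply: mulr_ge0 => //; lra.
    by apply: mulr_gt0 => //; lra.
  by split; apply: P.
move=> V /= nV.
have cv : (fun h : R => p + h *: (g - p)) @ 0^'+ --> p.
  rewrite [X in _ --> X](_ : p = p + (0 : R) *: (g - p)); last first.
    by rewrite scale0r addr0.
  apply: cvgD; first exact: cvg_cst.
  apply: cvgZr_tmp.
  by apply: cvg_at_right_filter; exact: cvg_id.
have H : \forall h \near (0 : R)^'+, V (p + h *: (g - p)) by exact: cv.
have [h [Vh [h0 hle1]]] : exists h : R, V (p + h *: (g - p)) /\ 0 < h /\ h <= 1.
  near (0 : R)^'+ => h; exists h; split; first by near: h.
  split; first by near: h; exact: nbhs_right_gt.
  by near: h; exact: nbhs_right_le.
by exists (p + h *: (g - p)); split => //; exact: seg.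
Unshelve. all: by end_near. Qed.

End OneTriangle.
End Topo.

(** * Piecewise polynomials over a finite closed cover *)

(** The limit of a function that coincides near F with one of finitely many
functions, possibly a different one at each point, all with the same limit.
All limits of piecewise functions below are computed in this way. *)
Lemma cvg_paste {R : realType} {I : finType} {T : Type} (F : set_system T)
    {FF : Filter F} (g : T -> R) (G : I -> T -> R) (good : I -> Prop) (l : R) :
  (\forall t \near F, exists2 k, good k & g t = G k t) ->
  (forall k, good k -> G k t @[t --> F] --> l) -> g t @[t --> F] --> l.
Proof.
move=> gG Gl; apply/cvgrPdist_lt => e e0.
have H : \forall t \near F, forall k, good k -> `|l - G k t| < e.
  apply: filter_forall => k; have [gk|gk] := pselect (good k); last first.
    by near=> t => /gk.
  by have /cvgrPdist_lt/(_ e e0) := Gl k gk; apply: filterS.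
near=> t.
have [k gk ->] : exists2 k, good k & g t = G k t by near: t.
by move: k gk; near: t.
Unshelve. all: by end_near. Qed.

Section Piecewise.
Context {R : realType}.
Variables v1 v2 v3 : R * R.
Hypothesis nd : nondegenerate_triangle (Triangle v1 v2 v3).
Implicit Types (p q u : R * R) (X Y U : R * R * R).
Local Notation coords := (coords v1 v2 v3).
Local Notation dcoords := (dcoords v1 v2 v3).
Local Notation pt := (pt v1 v2 v3).

Variables (I : finType) (A : set (R * R)) (P O : I -> set (R * R)).
Hypothesis Pclosed : forall k, closed (P k).
Hypothesis Oopen : forall k, open (O k).
Hypothesis OP : forall k, O k `<=` P k.
Hypothesis PO : forall k, P k `<=` closure (O k).
Hypothesis PA : forall p, A p <-> exists k, P k p.

Implicit Types (c : I -> nat -> nat -> R) (f : R * R -> R).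

Definition piecewise d c f :=
  forall k p, P k p -> f p = eval d (c k) (coords p).

(** For forms of degree n + r this says that all derivatives of order at most r
of the two pieces agree at the common point p: such derivatives have at least n
arguments of the polar form equal to the coordinates of p. *)
Definition compat n r c := forall k l p, P k p -> P l p ->
  agree r (iter n (step (coords p)) (c k)) (iter n (step (coords p)) (c l)).

(** The net of the derivative along u of a form of degree m. *)
Definition derived_net m u c : I -> nat -> nat -> R :=
  fun k => net_scale m%:R (step (dcoords u) (c k)).

(** The pieces are closed and finite in number. *)
Lemma near_pieces p : \forall q \near p, forall k, P k q -> P k p.
Proof.
apply: (@filter_forall _ I (fun k => [set q | P k q -> P k p]) _
  (nbhs_filter p)) => k.
have [Pp|nPp] := pselect (P k p); first by near=> q.
have : nbhs p (~` P k).
  by apply: open_nbhs_nbhs; split => //; exact: closed_openC.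
by apply: filterS => q nPq /nPq.
Unshelve. all: by end_near. Qed.

Lemma O_sub_interior k : O k `<=` A°.
Proof.
rewrite -open_subsetE; last exact: Oopen.
by move=> p Op; apply/PA; exists k; exact: OP.
Qed.

Lemma closure_interior k p : P k p -> closure A° p.
Proof. by move=> /PO; apply: closureS; exact: O_sub_interior. Qed.

(** A function given by forms on overlapping closed pieces takes the same values
on the overlaps, which is what continuity across the pieces asks for. *)
Lemma piecewise_continuous d c f :
  piecewise d c f -> {within A, continuous f}.
Proof.
move=> pf; apply/subspace_continuousP => p /PA[k Pk].
apply: (@cvg_paste _ _ _ _ _ _ (fun l q => eval d (c l) (coords q))
   (fun l => P l p)).
  near=> q; have /PA[l Pl] : A q by near: q; exact: withinT.
  exists l; last exact: pf.
  suff : forall l, P l q -> P l p by apply.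
  by near: q; apply: cvg_within; exact: near_pieces.
move=> l Pl; rewrite /from_subspace (pf _ _ Pl); apply: cvg_trans.
  by apply: cvg_app; exact: cvg_within.
exact: eval_continuous.
Unshelve. all: by end_near. Qed.

Lemma compat_eval n r c k l p : compat n r c -> P k p -> P l p ->
  eval (n + r) (c k) (coords p) = eval (n + r) (c l) (coords p).
Proof. by move=> cc Pk Pl; rewrite !eval_add; apply: eval_agree; exact: cc. Qed.

Lemma compat_derived_net n r m u c : compat n r.+1 c -> compat n r (derived_net m u c).
Proof.
move=> cc k l p Pk Pl i j ij; rewrite /derived_net !iter_scale /net_scale.
rewrite -!step_iterC; congr (_ * _).
by apply: agree_step ij; exact: cc.
Qed.

Lemma compat_scale n r a c : compat n r c -> compat n r (fun k => net_scale a (c k)).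
Proof.
move=> cc k l p Pk Pl i j ij; rewrite !iter_scale /net_scale; congr (_ * _).
exact: cc.
Qed.

Lemma compat_plus n r c c' : compat n r c -> compat n r c' ->
  compat n r (fun k => net_add (c k) (c' k)).
Proof.
move=> cc cc' k l p Pk Pl i j ij; rewrite !iter_plus /net_add.
by rewrite (cc k l p Pk Pl) // (cc' k l p Pk Pl).
Qed.

Lemma piecewise_scale d a c f : piecewise d c f ->
  piecewise d (fun k => net_scale a (c k)) (fun p => a * f p).
Proof. by move=> cf k p Pk; rewrite eval_scale (cf _ _ Pk). Qed.

Lemma piecewise_plus d c f c' f' : piecewise d c f -> piecewise d c' f' ->
  piecewise d (fun k => net_add (c k) (c' k)) (fun p => f p + f' p).
Proof. by move=> h h' k p Pk; rewrite eval_plus (h _ _ Pk) (h' _ _ Pk). Qed.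

(** The point p + h u may lie in different pieces for different small h; all of
them contain p, and their forms have the same derivative along u at p. *)
Lemma piecewise_derive n r c f k p u :
  compat n r.+1 c -> piecewise (n + r.+1) c f -> A° p -> P k p ->
  is_derive p u f (eval (n + r) (derived_net (n + r.+1) u c k) (coords p)).
Proof.
move=> cc pf Ap Pk; set l := eval _ _ _.
have e : (fun h : R => h^-1 *: ((f \o shift p) (h *: u) - f p)) @ 0^'
    --> (l : R).
  apply: (@cvg_paste _ _ _ _ _ _
    (fun j h => h^-1 *: (((fun q => eval (n + r.+1) (c j) (coords q)) \o shift p)
       (h *: u) - eval (n + r.+1) (c j) (coords p))) (fun j => P j p)).
    have cv : (fun h : R => h *: u + p) @ 0^' --> p.
      rewrite [X in _ --> X](_ : p = (0 : R) *: u + p); last first.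
        by rewrite scale0r add0r.
      apply: cvgD; last exact: cvg_cst.
      by apply: cvgZr_tmp; apply: nbhs_dnbhs.
    have H1 : \forall h \near (0 : R)^', A (h *: u + p).
      exact: (cv _ Ap).
    have H2 : \forall h \near (0 : R)^', forall j, P j (h *: u + p) -> P j p.
      exact: (cv _ (near_pieces p)).
    near=> h.
    have /PA[j Pj] : A (h *: u + p) by near: h.
    have Pjp : P j p by move: j Pj; near: h.
    by exists j => //=; rewrite (pf _ _ Pj) (pf _ _ Pjp).
  move=> j Pj.
  have -> : l = (n + r.+1)%:R *
      eval (n + r.+1).-1 (step (dcoords u) (c j)) (coords p).
    rewrite -eval_scale addnS /=.
    rewrite /l (@compat_eval n r (derived_net (n + r.+1) u c) k j p) //.
      by rewrite /derived_net addnS.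
    exact: compat_derived_net.
  by have [dj <-] := is_derive_eval v1 v2 v3 (n + r.+1) (c j) p u.
by split; [exact: cvgP e|exact: cvg_lim e].
Unshelve. all: by end_near. Qed.

(** The limit defining [dirD] on the boundary is computed piecewise; pieces that
share p give the same value since their derived nets are again compatible. *)
Lemma piecewise_dirD n r c f u :
  compat n r.+1 c -> piecewise (n + r.+1) c f ->
  piecewise (n + r) (derived_net (n + r.+1) u c) (dirD A u f).
Proof.
move=> cc pf k p Pk; have pr := within_nbhs_proper (closure_interior Pk).
apply: cvg_lim => //.
apply: (@cvg_paste _ _ _ _ _ _
   (fun l q => eval (n + r) (derived_net (n + r.+1) u c l) (coords q))
   (fun l => P l p)).
  near=> q.
  have Aq : A° q by near: q; exact: withinT.
  have /PA[l Pl] := interior_subset Aq.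
  exists l.
    suff : forall l, P l q -> P l p by apply.
    by near: q; apply: cvg_within; exact: near_pieces.
  by have [_ ->] := piecewise_derive u cc pf Aq Pl.
move=> l Pl.
rewrite (@compat_eval n r (derived_net (n + r.+1) u c) k l p) //; last first.
  exact: compat_derived_net.
apply: cvg_trans; first by apply: cvg_app; exact: cvg_within.
exact: eval_continuous.
Unshelve. all: by end_near. Qed.

Lemma piecewise_Cn n r c f :
  compat n r c -> piecewise (n + r) c f -> Cn A r f.
Proof.
elim: r c f => [|r IH] c f cc pf /=; split=> //;
  try exact: piecewise_continuous pf.
move=> u; split; last first.
  by apply: (IH (derived_net (n + r.+1) u c));
     [exact: compat_derived_net|exact: piecewise_dirD].
move=> p Ap; have /PA[k Pk] := interior_subset Ap.
rewrite (piecewise_dirD u cc pf Pk); exact: piecewise_derive.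
Qed.

(** In the interior of a piece the derivative is that of the form; both sides
are continuous on the region, and the interior is dense in the piece. *)
Lemma Cn_piecewise_dirD d c f u r :
  Cn A r.+1 f -> piecewise d c f ->
  piecewise d.-1 (derived_net d u c) (dirD A u f).
Proof.
move=> [_ /(_ u)[df cf]] pf.
have cg : {within A, continuous (dirD A u f)} by case: r cf {df} => [|r] [].
have OE k q : O k q -> dirD A u f q = eval d.-1 (derived_net d u c k) (coords q).
  move=> Oq; have [_ <-] := df _ (O_sub_interior Oq).
  have e : \near q, f q = eval d (c k) (coords q).
    have : nbhs q (O k) by apply: open_nbhs_nbhs; split => //; exact: Oopen.
    by apply: filterS => q' /OP; exact: pf.
  rewrite (near_eq_derive _ e) eval_scale.
  by have [_ ->] := is_derive_eval v1 v2 v3 d (c k) q u.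
move=> k p Pk; have pr := within_nbhs_proper (PO Pk).
have c1 : dirD A u f q @[q --> within (O k) (nbhs p)] --> dirD A u f p.
  have /subspace_continuousP/(_ p) := cg.
  move=> /(_ (proj2 (PA p) (ex_intro _ k Pk))); apply: cvg_trans.
  apply: cvg_app; apply: within_subset.
  by apply: subset_trans; [exact: OP|move=> q Pq; apply/PA; exists k].
have c2 : dirD A u f q @[q --> within (O k) (nbhs p)] -->
    eval d.-1 (derived_net d u c k) (coords p).
  apply: (@cvg_trans _ (eval d.-1 (derived_net d u c k) (coords q)
     @[q --> within (O k) (nbhs p)])).
    by apply: near_eq_cvg; near=> q; rewrite -OE //; near: q; exact: withinT.
  apply: cvg_trans; first by apply: cvg_app; exact: cvg_within.
  exact: eval_continuous.
exact: (cvg_unique _ c1 c2).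
Unshelve. all: by end_near. Qed.

Lemma Cn_le r f : Cn A r.+1 f -> Cn A r f.
Proof.
elim: r f => [|r IH] f; first by case.
move=> [cf H]; split => // u; have [df cdf] := H u; split=> //.
exact: IH.
Qed.

(** The unit vectors, along which entries of a net are shifts, are each the sum
of X and a vector of weight 0. *)
Lemma agree_of_dirs r X (a b : nat -> nat -> R) : weight X = 1 ->
  agree r (step X a) (step X b) ->
  (forall U, weight U = 0 -> agree r (step U a) (step U b)) ->
  agree r.+1 a b.
Proof.
move=> wX hX hU.
have H E : weight E = 1 -> agree r (step E a) (step E b).
  move=> wE i j ij; have w0 : weight (E - X) = 0.
    by move: wE wX; rewrite /weight /=; lra.
  by rewrite -[E](subrK X) !(step_addl (E - X)) /net_add (hX i j ij) (hU _ w0).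
have S1 (e : nat -> nat -> R) i j : e i.+1 j = step (1, 0, 0) e i j by rewrite /step /=; ring.
have S2 (e : nat -> nat -> R) i j : e i j.+1 = step (0, 1, 0) e i j by rewrite /step /=; ring.
have S3 (e : nat -> nat -> R) i j : e i j = step (0, 0, 1) e i j by rewrite /step /=; ring.
have [w1 w2 w3] : [/\ weight (1, 0, 0) = 1 :> R, weight (0, 1, 0) = 1 :> R
    & weight (0, 0, 1) = 1 :> R] by rewrite /weight /=; split; ring.
move=> [|i] j ij; last by rewrite !S1 H // -ltnS -addSn.
case: j ij => [|j] ij; last by rewrite !S2 H // -ltnS -addnS.
by rewrite (S3 a) (S3 b) H.
Qed.

(** By induction on r the condition holds for the derivatives in all directions
u, and for one derivative less: so for polar forms with one more argument at
a vector or at the common point, which together span ([agree_of_dirs]). *)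
Lemma Cn_compat n r c f :
  Cn A r f -> piecewise (n + r) c f -> compat n r c.
Proof.
elim: r n c f => [|r IH] n c f Cf pf k l p Pk Pl.
  move=> [|//] [|//] _; rewrite -!/(eval n _ _).
  by rewrite addn0 in pf; rewrite -(pf _ _ Pk) (pf _ _ Pl).
have wX : weight (coords p) = 1 by exact: weight_coords.
apply: (agree_of_dirs wX).
  have : compat n.+1 r c by apply: IH (Cn_le Cf) _; rewrite addSnnS.
  by move=> /(_ k l p Pk Pl).
move=> U wU i j ij; rewrite -(dcoords_pt nd wU) !step_iterC.
have pd := Cn_piecewise_dirD (pt U) Cf pf.
rewrite addnS /= in pd.
have := IH n _ _ (proj2 (proj2 Cf (pt U))) pd k l p Pk Pl i j ij.
rewrite /derived_net !iter_scale /net_scale => /mulfI; apply.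
by rewrite pnatr_eq0.
Qed.

Lemma Cn_dirs us r f : Cn A (r + size us) f -> Cn A r (foldr (dirD A) f us).
Proof.
elim: us r => [|u us IH] r /=; first by rewrite addn0.
by rewrite addnS -addSn => /IH[_ /(_ u)[_]].
Qed.

(** Iterating [dirD] along the list us, the degree drops by one each time and the
factors multiply to a falling factorial. *)
Lemma piecewise_dirs us d c f : Cn A (size us) f -> piecewise d c f ->
  piecewise (d - size us)
    (fun k => net_scale (d ^_ (size us))%:R (foldr step (c k) (map dcoords us)))
    (foldr (dirD A) f us).
Proof.
elim: us => [|u us IH] Cf pf k p Pk.
  by rewrite subn0 ffactn0 eval_scale mul1r /= (pf _ _ Pk).
have C' : Cn A 1 (foldr (dirD A) f us).
  by apply: Cn_dirs; rewrite add1n.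
have := Cn_piecewise_dirD u C' (IH (Cn_le Cf) pf) Pk.
rewrite /= -subnS => ->; rewrite /derived_net /= !eval_scale step_scale !eval_scale.
by rewrite ffactnSr natrM; ring.
Qed.

End Piecewise.

(** * Bivariate polynomials as nets *)

Section BivariatePolynomials.
Context {R : realType}.
Implicit Types (a : nat -> nat -> R) (p : R * R).

Definition bipoly d a p : R :=
  \sum_(i < d.+1) \sum_(j < d.+1 | (i + j <= d)%N) a i j * p.1 ^+ i * p.2 ^+ j.

Lemma bipoly0 a p : bipoly 0 a p = a 0%N 0%N.
Proof.
by rewrite /bipoly big_ord_recl big_ord0 addr0 big_mkcond big_ord_recl big_ord0
  /= addr0 !expr0 !mulr1.
Qed.

(** Horner's scheme in the first variable. *)
Lemma bipolyS d a p : bipoly d.+1 a p =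
  p.1 * bipoly d (fun i => a i.+1) p + \sum_(j < d.+2) a 0%N j * p.2 ^+ j.
Proof.
rewrite /bipoly big_ord_recl addrC; congr (_ + _).
  rewrite mulr_sumr; apply: eq_bigr => i _; rewrite mulr_sumr.
  rewrite big_mkcond big_ord_recr /= [X in _ + X]ifF ?addr0; last first.
    by rewrite /bump /= addnS !ltnS ltnNge leq_addl.
  rewrite -big_mkcond; apply: eq_big => j.
    by rewrite /= /bump add1n addSn ltnS.
  by move=> _; rewrite /bump /= add1n exprS; ring.
rewrite big_mkcond; apply: eq_bigr => j _ /=.
by rewrite add0n -ltnS ltn_ord expr0 mulr1.
Qed.

Definition shift1 a : nat -> nat -> R := fun i j => if i is i'.+1 then a i' j else 0.
Definition shift2 a : nat -> nat -> R := fun i j => if j is j'.+1 then a i j' else 0.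

Lemma bipoly_shift1 d a p : bipoly d.+1 (shift1 a) p = p.1 * bipoly d a p.
Proof.
by rewrite bipolyS big1 ?addr0 // => j _; rewrite /shift1 mul0r.
Qed.

Lemma bipoly_shift2 d a p : bipoly d.+1 (shift2 a) p = p.2 * bipoly d a p.
Proof.
elim: d a => [|d IH] a.
  rewrite bipolyS !bipoly0 /shift2 /= !big_ord_recl big_ord0 /=; ring.
rewrite bipolyS (IH (fun i => a i.+1)) [in RHS]bipolyS mulrDr mulrCA.
congr (_ + _).
rewrite big_ord_recl /= mul0r add0r mulr_sumr; apply: eq_bigr => j _.
by rewrite /= exprS; ring.
Qed.

Lemma bipoly_elevate d a p :
  bipoly d.+1 (fun i j => if (i + j <= d)%N then a i j else 0) p = bipoly d a p.
Proof.
elim: d a => [|d IH] a.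
  rewrite bipolyS !bipoly0 /= !big_ord_recl big_ord0 /=; ring.
rewrite bipolyS [in RHS]bipolyS; congr (_ * _ + _).
  by rewrite -(IH (fun i => a i.+1)).
rewrite big_ord_recr /= ltnn mul0r addr0; apply: eq_bigr => j _.
by rewrite add0n -ltnS ltn_ord.
Qed.

Lemma bipoly_lin d x y z a a' a'' p :
  bipoly d (fun i j => x * a i j + y * a' i j + z * a'' i j) p =
  x * bipoly d a p + y * bipoly d a' p + z * bipoly d a'' p.
Proof.
rewrite /bipoly !mulr_sumr -!big_split /=; apply: eq_bigr => i _.
rewrite !mulr_sumr -!big_split /=; apply: eq_bigr => j _; ring.
Qed.

Definition is_bipoly d (f : R * R -> R) := exists a, forall p, f p = bipoly d a p.

Lemma is_bipolyM d f (l x y : R) : is_bipoly d f ->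
  is_bipoly d.+1 (fun p => (l + x * p.1 + y * p.2) * f p).
Proof.
move=> [a fa].
exists (fun i j => l * (if (i + j <= d)%N then a i j else 0) +
  x * shift1 a i j + y * shift2 a i j) => p.
by rewrite bipoly_lin bipoly_elevate bipoly_shift1 bipoly_shift2 -fa; ring.
Qed.

Lemma is_bipolyD d f g : is_bipoly d f -> is_bipoly d g ->
  is_bipoly d (fun p => f p + g p).
Proof.
move=> [a fa] [b gb]; exists (fun i j => 1 * a i j + 1 * b i j + 0 * b i j) => p.
by rewrite bipoly_lin fa gb; ring.
Qed.

Variables v1 v2 v3 : R * R.
Hypothesis nd : nondegenerate_triangle (Triangle v1 v2 v3).
Local Notation coords := (coords v1 v2 v3).

Lemma lin_coords_affine b : exists l x y, forall p,
  lin b (coords p) = l + x * p.1 + y * p.2.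
Proof.
exists (lin b (coords 0)), (lin b (dcoords v1 v2 v3 (1, 0))),
  (lin b (dcoords v1 v2 v3 (0, 1))) => p.
rewrite [_ * p.1]mulrC [_ * p.2]mulrC -!lin_coordsE.
by congr (lin b (coords _)); apply: pairE; rewrite /= /GRing.scale /=; ring.
Qed.

(** Coordinates are affine functions of the point, and both families grow by
multiplication with affine functions. *)
Lemma eval_is_bipoly d c : is_bipoly d (fun p => eval d c (coords p)).
Proof.
elim: d c => [|d IH] c.
  by exists (fun _ _ => c 0%N 0%N) => p; rewrite bipoly0.
rewrite eval_coordsE.
have M b c' : is_bipoly d.+1 (fun p => lin b (coords p) * eval d c' (coords p)).
  have [l [x [y e]]] := lin_coords_affine b.
  by under eq_fun do rewrite e; exact: is_bipolyM.
by apply: is_bipolyD; first apply: is_bipolyD; exact: M.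
Qed.

Definition is_net d (f : R * R -> R) := exists c, forall p, f p = eval d c (coords p).

Lemma is_netM d f b : is_net d f -> is_net d.+1 (fun p => lin b (coords p) * f p).
Proof.
move=> [c fc]; pose m := d.+1%:R : R.
exists (net_scale m^-1 (net_add (net_add (net_scale b.1.1 (mul1 c)) (net_scale b.1.2 (mul2 c)))
  (net_scale b.2 (mul3 d.+1%:R c)))) => p.
rewrite eval_scale !eval_plus !eval_scale eval_mul1 eval_mul2 eval_mul3 -fc.
by rewrite /lin; field; rewrite addrC natr1 pnatr_eq0.
Qed.

Lemma is_netD d f g : is_net d f -> is_net d g -> is_net d (fun p => f p + g p).
Proof.
by move=> [c fc] [b gb]; exists (net_add c b) => p; rewrite eval_plus fc gb.
Qed.

(** Degree elevation: multiplying by the sum of the coordinates, which is 1. *)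
Lemma is_net_const d k : is_net d (fun=> k).
Proof.
elim: d => [|d]; first by exists (fun _ _ => k).
move=> /(is_netM (1, 1, 1))[c h]; exists c => p; rewrite -h.
have := weight_coords v1 v2 v3 p; rewrite /weight /lin /= !mul1r => ->.
by rewrite mul1r.
Qed.

Lemma coord_x p : p.1 = lin (v1.1, v2.1, v3.1) (coords p).
Proof. by rewrite -{1}(pt_coords nd p) /pt /lin /= /GRing.scale /=; ring. Qed.

Lemma coord_y p : p.2 = lin (v1.2, v2.2, v3.2) (coords p).
Proof. by rewrite -{1}(pt_coords nd p) /pt /lin /= /GRing.scale /=; ring. Qed.

Lemma bipoly_is_net d a : is_net d (bipoly d a).
Proof.
have ext e f g : (forall p, f p = g p) -> is_net e f -> is_net e g.
  by move=> fg [c h]; exists c => p; rewrite -fg.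
have Y e (b : nat -> R) : is_net e (fun p => \sum_(j < e.+1) b j * p.2 ^+ j).
  elim: e b => [|e IH] b.
    apply: (ext _ (fun=> b 0%N)); last exact: is_net_const.
    by move=> p; rewrite big_ord_recl big_ord0 expr0 mulr1 addr0.
  apply: ext (is_netD (is_net_const e.+1 (b 0%N))
    (is_netM (v1.2, v2.2, v3.2) (IH (fun j => b j.+1)))) => p.
  rewrite -coord_y [in RHS]big_ord_recl expr0 mulr1 mulr_sumr; congr (_ + _).
  by apply: eq_bigr => j _; rewrite /= exprS; ring.
elim: d a => [|d IH] a.
  apply: (ext _ (fun=> a 0%N 0%N)); last exact: is_net_const.
  by move=> p; rewrite bipoly0.
apply: ext (is_netD (is_netM (v1.1, v2.1, v3.1) (IH (fun i => a i.+1)))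
   (Y d.+1 (a 0%N))) => p.
by rewrite bipolyS -coord_x.
Qed.

End BivariatePolynomials.

(** * Areas *)

Section Area.
Context {R : realType}.
Implicit Types (p q r : R * R) (A B : set (R * R)).
Local Notation mu := (@lebesgue_measure R).
Local Notation mu2 := ((@lebesgue_measure R \x @lebesgue_measure R)%E).
Local Notation tri p q r := (conv_hull [:: p; q; r]).

(** Both sides are measures in B that agree on half-open intervals. *)
Lemma lebesgue_measure_affine (b e : R) (B : set (measurableTypeR R)) : b != 0 -> measurable B ->
  mu B = (`|b|%:E * mu ((fun y => b * y + e)%R @^-1` B))%E.
Proof.
move=> b0 mB; pose f (y : R) : measurableTypeR R := b * y + e.
have mf : measurable_fun [set: measurableTypeR R] f.
  by apply: measurable_funD => //; exact: measurable_funM.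
pose nb := NngNum (normr_ge0 b).
pose m := mscale nb
  (measure_function_pushforward__canonical__measure_function_Measure mu mf).
rewrite -[RHS]/(m B).
apply: lebesgue_measure_unique => // X [[x y] _ <-] /=.
rewrite /m /mscale /= /pushforward /f /= lebesgue_measure_itv /= lte_fin.
have [b0'|b0'] := ltP 0 b.
  rewrite (_ : _ @^-1` _ = `](x - e) / b, (y - e) / b]%classic); last first.
    apply/seteqP; split => z /=; rewrite !in_itv /= ltr_pdivrMr // ler_pdivlMr //;
    rewrite ltrBlDr lerBrDr mulrC //.
  rewrite lebesgue_measure_itv /= lte_fin ltr_pM2r ?invr_gt0 // ltrD2r.
  case: ifP => xy; last by rewrite mule0.
  by rewrite -EFinD -!EFinB -EFinM gtr0_norm //; congr EFin; field.
have bn : b < 0 by rewrite lt_neqAle b0.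
rewrite (_ : _ @^-1` _ = `[(y - e) / b, (x - e) / b[%classic); last first.
  apply/seteqP; split => z /=; rewrite !in_itv /= ltr_ndivlMr // ler_ndivrMr //;
  by rewrite ltrBlDr lerBrDr mulrC andbC.
rewrite lebesgue_measure_itv /= lte_fin ltr_nM2r ?invr_lt0 // ltrD2r.
case: ifP => xy; last by rewrite mule0.
by rewrite -EFinD -!EFinB -EFinM ltr0_norm //; congr EFin; field.
Qed.

Lemma tri_measurable p q r : cross (q - p) (r - p) != 0 ->
  measurable (tri p q r : set (measurableTypeR R * measurableTypeR R)).
Proof.
move=> nd; pose c := coords p q r.
have ml a : measurable [set x | 0 <= lin a (c x)].
  have [l [x [y e]]] := lin_coords_affine p q r a.
  rewrite (_ : [set _ | _] = setT `&`
      (fun z : measurableTypeR R * measurableTypeR R => l + x * z.1 + y * z.2)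
      @^-1` `[0, +oo[%classic); last first.
    by rewrite setTI; apply/seteqP; split => z; rewrite /= in_itv /= andbT e.
  have mf : measurable_fun [set: measurableTypeR R * measurableTypeR R]
    (fun z : measurableTypeR R * measurableTypeR R => l + x * z.1 + y * z.2).
    apply: measurable_funD.
      apply: measurable_funD => //; apply: measurable_funM => //.
    by apply: measurable_funM.
  exact: mf.
have [a ea] := face1E (1, 0, 0) (0, 1, 0) ((0, 0, 1) : R * R * R).
have [b eb] := face2E (1, 0, 0) (0, 1, 0) ((0, 0, 1) : R * R * R).
have [d ed] := face3E (1, 0, 0) (0, 1, 0) ((0, 0, 1) : R * R * R).
rewrite (_ : tri p q r = [set x | 0 <= lin a (c x)] `&`
   [set x | 0 <= lin b (c x)] `&` [set x | 0 <= lin d (c x)]).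
  by apply: measurableI; [apply: measurableI|]; exact: ml.
have w1 : weight (1, 0, 0) = 1 :> R by rewrite /weight /=; ring.
have w2 : weight (0, 1, 0) = 1 :> R by rewrite /weight /=; ring.
have w3 : weight (0, 0, 1) = 1 :> R by rewrite /weight /=; ring.
have d0 : det3 (1, 0, 0) (0, 1, 0) ((0, 0, 1) : R * R * R) != 0.
  rewrite (_ : det3 _ _ _ = 1) ?oner_eq0 //; by rewrite /det3 /=; ring.
have e1 : pt p q r (1, 0, 0) = p.
  by apply: pairE; rewrite /pt /= /GRing.scale /=; ring.
have e2 : pt p q r (0, 1, 0) = q.
  by apply: pairE; rewrite /pt /= /GRing.scale /=; ring.
have e3 : pt p q r (0, 0, 1) = r.
  by apply: pairE; rewrite /pt /= /GRing.scale /=; ring.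
have H x := hull3P nd x w1 w2 w3 d0; rewrite e1 e2 e3 in H.
rewrite -ea -eb -ed; apply/seteqP; split => x /=.
  by move=> /H[].
by move=> [[? ?] ?]; apply/H.
Qed.

(** Affine injections preserve convex combinations. *)
Lemma tri_affine (F : R * R -> R * R) p q r x : injective F ->
  (forall a b c : R, a + b + c = 1 ->
    F (a *: p + b *: q + c *: r) = a *: F p + b *: F q + c *: F r) ->
  tri (F p) (F q) (F r) (F x) <-> tri p q r x.
Proof.
move=> Fi Fa; rewrite !conv_hull3; split=> -[a [b [c [a0 b0 c0 s e]]]];
  exists a, b, c; split=> //; last by rewrite e Fa.
by apply: Fi; rewrite Fa.
Qed.

(** Maps that act affinely on each vertical, resp. horizontal line.  They suffice
to move the standard triangle to any nondegenerate one, and their effect on the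
product measure follows from the one-dimensional case on the sections. *)
Definition shearY b c e p : R * R := (p.1, b * p.2 + (c * p.1 + e)).
Definition shearX b c e p : R * R := (b * p.1 + (c * p.2 + e), p.2).

Lemma tri_shearY b c e p q r x : b != 0 ->
  tri (shearY b c e p) (shearY b c e q) (shearY b c e r) (shearY b c e x) <->
  tri p q r x.
Proof.
move=> b0; apply: tri_affine.
  by move=> [y z] [y' z'] []/= -> /addIr /(mulfI b0) ->.
move=> a a' a'' s; have -> : a = 1 - a' - a'' by lra.
by apply: pairE; rewrite /shearY /= /GRing.scale /=; ring.
Qed.

Lemma tri_shearX b c e p q r x : b != 0 ->
  tri (shearX b c e p) (shearX b c e q) (shearX b c e r) (shearX b c e x) <->
  tri p q r x.
Proof.
move=> b0; apply: tri_affine.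
  by move=> [y z] [y' z'] []/= /[swap] -> /addIr /(mulfI b0) ->.
move=> a a' a'' s; have -> : a = 1 - a' - a'' by lra.
by apply: pairE; rewrite /shearX /= /GRing.scale /=; ring.
Qed.

Lemma mu2_shearY b c e p q r : b != 0 -> cross (q - p) (r - p) != 0 ->
  mu2 (tri (shearY b c e p) (shearY b c e q) (shearY b c e r)) =
  (`|b|%:E * mu2 (tri p q r))%E.
Proof.
move=> b0 nd.
have nd' : cross (shearY b c e q - shearY b c e p)
   (shearY b c e r - shearY b c e p) != 0.
  rewrite (_ : cross _ _ = b * cross (q - p) (r - p)) ?mulf_neq0 //.
  by rewrite /cross /shearY /=; ring.
have m := tri_measurable nd; have m' := tri_measurable nd'.
rewrite /product_measure1 -ge0_integralZl //; last exact: measurable_fun_xsection.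
apply: eq_integral => x _ /=.
rewrite (@lebesgue_measure_affine b (c * x + e)) //; last exact: measurable_xsection.
congr (_ * mu _)%E; apply/seteqP; split=> y /=.
  by rewrite /xsection /= !inE -(tri_shearY c e p q r (x, y) b0).
by rewrite /xsection /= !inE -(tri_shearY c e p q r (x, y) b0).
Qed.

(** Horizontal sections may replace vertical ones by uniqueness of the product
measure. *)
Lemma mu2_swap A : measurable (A : set (measurableTypeR R * measurableTypeR R)) ->
  mu2 A = (\int[mu]_y mu (ysection A y))%E.
Proof.
move=> mA; rewrite -[RHS]/((mu \x^ mu)%E A).
by apply: product_measure_unique => // X Y mX mY; exact: product_measure2E.
Qed.

Lemma mu2_shearX b c e p q r : b != 0 -> cross (q - p) (r - p) != 0 ->
  mu2 (tri (shearX b c e p) (shearX b c e q) (shearX b c e r)) =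
  (`|b|%:E * mu2 (tri p q r))%E.
Proof.
move=> b0 nd.
have nd' : cross (shearX b c e q - shearX b c e p)
   (shearX b c e r - shearX b c e p) != 0.
  rewrite (_ : cross _ _ = b * cross (q - p) (r - p)) ?mulf_neq0 //.
  by rewrite /cross /shearX /=; ring.
have m := tri_measurable nd; have m' := tri_measurable nd'.
rewrite !mu2_swap // -ge0_integralZl //; last exact: measurable_fun_ysection.
apply: eq_integral => x _ /=.
rewrite (@lebesgue_measure_affine b (c * x + e)) //; last exact: measurable_ysection.
congr (_ * mu _)%E; apply/seteqP; split=> y /=.
  by rewrite /ysection /= !inE -(tri_shearX c e p q r (y, x) b0).
by rewrite /ysection /= !inE -(tri_shearX c e p q r (y, x) b0).
Qed.

Definition unit_tri : set (R * R) := tri (0, 0) (1, 0) (0, 1).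

Lemma tri_swap p q r : tri p q r = tri p r q.
Proof.
have H q' r' : tri p q' r' `<=` tri p r' q'.
  move=> x /conv_hull3[a [b [c [a0 b0 c0 s ->]]]]; apply/conv_hull3.
  by exists a, c, b; split=> //; [rewrite addrAC|rewrite addrAC].
by apply/seteqP; split.
Qed.

Lemma cross_unit : cross ((1, 0) - (0, 0)) ((0, 1) - (0, 0)) = 1 :> R.
Proof. by rewrite /cross /=; ring. Qed.

(** The triangle is the image of the standard one under a horizontal shear
followed by a vertical one, when its first edge is not vertical; otherwise the
two edges at p are exchanged.  Only ratios of areas matter for the recursion, so
the area of the standard triangle is left unevaluated. *)
Lemma mu2_tri p q r : cross (q - p) (r - p) != 0 ->
  mu2 (tri p q r) = (`|cross (q - p) (r - p)|%:E * mu2 unit_tri)%E.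
Proof.
wlog a0 : q r / (q - p).1 != 0.
  move=> H nd; have [q0|] := eqVneq (q - p).1 0; last by move=> /H; apply.
  have r0 : (r - p).1 != 0.
    by apply: contraNneq nd => r0; rewrite /cross q0 r0; apply/eqP; ring.
  have c' : cross (r - p) (q - p) = - cross (q - p) (r - p) by rewrite /cross; ring.
  by rewrite tri_swap H // c' ?oppr_eq0 // normrN.
move=> nd; set d := cross _ _ in nd *; set a := (q - p).1 in a0 *.
pose X := shearX a (r - p).1 p.1.
pose c := (q - p).2 / a; pose b := d / a.
pose Y := shearY b c (p.2 - c * p.1).
have b0 : b != 0 by rewrite mulf_neq0 // invr_eq0.
have Xp : Y (X (0, 0)) = p.
  by apply: pairE; rewrite /X /Y /shearX /shearY /=; ring.
have Xq : Y (X (1, 0)) = q.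
  have a0' := a0; rewrite /a /= in a0'.
  by apply: pairE; rewrite /X /Y /shearX /shearY /c /b /a /=; field.
have Xr : Y (X (0, 1)) = r.
  have a0' := a0; rewrite /a /= in a0'.
  by apply: pairE; rewrite /X /Y /shearX /shearY /c /b /d /a /cross /=; field.
have nX : cross (X (1, 0) - X (0, 0)) (X (0, 1) - X (0, 0)) != 0.
  by rewrite (_ : cross _ _ = a) // /X /shearX /cross /=; ring.
have n1 : cross ((1, 0) - (0, 0)) ((0, 1) - (0, 0)) != 0 :> R.
  by rewrite cross_unit oner_eq0.
have -> : tri p q r = tri (Y (X (0, 0))) (Y (X (1, 0))) (Y (X (0, 1))).
  by rewrite Xp Xq Xr.
rewrite (mu2_shearY c (p.2 - c * p.1) b0 nX) (mu2_shearX _ _ a0 n1) muleA.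
by rewrite -EFinM -normrM /b divfK.
Qed.

(** The integral of a nonnegative function is a supremum over simple functions
below it and the Lebesgue measure is an outer measure, so that monotonicity
extends to sets whose measurability is unknown, such as the hull of many knots. *)
Lemma mu2_mono A B : A `<=` B -> (mu2 A <= mu2 B)%E.
Proof.
move=> AB; rewrite /product_measure1 !ge0_integralTE //.
apply: ereal_sup_le => _ [h hA <-]; exists h => // x.
apply: (le_trans (hA x)) => /=.
have m : (forall X Y : set R, X `<=` Y -> mu X <= mu Y)%E.
  by move=> X Y XY; exact: le_mu_ext.
by apply: m => y; rewrite /xsection /= !inE; exact: AB.
Qed.

Lemma mu2_box (a b c d : R) : a <= b -> c <= d ->
  mu2 (`[a, b]%classic `*` `[c, d]%classic) = ((b - a) * (d - c))%:E.
Proof.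
move=> ab cd; rewrite product_measure1E //.
have m x y : x <= y -> mu `[x, y]%classic = (y - x)%:E.
  move=> xy; rewrite lebesgue_measure_itv /= lte_fin.
  by case: ltgtP xy => // -> _; rewrite subrr.
by rewrite -[X in (X * _)%E]/(mu `[a, b]%classic)
  -[X in (_ * X)%E]/(mu `[c, d]%classic) !m // EFinM.
Qed.

Lemma mu2_unit_tri : exists2 c0 : R, 0 < c0 & mu2 unit_tri = c0%:E.
Proof.
have up : (mu2 unit_tri <= 1%:E)%E.
  rewrite (_ : 1%:E = mu2 (`[0, 1]%classic `*` `[0, 1]%classic)); last first.
    by rewrite mu2_box // subr0 mulr1.
  apply: mu2_mono => x /conv_hull3[a [b [c [a0 b0 c0 s ->]]]].
  by split; rewrite /= in_itv /= /GRing.scale /=; apply/andP; split; lra.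
have lo : ((2^-1 * 2^-1)%:E <= mu2 unit_tri)%E.
  rewrite (_ : (2^-1 * 2^-1)%:E =
    mu2 (`[0, 2^-1]%classic `*` `[0, 2^-1]%classic)); last first.
    by rewrite mu2_box ?invr_ge0 // !subr0.
  apply: mu2_mono => x [] /=; rewrite !in_itv /= => /andP[x0 x1] /andP[y0 y1].
  apply/conv_hull3; exists (1 - x.1 - x.2), x.1, x.2; split=> //; [lra|ring|].
  by apply: pairE; rewrite /= /GRing.scale /=; ring.
have fin : mu2 unit_tri \is a fin_num.
  rewrite fin_real //; apply/andP; split.
    by apply: lt_le_trans lo; rewrite ltNyr.
  by apply: le_lt_trans up _; rewrite ltry.
exists (fine (mu2 unit_tri)); last by rewrite fineK.
rewrite -lte_fin fineK //; apply: lt_le_trans lo.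
by rewrite lte_fin mulr_gt0 // invr_gt0.
Qed.

Lemma area_tri : exists2 c0 : R, 0 < c0 & forall p q r,
  cross (q - p) (r - p) != 0 -> area (tri p q r) = `|cross (q - p) (r - p)| * c0.
Proof.
have [c0 c00 e] := mu2_unit_tri; exists c0 => // p q r nd.
by rewrite /area mu2_tri // e.
Qed.

(** Since [area] is real-valued, the set has to be bounded as well: an infinite
measure would give area 0. *)
Lemma area_neq0 A p q r (M : R) : cross (q - p) (r - p) != 0 ->
  tri p q r `<=` A -> (forall x, A x -> `|x.1| <= M /\ `|x.2| <= M) ->
  area A != 0.
Proof.
move=> nd sub bd.
pose N : R := `|M|; have N0 : - N <= N by have := normr_ge0 M; rewrite /N; lra.
have up : (mu2 A < +oo)%E.
  have : (mu2 A <= mu2 (`[(- N)%R, N]%classic `*` `[(- N)%R, N]%classic))%E.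
    apply: mu2_mono => x /bd[h1 h2].
    by split; rewrite /= in_itv /= -ler_norml;
      [apply: le_trans h1 _|apply: le_trans h2 _]; exact: ler_norm.
  by rewrite mu2_box // => /le_lt_trans; apply; rewrite ltry.
have lo : (0 < mu2 A)%E.
  apply: lt_le_trans (mu2_mono sub).
  have [c0 c00 e] := mu2_unit_tri.
  by rewrite mu2_tri // e -EFinM lte_fin mulr_gt0 // normr_gt0.
have fin : mu2 A \is a fin_num by rewrite fin_real // (lt_trans _ lo) ?ltNyr.
by rewrite gt_eqF // -lte_fin /area fineK.
Qed.

Lemma area_line0 A (w p : R * R) : w != 0 ->
  (forall x, A x -> cross (x - p) w = 0) -> area A = 0.
Proof.
move=> w0 Aw; suff : mu2 A = 0%E by rewrite /area => ->.
have pos : (0 <= mu2 A)%E by apply: integral_ge0.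
apply/eqP; rewrite eq_le pos andbT.
have [w10|w10] := eqVneq w.1 0.
  have w20 : w.2 != 0.
    by apply: contraNneq w0 => w20; apply/eqP; exact: pairE.
  apply: (@le_trans _ _ (mu2 ([set p.1] `*` setT))).
    apply: mu2_mono => x /Aw; rewrite /cross w10 mulr0 subr0 => /eqP.
    by rewrite mulf_eq0 (negbTE w20) orbF subr_eq0 => /eqP e; split.
  rewrite product_measure1E // -[X in (X * _)%E]/(mu [set p.1]).
  by rewrite lebesgue_measure_set1 mul0e.
rewrite /product_measure1 (eq_integral (fun=> 0%E)) ?integral0 // => x _ /=.
have sub : xsection A x `<=` [set p.2 + (x - p.1) * w.2 / w.1].
  move=> y; rewrite /xsection /= inE => /Aw; rewrite /cross /= => e.
  have e' : (y - p.2) * w.1 = (x - p.1) * w.2 by lra.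
  by rewrite -e' mulfK // subrKC.
by case: (subset_set1 sub) => ->; rewrite ?measure0 ?lebesgue_measure_set1.
Qed.

End Area.

(** * The 12-split in integer coordinates *)

Section IntegersInReals.
Context {R : realType}.

(** Integers in binary representation are used for all computations. *)
Definition toR (z : Z) : R := (int_of_Z z)%:~R.

Lemma toRD x y : toR (Z.add x y) = toR x + toR y.
Proof. by rewrite /toR -[Z.add x y]/(x + y) rmorphD rmorphD. Qed.

Lemma toRM x y : toR (Z.mul x y) = toR x * toR y.
Proof. by rewrite /toR -[Z.mul x y]/(x * y) rmorphM rmorphM. Qed.

Lemma toRN x : toR (Z.opp x) = - toR x.
Proof. by rewrite /toR -[Z.opp x]/(- x) rmorphN rmorphN. Qed.

Lemma toRB x y : toR (Z.sub x y) = toR x - toR y.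
Proof. by rewrite -Z.add_opp_r toRD toRN. Qed.

Lemma toR0 : toR 0 = 0. Proof. by []. Qed.

Lemma toR3E : toR 3 = 3. Proof. by []. Qed.
Lemma toR4E : toR 4 = 4. Proof. by []. Qed.
Lemma toR6E : toR 6 = 6. Proof. by []. Qed.
Lemma toR12E : toR 12 = 12. Proof. by []. Qed.
Definition toR_num := (toR0, toR3E, toR4E, toR6E, toR12E).

Lemma toR_ge0 z : (0 <=? z)%BZ -> 0 <= toR z.
Proof. by rewrite /toR ler0z; case: z. Qed.

Lemma toR_gt0 z : (0 <? z)%BZ -> 0 < toR z.
Proof. by rewrite /toR ltr0z; case: z => // p _; rewrite ltz_nat; apply/ssrnat.ltP; exact: Pos2Nat.is_pos. Qed.

Lemma toR_le0 z : (z <=? 0)%BZ -> toR z <= 0.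
Proof. by rewrite /toR lerz0; case: z. Qed.

Lemma toR_eq0 z : (toR z == 0) = (z =? 0)%BZ.
Proof.
case: z => [|p|p]; first by rewrite eqxx.
  by rewrite gt_eqF // toR_gt0.
by rewrite lt_eqF // /toR ltrz0.
Qed.

Definition toR3 (x : Z * Z * Z) : R * R * R := (toR x.1.1, toR x.1.2, toR x.2).

End IntegersInReals.

Definition zdet (A B C : Z * Z * Z) : Z :=
  (A.1.1 * (B.1.2 * C.2 - B.2 * C.1.2) - A.1.2 * (B.1.1 * C.2 - B.2 * C.1.1)
  + A.2 * (B.1.1 * C.1.2 - B.1.2 * C.1.1))%BZ.

Lemma toR_det {R : realType} A B C :
  toR (zdet A B C) = det3 (toR3 A) (toR3 B) (toR3 C) :> R.
Proof. by rewrite /zdet /det3 /= !(toRD, toRB, toRM). Qed.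

(** The barycentric coordinates of the ten vertices, multiplied by 12. *)
Definition zvert : seq (Z * Z * Z) :=
  [:: (12, 0, 0); (0, 12, 0); (0, 0, 12); (6, 6, 0); (0, 6, 6); (6, 0, 6);
      (6, 3, 3); (3, 6, 3); (3, 3, 6); (4, 4, 4)]%BZ.

Definition zv (n : nat) := nth (0, 0, 0)%BZ zvert n.

(** The indices, counted from 0, of the vertices of the faces in [split12]. *)
Definition zpieces : seq (nat * nat * nat) :=
  [:: (0, 3, 6); (0, 5, 6); (1, 3, 7); (1, 4, 7); (2, 4, 8); (2, 5, 8);
      (3, 6, 9); (5, 6, 9); (3, 7, 9); (4, 7, 9); (4, 8, 9); (5, 8, 9)]%N.

Definition pc (k r : nat) : nat :=
  let w := nth (0, 0, 0)%N zpieces k in nth 0%N [:: w.1.1; w.1.2; w.2] r.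

Section Split.
Context {R : realType}.
Variables v1 v2 v3 : R * R.
Hypothesis nd : nondegenerate_triangle (Triangle v1 v2 v3).
Let t := Triangle v1 v2 v3.
Local Notation coords := (coords v1 v2 v3).
Local Notation dcoords := (dcoords v1 v2 v3).
Local Notation pt := (pt v1 v2 v3).

Definition vtx (n : nat) : R * R * R := 12^-1 *: toR3 (zv n).

Lemma vertE (j : 'I_10) : vert t j = pt (vtx j).
Proof.
case: j => [[|[|[|[|[|[|[|[|[|[|//]]]]]]]]]] lt]; rewrite /vert /pt /vtx /=;
  apply: pairE; rewrite /vert7 /vert8 /vert9 /vert10 /midpoint
    /vert4 /vert5 /vert6 /midpoint /= /GRing.scale /= ?toR_num /=; by field.
Qed.

Lemma weight_vtx n : (n < 10)%N -> weight (vtx n) = 1.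
Proof.
case: n => [|[|[|[|[|[|[|[|[|[|//]]]]]]]]]] _;
  rewrite /weight /vtx /= /GRing.scale /= ?toR_num; by field.
Qed.

Lemma det_vtx a b c :
  det3 (vtx a) (vtx b) (vtx c) = (12 ^- 3) * toR (zdet (zv a) (zv b) (zv c)).
Proof. by rewrite toR_det /vtx /det3 /= /GRing.scale /=; field. Qed.

Lemma pc_lt k r : (pc k r < 10)%N.
Proof.
rewrite /pc; set w := nth _ _ k.
have /and3P[] : [&& w.1.1 < 10, w.1.2 < 10 & w.2 < 10]%N.
  have [kl|kl] := ltnP k (size zpieces); last by rewrite /w nth_default.
  pose f (w : nat * nat * nat) := [&& w.1.1 < 10, w.1.2 < 10 & w.2 < 10]%N.
  by apply: (@all_nthP _ f zpieces (0, 0, 0)%N _ k kl).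
by case: r => [|[|[|r]]] //=; rewrite nth_nil.
Qed.

Definition piece (k : 'I_12) : set (R * R) :=
  conv_hull [:: pt (vtx (pc k 0)); pt (vtx (pc k 1)); pt (vtx (pc k 2))].

Definition open_piece (k : 'I_12) : set (R * R) :=
  open_tri v1 v2 v3 (vtx (pc k 0)) (vtx (pc k 1)) (vtx (pc k 2)).

Lemma piece_det_neq0 (k : 'I_12) :
  det3 (vtx (pc k 0)) (vtx (pc k 1)) (vtx (pc k 2)) != 0.
Proof.
rewrite det_vtx mulf_neq0 // ?invr_neq0 ?expf_neq0 // toR_eq0.
by case: k => [] /=; do 12 (case=> //).
Qed.

Lemma split12E (k : 'I_12) : nth set0 (split12 t) k = piece k.
Proof.
have V n (h : (n < 10)%N) : pt (vtx n) = vert t (Ordinal h) by rewrite vertE.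
rewrite /piece !(V _ (pc_lt _ _)) /vert.
by case: k => [[|[|[|[|[|[|[|[|[|[|[|[|//]]]]]]]]]]]] lt].
Qed.

Lemma piece_closed k : closed (piece k).
Proof. by apply: tri_closed => //; rewrite ?weight_vtx ?pc_lt ?piece_det_neq0. Qed.

Lemma open_piece_open k : open (open_piece k).
Proof. exact: open_tri_open. Qed.

Lemma open_piece_sub k : open_piece k `<=` piece k.
Proof. by apply: open_tri_sub => //; rewrite ?weight_vtx ?pc_lt ?piece_det_neq0. Qed.

Lemma piece_closure k : piece k `<=` closure (open_piece k).
Proof. by apply: tri_closure => //; rewrite ?weight_vtx ?pc_lt ?piece_det_neq0. Qed.

Lemma pt0 : pt (vtx 0) = v1.
Proof. by rewrite -(vertE (@Ordinal 10 0 isT)). Qed.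
Lemma pt1 : pt (vtx 1) = v2.
Proof. by rewrite -(vertE (@Ordinal 10 1 isT)). Qed.
Lemma pt2 : pt (vtx 2) = v3.
Proof. by rewrite -(vertE (@Ordinal 10 2 isT)). Qed.

Lemma regionP p : region t p <->
  [/\ 0 <= (coords p).1.1, 0 <= (coords p).1.2 & 0 <= (coords p).2].
Proof.
have -> : region t = conv_hull [:: pt (vtx 0); pt (vtx 1); pt (vtx 2)].
  by rewrite pt0 pt1 pt2.
have n0 : det3 (vtx 0) (vtx 1) (vtx 2) != 0.
  by rewrite det_vtx mulf_neq0 // ?invr_neq0 ?expf_neq0 // toR_eq0.
rewrite (hull3P nd) ?weight_vtx //.
rewrite (_ : _ / _ = (coords p).1.1); last first.
  by move: n0; move: (coords p) => X; rewrite /det3 /vtx /= /GRing.scale /= ?toR_num => ?; field.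
rewrite (_ : _ / _ = (coords p).1.2); last first.
  by move: n0; move: (coords p) => X; rewrite /det3 /vtx /= /GRing.scale /= ?toR_num => ?; field.
rewrite (_ : det3 _ _ (coords p) / _ = (coords p).2) //.
by move: n0; move: (coords p) => X; rewrite /det3 /vtx /= /GRing.scale /= ?toR_num => ?; field.
Qed.

Lemma piece_region k : piece k `<=` region t.
Proof.
move=> p /conv_hull3[a [b [c [a0 b0 c0 s]]]].
rewrite pt_comb3 => ->; apply/regionP.
rewrite coords_pt //; last by rewrite weight_comb3 ?weight_vtx ?pc_lt.
have pos n : [/\ 0 <= (vtx n).1.1, 0 <= (vtx n).1.2 & 0 <= (vtx n).2].
  have [nl|nl] := ltnP n 10; last first.
    by rewrite /vtx /zv nth_default //= /GRing.scale /= !toR0 mulr0.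
  rewrite /vtx /= /GRing.scale /=.
  by split; apply: mulr_ge0; rewrite ?invr_ge0 //; apply: toR_ge0;
    move: n nl; do 10 (case=> //).
have [x1 y1 z1] := pos (pc k 0); have [x2 y2 z2] := pos (pc k 1).
have [x3 y3 z3] := pos (pc k 2).
rewrite /= /GRing.scale /=.
by split; apply: addr_ge0; try apply: addr_ge0; exact: mulr_ge0.
Qed.

Lemma in_piece (k : nat) (hk : (k < 12)%N) p (a b c : R) :
  0 <= a -> 0 <= b -> 0 <= c -> a + b + c = 1 ->
  coords p = a *: vtx (pc k 0) + b *: vtx (pc k 1) + c *: vtx (pc k 2) ->
  exists k, piece k p.
Proof.
move=> a0 b0 c0 s e; exists (Ordinal hk); apply/conv_hull3; exists a, b, c.
by split=> //; rewrite pt_comb3 -e (pt_coords nd).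
Qed.

Local Ltac in_piece_tac k a b c H := apply: (H k isT a b c); [lra|lra|lra|lra|];
  apply: tripleE; rewrite /vtx /= /GRing.scale /= ?toR_num; lra.

(** The order of the three coordinates of p singles out one of six sectors of the
medians, and comparing the largest coordinate with the sum of the others
decides whether p lies in the medial triangle. *)
Lemma piece_cover p : region t p -> exists k, piece k p.
Proof.
move=> /regionP[]; have := weight_coords v1 v2 v3 p.
move: (fun k hk => @in_piece k hk p).
case: (coords p) => [[x y] z] /= H; rewrite /weight /= => s x0 y0 z0.
have [xy|xy] := lerP x y; have [yz|yz] := lerP y z; have [xz|xz] := lerP x z.
(* Outside the medial triangle, with l >= m >= s the sorted coordinates of p, the
   weights at the vertices of the piece are l - m - s, 2 (m - s) and 4 s; inside
   they are 2 (m - s), 4 (l - m) and 3 (m + s - l). *)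
- have [h|h] := lerP (x + y) z.
    in_piece_tac 4%N (z - y - x) (2 * (y - x)) (4 * x) H.
  in_piece_tac 10%N (2 * (y - x)) (4 * (z - y)) (3 * (y + x - z)) H.
- lra.
- have [h|h] := lerP (x + z) y.
    in_piece_tac 3%N (y - z - x) (2 * (z - x)) (4 * x) H.
  in_piece_tac 9%N (2 * (z - x)) (4 * (y - z)) (3 * (z + x - y)) H.
- have [h|h] := lerP (x + z) y.
    in_piece_tac 2%N (y - x - z) (2 * (x - z)) (4 * z) H.
  in_piece_tac 8%N (2 * (x - z)) (4 * (y - x)) (3 * (x + z - y)) H.
- have [h|h] := lerP (x + y) z.
    in_piece_tac 5%N (z - x - y) (2 * (x - y)) (4 * y) H.
  in_piece_tac 11%N (2 * (x - y)) (4 * (z - x)) (3 * (x + y - z)) H.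
- have [h|h] := lerP (y + z) x.
    in_piece_tac 1%N (x - z - y) (2 * (z - y)) (4 * y) H.
  in_piece_tac 7%N (2 * (z - y)) (4 * (x - z)) (3 * (z + y - x)) H.
- lra.
- have [h|h] := lerP (y + z) x.
    in_piece_tac 0%N (x - y - z) (2 * (y - z)) (4 * z) H.
  in_piece_tac 6%N (2 * (y - z)) (4 * (x - y)) (3 * (y + z - x)) H.
Qed.

Lemma region_pieces p : region t p <-> exists k, piece k p.
Proof.
by split=> [|[k]]; [exact: piece_cover|exact: piece_region].
Qed.

End Split.

(** * Smoothness across common faces, and generic points *)

Lemma all_iota2P m n (f : nat -> nat -> bool) :
  all (fun i => all (f i) (iota 0 n)) (iota 0 m) ->
  forall i j, (i < m)%N -> (j < n)%N -> f i j.
Proof.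
move=> /allP h i j im jn; have /h/allP : i \in iota 0 m by rewrite mem_iota.
by apply; rewrite mem_iota.
Qed.

Definition subst3 {T} (s : nat) (w a b c : T) : T * T * T :=
  match s with 0%N => (w, b, c) | 1%N => (a, w, c) | _ => (a, b, w) end.

(** A positive multiple of the barycentric coordinate of index s of the vertex w
with respect to the vertices a, b, c: its sign is what matters. *)
Definition zform (a b c : nat) (s w : nat) : Z :=
  let m := subst3 s (zv w) (zv a) (zv b) (zv c) in
  (zdet m.1.1 m.1.2 m.2 * zdet (zv a) (zv b) (zv c))%BZ.

Definition zface (k s w : nat) : Z := zform (pc k 0) (pc k 1) (pc k 2) s w.

(** Vertex r of piece k survives if each side of piece l that separates k from l
contains it. *)
Definition zcommon (k l r : nat) : bool :=
  all (fun s => all (fun r' => zface l s (pc k r') <=? 0)%BZ (iota 0 3) ==>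
                (zface l s (pc k r) =? 0)%BZ) (iota 0 3).

Definition common_face (k l : nat) : seq nat := [seq r <- iota 0 3 | zcommon k l r].

Definition znet := nat -> nat -> Z.
Definition zrows (L : seq (seq Z)) : znet := fun i j => nth 0%BZ (nth [::] L i) j.
Definition zstep (w : Z * Z * Z) (c : znet) : znet :=
  fun i j => (w.1.1 * c i.+1 j + w.1.2 * c i j.+1 + w.2 * c i j)%BZ.
Definition zagree (r : nat) (c c' : znet) : bool :=
  all (fun i => all (fun j => c i j =? c' i j)%BZ (iota 0 (r - i).+1)) (iota 0 r.+1).

(** Evaluated once, as all smoothness checks consult it. *)
Definition common_faces : seq (seq (seq nat)) := Eval vm_compute in
  [seq [seq common_face k l | l <- iota 0 k] | k <- iota 0 12].

Lemma common_facesE k l : (k < 12)%N -> (l < k)%N ->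
  nth [::] (nth [::] common_faces k) l = common_face k l.
Proof.
move=> k12 lk.
have /allP H : all (fun k => all (fun l => nth [::] (nth [::] common_faces k) l
  == common_face k l) (iota 0 k)) (iota 0 12) by vm_compute.
have /H/allP/(_ l) : k \in iota 0 12 by rewrite mem_iota.
by rewrite mem_iota lk => /(_ isT)/eqP.
Qed.

(** Compatibility of order 3 for nets of degree 5, with the two arguments at the
common point replaced by vertices of the common face. *)
Definition zcompat (c : nat -> znet) : bool :=
  all (fun k => all (fun l =>
    let f := nth [::] (nth [::] common_faces k) l in
    all (fun r => let w := zv (pc k r) in
      let ck := zstep w (c k) in let cl := zstep w (c l) in
      all (fun s => let u := zv (pc k s) in
        zagree 3 (zstep u ck) (zstep u cl)) f) f)
    (iota 0 k)) (iota 0 12).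

Section Compat.
Context {R : realType}.
Variables v1 v2 v3 : R * R.
Hypothesis nd : nondegenerate_triangle (Triangle v1 v2 v3).
Let t := Triangle v1 v2 v3.
Local Notation coords := (coords v1 v2 v3).
Local Notation dcoords := (dcoords v1 v2 v3).
Local Notation pt := (pt v1 v2 v3).
Local Notation piece := (piece v1 v2 v3).
Local Notation vtx := (@vtx R).

Definition rnet (c : znet) : nat -> nat -> R := fun i j => toR (c i j).

Lemma rnet_step w c : rnet (zstep w c) = step (toR3 w) (rnet c).
Proof. by apply/netP => i j; rewrite /rnet /zstep /step !toRD !toRM. Qed.

Lemma step_scalel a X (c : nat -> nat -> R) : step (a *: X) c = net_scale a (step X c).
Proof. by apply/netP => i j; rewrite /step /net_scale /= /GRing.scale /=; ring. Qed.

Lemma zagreeP r c c' : zagree r c c' -> agree r (rnet c) (rnet c').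
Proof.
move=> /allP h i j ij; have /h/allP/(_ j) : i \in iota 0 r.+1.
  by rewrite mem_iota add0n ltnS (leq_trans _ ij) // leq_addr.
have -> : j \in iota 0 (r - i).+1.
  by rewrite mem_iota add0n ltnS leq_subRL ?(leq_trans _ ij) ?leq_addr.
by move=> /(_ isT)/Z.eqb_spec; rewrite /rnet => ->.
Qed.

(** As [face1] and its variants, multiplied by the square of the determinant, so
that the sign of an integer decides. *)
Definition form (A B C : R * R * R) (s : nat) X : R :=
  let m := subst3 s X A B C in det3 m.1.1 m.1.2 m.2 * det3 A B C.

Lemma formE a b c s n : form (vtx a) (vtx b) (vtx c) s (vtx n) =
  12 ^- 6 * toR (zform a b c s n).
Proof.
have e : (12 : R) ^- 6 = 12 ^- 3 * 12 ^- 3 by rewrite -invrM ?unitfE ?expf_neq0 // -exprD.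
rewrite /form /zform toRM e mulrACA -det_vtx; congr (_ * _).
by case: s => [|[|s]] /=; exact: det_vtx.
Qed.

Lemma form_comb A B C s X Y Z (x y z : R) :
  form A B C s (x *: X + y *: Y + z *: Z) =
  x * form A B C s X + y * form A B C s Y + z * form A B C s Z.
Proof.
rewrite /form; set d := det3 A B C.
by case: s => [|[|s]]; rewrite /= /det3 /= /GRing.scale /=; ring.
Qed.

Lemma hull_form A B C p : weight A = 1 -> weight B = 1 -> weight C = 1 ->
    det3 A B C != 0 ->
  conv_hull [:: pt A; pt B; pt C] p <->
  forall s, (s < 3)%N -> 0 <= form A B C s (coords p).
Proof.
move=> wA wB wC d0; rewrite (hull3P nd) //.
have e x : (0 <= x / det3 A B C) = (0 <= x * det3 A B C).
  have -> : x * det3 A B C = x / det3 A B C * det3 A B C ^+ 2 by field.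
  have dp : 0 < det3 A B C ^+ 2 by rewrite lt_neqAle eq_sym sqrf_eq0 d0 sqr_ge0.
  by rewrite (pmulr_lge0 _ dp).
rewrite !e; split=> [[h1 h2 h3] [|[|[|//]]] _ //|h].
by split; [exact: (h 0%N)|exact: (h 1%N)|exact: (h 2%N)].
Qed.

Lemma piece_form (k : 'I_12) p : piece k p <-> forall s, (s < 3)%N ->
  0 <= form (vtx (pc k 0)) (vtx (pc k 1)) (vtx (pc k 2)) s (coords p).
Proof. by apply: hull_form; rewrite ?weight_vtx ?pc_lt ?piece_det_neq0. Qed.

Lemma piece_comb (k : 'I_12) p : piece k p -> exists w : nat -> R,
  [/\ forall r, 0 <= w r, w 0%N + w 1%N + w 2%N = 1 & coords p =
    w 0%N *: vtx (pc k 0) + w 1%N *: vtx (pc k 1) + w 2%N *: vtx (pc k 2)].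
Proof.
move=> /conv_hull3[a [b [c [a0 b0 c0 s e]]]].
exists (fun r => nth 0 [:: a; b; c] r); split=> //=.
  by move=> [|[|[|[]]]].
by rewrite e pt_comb3 coords_pt // weight_comb3 ?weight_vtx ?pc_lt.
Qed.

(** Write the coordinates of p as a combination of the vertices of k with
nonnegative weights.  A side of l separating k from l is nonpositive at the
vertices of k and nonnegative at p, hence the weights of the vertices of k off
that side vanish. *)
Lemma piece_common (k l : 'I_12) p : piece k p -> piece l p ->
  exists w : nat -> R,
  (forall r, (r < 3)%N -> r \notin common_face k l -> w r = 0) /\ coords p =
    w 0%N *: vtx (pc k 0) + w 1%N *: vtx (pc k 1) + w 2%N *: vtx (pc k 2).
Proof.
move=> /piece_comb[w [w0 _ e]] /piece_form hl; exists w; split=> // r r3.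
rewrite mem_filter mem_iota leq0n add0n r3 /zcommon !andbT -has_predC => /hasP[s].
rewrite mem_iota leq0n add0n => s3.
rewrite [predC _ _]negb_imply => /andP[/allP neg nz].
have := hl s s3; rewrite e form_comb !formE -/(zface _ _ _) -/(zface _ _ _)
  -/(zface _ _ _).
set c := 12 ^- 6; have c0 : 0 < c by rewrite invr_gt0 exprn_gt0.
have np r' : (r' < 3)%N -> w r' * (c * toR (zface l s (pc k r'))) <= 0.
  move=> r3'; apply: mulr_ge0_le0 => //; apply: mulr_ge0_le0; first exact: ltW.
  by apply: toR_le0; apply: neg; rewrite mem_iota.
have n0 := np 0%N isT; have n1 := np 1%N isT; have n2 := np 2%N isT.
move=> sum; have : w r * (c * toR (zface l s (pc k r))) = 0.
  by case: r r3 {nz} => [|[|[|//]]] _; lra.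
move/eqP; rewrite !mulf_eq0 (gt_eqF c0) toR_eq0 (negbTE nz) !orbF.
by move/eqP.
Qed.

Lemma vtxE n : vtx n = 12^-1 *: toR3 (zv n). Proof. by []. Qed.

(** Two steps at a combination of vertices expand into steps at pairs of these
vertices. *)
Lemma zcompatP c : zcompat c -> compat v1 v2 v3 piece 2 3 (fun k => rnet (c k)).
Proof.
move=> zc.
have main (k l : 'I_12) p : (l < k)%N -> piece k p -> piece l p ->
    agree 3 (iter 2 (step (coords p)) (rnet (c k)))
            (iter 2 (step (coords p)) (rnet (c l))).
  move=> lk Pk Pl; have [w [w0 e]] := piece_common Pk Pl.
  have H r s : (r < 3)%N -> (s < 3)%N -> forall i j, (i + j <= 3)%N ->
    w r * w s * step (vtx (pc k s)) (step (vtx (pc k r)) (rnet (c k))) i j =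
    w r * w s * step (vtx (pc k s)) (step (vtx (pc k r)) (rnet (c l))) i j.
    move=> r3 s3 i j ij.
    have [rc|/(w0 r r3)->] := boolP (r \in common_face k l); last by rewrite !mul0r.
    have [sc|/(w0 s s3)->] := boolP (s \in common_face k l); last by rewrite mulr0 !mul0r.
    congr (_ * _); rewrite !vtxE !step_scalel !step_scale /net_scale; congr (_ * (_ * _)).
    have /allP/(_ k) := zc; rewrite mem_iota leq0n add0n ltn_ord => /(_ isT).
    move=> /allP/(_ l); rewrite mem_iota leq0n add0n lk common_facesE // => /(_ isT).
    move=> /allP/(_ r rc)/allP/(_ s sc)/zagreeP; rewrite !rnet_step; exact.
  move=> i j ij.
  have E c' : iter 2 (step (coords p)) c' i j =
    \sum_(r < 3) \sum_(s < 3)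
       w r * w s * step (vtx (pc k s)) (step (vtx (pc k r)) c') i j.
    rewrite !big_ord_recl !big_ord0 /= e !step_addl !step_scalel /=.
    by rewrite /net_add /net_scale /bump /= !(step_plus, step_scale) /net_add /net_scale; ring.
  by rewrite !E; apply: eq_bigr => r _; apply: eq_bigr => s _; apply: H.
move=> k l p Pk Pl i j ij.
have [kl|kl|/val_inj ->] := ltngtP l k; first by apply: main.
  by apply/esym; apply: main.
by [].
Qed.

(** For points of weight 1 the determinant is the cross product of X - A and
B - A. *)
Lemma det3_line (A B X : R * R * R) : weight A = 1 -> weight B = 1 -> weight X = 1 -> A != B ->
  det3 X A B = 0 -> exists a, X = A + a *: (B - A).
Proof.
case: A B X => [[a1 a2] a3] [[b1 b2] b3] [[x1 x2] x3]; rewrite /weight /=.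
move=> wA wB wX nAB d.
have e3 : a3 = 1 - a1 - a2 by lra.
have f3 : b3 = 1 - b1 - b2 by lra.
have g3 : x3 = 1 - x1 - x2 by lra.
have k : (x1 - a1) * (b2 - a2) = (x2 - a2) * (b1 - a1).
  by move: d; rewrite /det3 /= e3 f3 g3 => d; nra.
have [b10|b10] := eqVneq (b1 - a1) 0; last first.
  exists ((x1 - a1) / (b1 - a1)).
  have x2E : x2 = a2 + (x1 - a1) / (b1 - a1) * (b2 - a2).
    by rewrite mulrAC k mulfK // subrKC.
  apply: tripleE; rewrite /= /GRing.scale /=; first by rewrite divfK // subrKC.
    exact: x2E.
  rewrite e3 f3 g3; move: x2E; have : (x1 - a1) / (b1 - a1) * (b1 - a1) = x1 - a1.
    by rewrite divfK.
  by set a := _ / _; lra.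
have b20 : b2 - a2 != 0.
  apply: contraNneq nAB => b20; apply/eqP; congr (_, _, _); lra.
have x1E : x1 = a1.
  apply/eqP; rewrite -subr_eq0; have : (x1 - a1) * (b2 - a2) == 0.
    by rewrite k b10 mulr0.
  by rewrite mulf_eq0 (negbTE b20) orbF.
exists ((x2 - a2) / (b2 - a2)).
apply: tripleE; rewrite /= /GRing.scale /=.
- by rewrite b10 mulr0 addr0.
- by rewrite divfK // subrKC.
rewrite e3 f3 g3 (_ : 1 - b1 - b2 - (1 - a1 - a2) = - (b2 - a2)); last by lra.
by rewrite mulrN divfK //; lra.
Qed.

Lemma zv_inj (i j : 'I_10) : i != j -> vtx i != vtx j.
Proof.
move=> ij; rewrite !vtxE; apply/eqP => /(scalerI _) H.
have {}H : toR3 (zv i) = toR3 (zv j) :> R * R * R by apply: H; rewrite invr_neq0.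
have e1 : (Z.sub (zv i).1.1 (zv j).1.1 =? 0)%BZ.
  by rewrite -(@toR_eq0 R) toRB subr_eq0; apply/eqP; exact: (congr1 (fun x => x.1.1) H).
have e2 : (Z.sub (zv i).1.2 (zv j).1.2 =? 0)%BZ.
  by rewrite -(@toR_eq0 R) toRB subr_eq0; apply/eqP; exact: (congr1 (fun x => x.1.2) H).
have := @all_iota2P 10 10 (fun i j => (Z.sub (zv i).1.1 (zv j).1.1 =? 0)%BZ &&
  (Z.sub (zv i).1.2 (zv j).1.2 =? 0)%BZ ==> (i == j)) isT i j (ltn_ord i)
  (ltn_ord j).
by rewrite /= e1 e2 /= => /eqP/val_inj/eqP; rewrite (negbTE ij).
Qed.

Lemma genericP x : generic t x <-> forall i j : 'I_10, i != j ->
  det3 (coords x) (vtx i) (vtx j) != 0.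
Proof.
split=> [g i j ij|h i j ij].
  apply: contra_notN (g i j ij) => /eqP d; rewrite /line !vertE /=.
  have [a e] := det3_line (weight_vtx (ltn_ord i)) (weight_vtx (ltn_ord j))
    (weight_coords v1 v2 v3 x) (zv_inj ij) d.
  exists a; rewrite -{1}(pt_coords nd x) e.
  by rewrite /pt; apply: pairE; rewrite /= /GRing.scale /=; ring.
rewrite /line !vertE => -[a e]; have /eqP := h i j ij; apply.
have -> : coords x = vtx i + a *: (vtx j - vtx i).
  have -> : x = pt (vtx i + a *: (vtx j - vtx i)).
    by rewrite e /pt; apply: pairE; rewrite /= /GRing.scale /=; ring.
  rewrite coords_pt //; have wi := weight_vtx (R := R) (ltn_ord i).
  have wj := weight_vtx (R := R) (ltn_ord j).
  rewrite (_ : weight _ = weight (vtx i) + a * (weight (vtx j) - weight (vtx i))).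
    by rewrite wi wj subrr mulr0 addr0.
  by rewrite /weight /= /GRing.scale /=; ring.
by rewrite /det3 /= /GRing.scale /=; ring.
Qed.

(** Barycentric coordinates, multiplied by 100, of an interior point that lies on
no line through two of the ten vertices. *)
Definition zgen : Z * Z * Z := (47, 33, 20)%BZ.

Lemma det_gen_neq0 (i j : 'I_10) : i != j ->
  det3 (100^-1 *: toR3 zgen : R * R * R) (vtx i) (vtx j) != 0.
Proof.
move=> ij; rewrite (_ : det3 _ _ _ = 100^-1 * 12 ^- 2 * toR (zdet zgen (zv i) (zv j))).
  rewrite !mulf_neq0 ?invr_neq0 ?expf_neq0 // toR_eq0.
  have := @all_iota2P 10 10 (fun i j => (i != j) ==>
    ~~ (zdet zgen (zv i) (zv j) =? 0)%BZ) isT i j (ltn_ord i) (ltn_ord j).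
  by rewrite /= val_eqE ij.
by rewrite toR_det /vtx /det3 /= /GRing.scale /=; field.
Qed.

(** On the segment from p to a fixed generic point, each of the finitely many
lines has at most one point, so the points near p are generic. *)
Lemma generic_dense p : region t p -> closure (region t `&` generic t) p.
Proof.
move=> rp; pose C : R * R * R := 100^-1 *: toR3 zgen; pose c := pt C.
have wC : weight C = 1.
  rewrite /C /weight /= /GRing.scale /= -!mulrDr -!toRD.
  by rewrite (_ : toR _ = 100) ?mulVf.
have cC : coords c = C by rewrite coords_pt.
have segE (h : R) X Y : det3 (coords (p + h *: (c - p))) X Y =
   (1 - h) * det3 (coords p) X Y + h * det3 C X Y.
  rewrite coords_add.
  have -> : dcoords (c - p) = C - coords p.
    have := coords_add v1 v2 v3 p (c - p) 1.
    rewrite !scale1r subrKC cC => ->; by rewrite [_ + dcoords _]addrC addrK.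
  by move: (coords p) => P; rewrite /det3 /= /GRing.scale /=; ring.
have seg_region (h : R) : 0 < h -> h <= 1 -> region t (p + h *: (c - p)).
  move=> h0 h1; apply/regionP => //.
  rewrite coords_add.
  have -> : dcoords (c - p) = C - coords p.
    have := coords_add v1 v2 v3 p (c - p) 1.
    rewrite !scale1r subrKC cC => ->; by rewrite [_ + dcoords _]addrC addrK.
  have [x0 y0 z0] := (regionP nd p).1 rp.
  move: (coords p) x0 y0 z0 => P x0 y0 z0.
  have [c1 c2 c3] : [/\ 0 <= C.1.1, 0 <= C.1.2 & 0 <= C.2].
    by rewrite /C /= /GRing.scale /=; split; apply: mulr_ge0;
      rewrite ?invr_ge0 //; apply: toR_ge0.
  by rewrite /= /GRing.scale /=; split; nra.
move=> V nV.
have cv : (fun h : R => p + h *: (c - p)) @ 0^'+ --> p.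
  rewrite [X in _ --> X](_ : p = p + (0 : R) *: (c - p)); last first.
    by rewrite scale0r addr0.
  apply: cvgD; first exact: cvg_cst.
  apply: cvgZr_tmp.
  by apply: cvg_at_right_filter; exact: cvg_id.
have HV : \forall h \near (0 : R)^'+, V (p + h *: (c - p)) by exact: cv.
have HG : \forall h \near (0 : R)^'+, forall i j : 'I_10, i != j ->
    det3 (coords (p + h *: (c - p))) (vtx i) (vtx j) != 0.
  apply: filter_forall => i; apply: filter_forall => j.
  have [->|ij] := eqVneq i j; first by near=> h.
  have d0 := det_gen_neq0 ij; rewrite -/C in d0.
  set a := det3 (coords p) (vtx i) (vtx j); set b := det3 C _ _ in d0.
  (* The determinant along the segment is (1 - h) a + h b with b nonzero: it
     vanishes for no h > 0 if a = 0, and for no h < |a| / (|a| + |b|) otherwise. *)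
  have [a0|a0] := eqVneq a 0.
    near=> h => _; have h0 : 0 < h by near: h; exact: nbhs_right_gt.
    rewrite segE -/a -/b a0 mulr0 add0r.
    by apply: mulf_neq0 => //; exact: lt0r_neq0.
  have hb : 0 < `|a| / (`|a| + `|b|).
    by rewrite divr_gt0 ?normr_gt0 // ltr_pwDl ?normr_gt0.
  near=> h => _; rewrite segE -/a -/b.
  have h0 : 0 < h by near: h; exact: nbhs_right_gt.
  have hlt : h < `|a| / (`|a| + `|b|) by near: h; exact: nbhs_right_lt.
  have s0 : 0 < `|a| + `|b| by rewrite ltr_pwDl ?normr_gt0.
  rewrite ltr_pdivlMr // in hlt.
  apply/eqP => e0.
  have : `|a| = h * `|a - b|.
    rewrite -[h in RHS](gtr0_norm h0) -normrM; congr `|_|; lra.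
  have := ler_normB a b; nra.
have [h [[Vh gh] [h0 hle1]]] : exists h : R, (V (p + h *: (c - p)) /\
    forall i j : 'I_10, i != j ->
    det3 (coords (p + h *: (c - p))) (vtx i) (vtx j) != 0) /\ 0 < h /\ h <= 1.
  near (0 : R)^'+ => h; exists h; split; first split.
  - by near: h.
  - by near: h.
  split; first by near: h; exact: nbhs_right_gt.
  by near: h; exact: nbhs_right_le.
exists (p + h *: (c - p)); split => //; split; first exact: seg_region.
exact/genericP.
Unshelve. all: by end_near. Qed.

End Compat.

(** * Convex hulls of knots *)

Section Knots.
Context {R : realType}.
Variables v1 v2 v3 : R * R.
Hypothesis nd : nondegenerate_triangle (Triangle v1 v2 v3).
Let t := Triangle v1 v2 v3.
Local Notation coords := (coords v1 v2 v3).
Local Notation dcoords := (dcoords v1 v2 v3).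
Local Notation pt := (pt v1 v2 v3).
Local Notation vtx := (@vtx R).
Implicit Types (K : knots) (x p : R * R).

(** Convex combinations of the list of vertices with positive multiplicity are
reindexed by all ten vertices. *)
Lemma knots_hullP K p : knots_hull t K p <-> exists b : 'I_10 -> R,
  [/\ forall j, 0 <= b j, \sum_j b j = 1, p = \sum_j b j *: vert t j &
      forall j, K j = 0%N -> b j = 0].
Proof.
rewrite /knots_hull; set e := [seq j <- enum 'I_10 | (0 < K j)%N].
have ue : uniq e by rewrite filter_uniq ?enum_uniq.
have sumE (V : nmodType) (F : 'I_10 -> V) : (forall j, K j = 0%N -> F j = 0) ->
    \sum_j F j = \sum_(i < size e) F (nth ord0 e i).
  move=> F0; transitivity (\sum_(j <- e) F j); last first.
    by rewrite (big_nth ord0) big_mkord.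
  rewrite big_filter big_enum_cond /= (bigID (fun j => 0 < K j)%N) /= [X in _ + X]big1 ?addr0 //.
  by move=> j; rewrite lt0n negbK => /eqP/F0.
have se : size [seq vert t j | j <- e] = size e by rewrite size_map.
have nthE i : (i < size e)%N ->
    [seq vert t j | j <- e]`_i = vert t (nth ord0 e i).
  by move=> ie; rewrite (nth_map ord0).
have castE (V : nmodType) (F : 'I_(size [seq vert t j | j <- e]) -> V) :
    \sum_i F i = \sum_(i < size e) F (cast_ord (esym se) i).
  rewrite (reindex (cast_ord (esym se))) //=; exists (cast_ord se) => i _.
    by apply: val_inj.
  by apply: val_inj.
split=> [[a [a0 a1 ->]]|[b [b0 b1 -> bK]]].
  pose a' (i : nat) : R := if insub i is Some i' then a i' else 0.
  pose b j := if (0 < K j)%N then a' (index j e) else 0.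
  have bE (i : 'I_(size e)) : b (nth ord0 e i) = a (cast_ord (esym se) i).
    have ie : (i < size e)%N by [].
    have : nth ord0 e i \in e by rewrite mem_nth.
    rewrite /b mem_filter => /andP[-> _]; rewrite index_uniq // /a'.
    case: insubP => [u _ ui|]; last by move=> /negP[]; rewrite se.
    by congr a; apply: val_inj.
  have bK j : K j = 0%N -> b j = 0 by rewrite /b => ->.
  exists b; split=> //.
  - move=> j; rewrite /b; case: ifP => // _; rewrite /a'.
    by case: insub => // u; exact: a0.
  - rewrite sumE // -a1 castE /=.
    by apply: eq_bigr => i _; rewrite bE.
  - rewrite (@sumE _ (fun j => b j *: vert t j)); last by move=> j /bK ->; rewrite scale0r.
    rewrite castE /=.
    by apply: eq_bigr => i _; rewrite bE nthE.
exists (fun i => b (nth ord0 e i)); split.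
- by move=> i; exact: b0.
- rewrite castE /= -b1 sumE //.
- rewrite castE /=.
  rewrite (@sumE _ (fun j => b j *: vert t j)); last by move=> j /bK ->; rewrite scale0r.
  by apply: eq_bigr => i _; rewrite nthE.
Qed.

Lemma cross_pt A B C : weight A = 1 -> weight B = 1 -> weight C = 1 ->
  cross (pt B - pt A) (pt C - pt A) = cross (v2 - v1) (v3 - v1) * det3 A B C.
Proof.
case: A B C => [[a1 a2] a3] [[b1 b2] b3] [[c1 c2] c3]; rewrite /weight /= => wA wB wC.
have -> : a1 = 1 - a2 - a3 by lra.
have -> : b1 = 1 - b2 - b3 by lra.
have -> : c1 = 1 - c2 - c3 by lra.
by rewrite /cross /pt /det3 /= /GRing.scale /=; ring.
Qed.

Definition base (i j l : 'I_10) (a b c : R) : 'I_10 -> R :=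
  fun n => a * (n == i)%:R + b * (n == j)%:R + c * (n == l)%:R.

Lemma sum_base i j l a b c : \sum_n base i j l a b c n = a + b + c.
Proof.
rewrite !big_split -!mulr_sumr /=.
have E (k : 'I_10) : \sum_n (n == k)%:R = 1 :> R.
  by rewrite (bigD1 k) //= eqxx big1 ?addr0 // => n /negbTE ->.
by rewrite !E !mulr1.
Qed.

Lemma sum_base_scale (V : lmodType R) (F : 'I_10 -> V) i j l a b c :
  \sum_n base i j l a b c n *: F n = a *: F i + b *: F j + c *: F l.
Proof.
have E (k : 'I_10) (x : R) : \sum_n (x * (n == k)%:R) *: F n = x *: F k.
  rewrite (bigD1 k) //= eqxx mulr1 big1 ?addr0 // => n /negbTE ->.
  by rewrite mulr0 scale0r.
by rewrite -!E -!big_split; apply: eq_bigr => n _; rewrite /base !scalerDl.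
Qed.

Lemma base0 K i j l a b c n : K i != 0%N -> K j != 0%N -> K l != 0%N ->
  K n = 0%N -> base i j l a b c n = 0.
Proof.
move=> Ki Kj Kl Kn; rewrite /base.
have -> : (n == i) = false by apply: contraNF Ki => /eqP <-; apply/eqP.
have -> : (n == j) = false by apply: contraNF Kj => /eqP <-; apply/eqP.
have -> : (n == l) = false by apply: contraNF Kl => /eqP <-; apply/eqP.
by rewrite !mulr0 !addr0.
Qed.

Section Noncollinear.
Variables (K : knots) (i j l : 'I_10).
Hypotheses (Ki : K i != 0%N) (Kj : K j != 0%N) (Kl : K l != 0%N).
Hypothesis d0 : det3 (vtx i) (vtx j) (vtx l) != 0.
Let wv n : weight (vtx (nat_of_ord (n : 'I_10))) = 1. Proof. exact: weight_vtx. Qed.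

Lemma sub_knots_hull :
  conv_hull [:: pt (vtx i); pt (vtx j); pt (vtx l)] `<=` knots_hull t K.
Proof.
move=> p /conv_hull3[a [b [c [a0 b0 c0 s ->]]]]; apply/knots_hullP.
exists (base i j l a b c); split.
- by move=> n; rewrite /base; do 2 ?apply: addr_ge0; apply: mulr_ge0.
- by rewrite sum_base.
- by rewrite (sum_base_scale (vert t)) !vertE.
- by move=> n; exact: base0.
Qed.

Lemma area_knots_neq0 : area (knots_hull t K) != 0.
Proof.
pose M : R := \sum_j (`|(vert t j).1| + `|(vert t j).2|).
apply: (@area_neq0 R _ (pt (vtx i)) (pt (vtx j)) (pt (vtx l)) M).
- by rewrite cross_pt ?wv // mulf_neq0.
- exact: sub_knots_hull.
move=> p /knots_hullP[b [b0 b1 -> _]].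
have b01 n : b n <= 1.
  by rewrite -b1 (bigD1 n) //= lerDl sumr_ge0.
have fst_sum : (\sum_n b n *: vert t n).1 = \sum_n b n * (vert t n).1.
  by apply: (big_morph (fun p : R * R => p.1)).
have snd_sum : (\sum_n b n *: vert t n).2 = \sum_n b n * (vert t n).2.
  by apply: (big_morph (fun p : R * R => p.2)).
rewrite fst_sum snd_sum; split; apply: (le_trans (ler_norm_sum _ _ _));
  apply: ler_sum => n _; rewrite normrM (ger0_norm (b0 n)).
  by apply: (@le_trans _ _ `|(vert t n).1|); [exact: ler_piMl|rewrite lerDl].
by apply: (@le_trans _ _ `|(vert t n).2|); [exact: ler_piMl|rewrite lerDr].
Qed.

Lemma bary_spec_exists x : exists b, bary_spec t K x b.
Proof.
have [a [b [c [s e]]]] : exists a b c, a + b + c = 1 /\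
    coords x = a *: vtx i + b *: vtx j + c *: vtx l.
  set A := vtx i; set B := vtx j; set C := vtx l; set X := coords x.
  exists (det3 X B C / det3 A B C), (det3 A X C / det3 A B C),
    (det3 A B X / det3 A B C); split.
    by rewrite -!mulrDl weight_det ?wv ?weight_coords // divff.
  have e f h := @cramer R A B C X f h.
  have F y : y = det3 A B C * y / det3 A B C by rewrite mulrAC divff // mul1r.
  apply: tripleE; rewrite [LHS]F.
  - by rewrite (e (fun Z => Z.1.1)); [rewrite /= /GRing.scale /=; ring|left].
  - by rewrite (e (fun Z => Z.1.2)); [rewrite /= /GRing.scale /=; ring|right; left].
  - by rewrite (e (fun Z => Z.2)); [rewrite /= /GRing.scale /=; ring|right; right].
exists (base i j l a b c); split.
- rewrite (sum_base_scale (vert t)) !vertE pt_comb3 -e.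
  by rewrite (pt_coords nd).
- by rewrite sum_base.
- by move=> n; exact: base0.
Qed.
End Noncollinear.

(** Linear functions of the coordinates of x are averages, by the coefficients b,
of their values at the vertices. *)
Lemma coords_bary K x b : bary_spec t K x b ->
  forall f : R * R * R -> R, (forall X Y a, f (a *: X + Y) = a * f X + f Y) ->
  f (coords x) = \sum_j b j * f (vtx j).
Proof.
move=> [e b1 _] f fl.
have f0 : f 0 = 0.
  by have := fl 0 0 (-1); rewrite scaleN1r addrC subrr; lra.
have sumE (F : 'I_10 -> R * R * R) : f (\sum_j b j *: F j) = \sum_j b j * f (F j).
  rewrite (big_morph f (id1 := 0) (op1 := +%R)) //.
    by apply: eq_bigr => j _; rewrite -[b j *: _]addr0 fl f0 addr0.
  by move=> X Y; rewrite -[X]scale1r fl mul1r scale1r.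
rewrite -sumE; congr f.
rewrite -[RHS](@coords_pt R v1 v2 v3 nd).
  congr coords; rewrite e.
  have ptS (F : 'I_10 -> R * R * R) : pt (\sum_j b j *: F j) = \sum_j b j *: pt (F j).
    rewrite (big_morph pt (id1 := 0) (op1 := +%R)).
    - by apply: eq_bigr => j _; apply: pairE; rewrite /pt /= /GRing.scale /=; ring.
    - by move=> X Y; apply: pairE; rewrite /pt /= /GRing.scale /=; ring.
    - by rewrite /pt /= !scale0r !addr0.
  by rewrite ptS; apply: eq_bigr => j _; rewrite vertE.
have wS (F : 'I_10 -> R * R * R) : weight (\sum_j b j *: F j) = \sum_j b j * weight (F j).
  rewrite (big_morph weight (id1 := 0) (op1 := +%R)).
  - by apply: eq_bigr => j _; rewrite /weight /= /GRing.scale /=; ring.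
  - by move=> X Y; rewrite /weight /=; ring.
  - by rewrite /weight /=; ring.
by rewrite wS -b1; apply: eq_bigr => j _; rewrite weight_vtx // mulr1.
Qed.

(** If two vertices are distinct, the hull lies on the line through them;
otherwise it is a point or empty. *)
Lemma area_knots_eq0 K :
  (forall i j l : 'I_10, K i != 0%N -> K j != 0%N -> K l != 0%N ->
     det3 (vtx i) (vtx j) (vtx l) = 0) -> area (knots_hull t K) = 0.
Proof.
move=> col.
have [/existsP[i Ki]|/existsPn no] := boolP [exists i, K i != 0%N]; last first.
  apply: (@area_line0 R _ (1, 0) 0).
    by apply/eqP => -[] /eqP; rewrite oner_eq0.
  move=> p /knots_hullP[b [_ + _ bK]]; rewrite big1 => [/esym/eqP|].
    by rewrite oner_eq0.
  by move=> j _; apply: bK; apply/eqP; have := no j; rewrite negbK.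
have [/existsP[j /andP[Kj ij]]|/existsPn no] :=
    boolP [exists j, (K j != 0%N) && (j != i)].
  apply: (@area_line0 R _ (pt (vtx j) - pt (vtx i)) (pt (vtx i))).
    rewrite subr_eq0; apply/eqP => /(congr1 coords).
    by rewrite !coords_pt ?weight_vtx //; apply/eqP; exact: zv_inj.
  move=> x hx; have [b [b0 b1 e bK]] := (knots_hullP K x).1 hx.
  rewrite -(pt_coords nd x) (_ : cross _ _ =
     - cross (pt (vtx j) - pt (vtx i)) (pt (coords x) - pt (vtx i))); last first.
    by rewrite /cross; ring.
  rewrite cross_pt ?weight_vtx ?weight_coords //.
  have -> : det3 (vtx i) (vtx j) (coords x) = 0.
    rewrite (@coords_bary K x b (And3 e b1 bK) (fun X => det3 (vtx i) (vtx j) X)).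
      rewrite big1 // => n _; have [/bK ->|Kn] := eqVneq (K n) 0%N.
        by rewrite mul0r.
      by rewrite col // mulr0.
    by move=> X Y a; rewrite /det3 /= /GRing.scale /=; ring.
  by rewrite mulr0 oppr0.
apply: (@area_line0 R _ (1, 0) (vert t i)).
  by apply/eqP => -[] /eqP; rewrite oner_eq0.
move=> x /knots_hullP[b [b0 b1 -> bK]].
have bi n : n != i -> b n = 0.
  by move=> ni; apply: bK; apply/eqP; have := no n; rewrite ni andbT negbK.
rewrite (bigD1 i) //= big1 => [|n ni]; last by rewrite bi // scale0r.
have -> : b i = 1.
  by rewrite -b1 (bigD1 i) //= big1 ?addr0 // => n ni; rewrite bi.
by rewrite scale1r addr0 subrr /cross mul0r mul0r subrr.
Qed.

Lemma area_ratio (A B C : R * R * R) : weight A = 1 -> weight B = 1 -> weight C = 1 ->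
  det3 A B C != 0 ->
  area (region t) / area (conv_hull [:: pt A; pt B; pt C]) = `|det3 A B C|^-1.
Proof.
move=> wA wB wC d0; have [c0 c00 E] := @area_tri R.
rewrite E ?cross_pt ?mulf_neq0 // /region E //.
have D0 : `|cross (v2 - v1) (v3 - v1)| != 0 by rewrite normr_eq0.
rewrite /= normrM; field.
by rewrite D0 normr_eq0 d0 gt_eqF.
Qed.
End Knots.

(** * A table of nets for the simplex splines *)

Definition multiplicity (K : seq nat) (j : nat) : nat := nth 0%N K j.
Definition supp (K : seq nat) : seq nat := [seq j <- iota 0 6 | multiplicity K j != 0%N].
Definition remove_knot (K : seq nat) (j : nat) : seq nat :=
  mkseq (fun i => (multiplicity K i - (i == j))%N) 6.
Definition collinear (K : seq nat) : bool :=
  let s := supp K in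
  all (fun i => all (fun j => all (fun l =>
    zdet (zv i) (zv j) (zv l) =? 0)%BZ s) s) s.

(** The knot multisets of one cardinality, as lists of the multiplicities of the
first six vertices, each with the nets of its simplex spline on the twelve
pieces; a net is a list of rows, empty if it vanishes. *)
Definition level := seq (seq nat * seq (seq (seq Z))).
Fixpoint find_nets (K : seq nat) (l : level) : seq (seq (seq Z)) :=
  if l is (K', N) :: l' then if K == K' then N else find_nets K l' else [::].

Section Build.
(** The knot multisets of the simplex splines of degree 5 in the theorem. *)
Definition max_knots : seq (seq nat) :=
  [:: [:: 6; 0; 0; 1; 0; 1]; [:: 5; 0; 0; 2; 0; 1]; [:: 5; 0; 0; 1; 0; 2];
      [:: 4; 1; 0; 2; 0; 1]; [:: 4; 0; 1; 1; 0; 2]; [:: 4; 1; 1; 1; 0; 1];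
      [:: 3; 1; 1; 2; 0; 1]; [:: 3; 1; 1; 1; 0; 2]; [:: 3; 2; 0; 2; 0; 1];
      [:: 3; 0; 2; 1; 0; 2]; [:: 2; 1; 1; 2; 1; 1]; [:: 2; 1; 1; 1; 1; 2];
      [:: 2; 2; 0; 2; 1; 1]; [:: 2; 0; 2; 1; 1; 2]; [:: 1; 1; 2; 1; 1; 2];
      [:: 1; 2; 1; 2; 1; 1]]%N.

Definition sub_knots (K : seq nat) : seq (seq nat) :=
  foldr (fun m acc => [seq i :: l | i <- iota 0 m.+1, l <- acc]) [:: [::]] K.

Definition all_knots : seq (seq nat) :=
  [seq K <- undup (flatten (map sub_knots max_knots)) | ~~ collinear K].

Definition find_basis (K : seq nat) : nat * nat * nat :=
  let s := supp K in
  head (0, 0, 0)%N [seq w <- [seq (i, jl.1, jl.2) | i <- s, jl <- [seq (j, l) | j <- s, l <- s]]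
    | ~~ (zdet (zv w.1.1) (zv w.1.2) (zv w.2) =? 0)%BZ].

(** By convexity it suffices to test the vertices of the piece. *)
Definition inside (i j l k : nat) : bool :=
  all (fun s => all (fun r => 0 <=? zform i j l s (pc k r))%BZ (iota 0 3)) (iota 0 3).

Definition mk_rows (d : nat) (c : nat -> nat -> Z) : seq (seq Z) :=
  let m := [seq [seq c i j | j <- iota 0 (d - i).+1] | i <- iota 0 d.+1] in
  if all (all (Z.eqb 0)) m then [::] else m.

(** The unit vectors are combinations of three noncollinear knots i, j, l.  Since
a step at a knot must give the net of K without that knot, a step at a unit
vector, which is a shift of the net of K, is a combination of three known nets;
so all entries of the net of K are known.  For |K| = 3 the net is the
constant area(T) / area([K]) on the pieces inside [K]; as the areas are
determinants of coordinates multiplied by 12, area(T) is 12^3. *)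
Definition mk_nets (prev : level) (d : nat) (K : seq nat) : seq (seq (seq Z)) :=
  let: (i, j, l) := find_basis K in
  let a := zv i in let b := zv j in let c := zv l in let D := zdet a b c in
  if d is 0%N then
    [seq mk_rows 0 (fun _ _ => if inside i j l k then (1728 / Z.abs D)%BZ else 0%BZ)
      | k <- iota 0 12]
  else
    let ni := find_nets (remove_knot K i) prev in
    let nj := find_nets (remove_knot K j) prev in
    let nl := find_nets (remove_knot K l) prev in
    [seq let N n := zrows (nth [::] n k) in
      let sh e p q := ((zdet e b c * N ni p q + zdet a e c * N nj p q
         + zdet a b e * N nl p q) / D)%BZ in
      mk_rows d (fun p q => if p is p'.+1 then sh (12, 0, 0)%BZ p' q else
        if q is q'.+1 then sh (0, 12, 0)%BZ p q' else sh (0, 0, 12)%BZ p q)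
      | k <- iota 0 12].

Definition mk_level (prev : level) (d : nat) : level :=
  [seq (K, mk_nets prev d K) | K <- all_knots & sumn K == d.+3].

Fixpoint mk_table (n d : nat) (prev : level) : seq level :=
  if n is n'.+1 then let l := mk_level prev d in l :: mk_table n' d.+1 l else [::].
End Build.

(** The identities of [table_okP] are what characterizes its entries as the nets
of the simplex splines. *)
Definition table : seq level := Eval vm_compute in mk_table 6 0 [::].

Definition nets (d : nat) (K : seq nat) := find_nets K (nth [::] table d).
Definition net (d : nat) (K : seq nat) (k : nat) : znet :=
  zrows (nth [::] (nets d K) k).
Definition known (d : nat) (K : seq nat) : bool :=
  collinear K || (size (nets d K) == 12%N).

(** A piece is inside the triangle of the three knots or is separated from it by
one of its sides. *)
Definition base_ok (K : seq nat) : bool :=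
  let s := supp K in let i := nth 0%N s 0 in let j := nth 0%N s 1 in
  let l := nth 0%N s 2 in
  [&& (size s == 3)%N, ~~ (zdet (zv i) (zv j) (zv l) =? 0)%BZ & all (fun k => let a := net 0 K k 0 0 in
    if inside i j l k then (a * Z.abs (zdet (zv i) (zv j) (zv l)) =? 1728)%BZ
    else (a =? 0)%BZ && has (fun s => all (fun r =>
      zform i j l s (pc k r) <=? 0)%BZ (iota 0 3)) (iota 0 3)) (iota 0 12)].

(** The homogeneous form of the recursion, for every knot and not only for three
of them: step v_j c_K = c_(K - v_j), with v_j multiplied by 12. *)
Definition step_ok (d : nat) (K : seq nat) (N : seq (seq (seq Z))) : bool :=
  all (fun j => (multiplicity K j == 0%N) ||
    (let K' := remove_knot K j in let N' := nets d K' in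
     (collinear K' || (size N' == 12%N)) &&
     all (fun k => zagree d (fun p q => 12 * zrows (nth [::] N' k) p q)%BZ
       (zstep (zv j) (zrows (nth [::] N k)))) (iota 0 12))) (iota 0 6).

Definition table_ok : bool :=
  all (fun d => all (fun e : seq nat * seq (seq (seq Z)) => let: (K, N) := e in
    [&& size K == 6%N, size N == 12%N, ~~ collinear K &
     (if d is d'.+1 then step_ok d' K N else base_ok K)])
    (nth [::] table d)) (iota 0 6).

Lemma table_okP : table_ok. Proof. by vm_compute. Qed.

Definition smooth_ok : bool :=
  all (fun K => (size K == 6%N) && known 5 K && zcompat (net 5 K)) max_knots.
Lemma smooth_okP : smooth_ok. Proof. by vm_compute. Qed.

(** * The recursion of the simplex splines *)

Opaque table.

Definition knots_of (K : seq nat) : knots := fun j => multiplicity K j.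

Lemma mem_supp K j : (j \in supp K) = (j < 6)%N && (multiplicity K j != 0%N).
Proof. by rewrite mem_filter mem_iota andbC. Qed.

Lemma knots_of_lt6 K (j : 'I_10) : size K = 6%N -> knots_of K j != 0%N -> (j < 6)%N.
Proof.
by move=> sK; rewrite ltnNge; apply: contra => h; rewrite /knots_of /multiplicity nth_default ?sK.
Qed.

Lemma knots_of_supp K (j : 'I_10) : size K = 6%N -> knots_of K j != 0%N ->
  nat_of_ord j \in supp K.
Proof. by move=> sK h; rewrite mem_supp (knots_of_lt6 sK h). Qed.

Lemma knots_remove_of K (j : 'I_10) : size K = 6%N -> knots_of K j != 0%N ->
  knots_remove (knots_of K) j = knots_of (remove_knot K j).
Proof.
move=> sK h; apply/funext => i; rewrite /knots_remove /knots_of /remove_knot /multiplicity.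
have [i6|i6] := ltnP i 6; first by rewrite nth_mkseq.
by rewrite [RHS]nth_default ?size_mkseq // nth_default ?sK.
Qed.

Lemma find_nets_mem K l : find_nets K l = [::] \/ (K, find_nets K l) \in l.
Proof.
elim: l => [|[K' N] l [IH|IH]] /=; first by left.
  by case: eqP => [->|_]; [right; rewrite mem_head|left].
by case: eqP => [->|_]; right; [rewrite mem_head|rewrite inE IH orbT].
Qed.

Lemma table_entry d K : (d < 6)%N -> nets d K = [::] \/
  [/\ size K = 6%N, ~~ collinear K &
    if d is d'.+1 then step_ok d' K (nets d K) else base_ok K].
Proof.
move=> d6; rewrite /nets; have [->|h] := find_nets_mem K (nth [::] table d); first by left.
right; have /allP/(_ d) := table_okP; rewrite mem_iota => /(_ d6)/allP/(_ _ h).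
by move=> /and4P[/eqP sK _ nc ok]; split=> //; case: d ok {d6 h}.
Qed.

Section Recursion.
Context {R : realType}.
Variables v1 v2 v3 : R * R.
Hypothesis nd : nondegenerate_triangle (Triangle v1 v2 v3).
Let t := Triangle v1 v2 v3.
Local Notation coords := (coords v1 v2 v3).
Local Notation dcoords := (dcoords v1 v2 v3).
Local Notation pt := (pt v1 v2 v3).
Local Notation vtx := (@vtx R).
Local Notation piece := (piece v1 v2 v3).

Lemma collinear_area K : size K = 6%N -> collinear K ->
  area (knots_hull t (knots_of K)) = 0.
Proof.
move=> sK /allP col; apply: area_knots_eq0 => // i j l Ki Kj Kl.
have /col/allP/(_ j) := knots_of_supp sK Ki.
move=> /(_ (knots_of_supp sK Kj))/allP/(_ l (knots_of_supp sK Kl)).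
by rewrite det_vtx -(@toR_eq0 R) => /eqP ->; rewrite mulr0.
Qed.

Lemma noncollinear_basis K : size K = 6%N -> ~~ collinear K ->
  exists i j l : 'I_10, [/\ knots_of K i != 0%N, knots_of K j != 0%N,
    knots_of K l != 0%N & det3 (vtx i) (vtx j) (vtx l) != 0].
Proof.
move=> sK; have lt (n : nat) : (n < 6)%N -> (n < 10)%N by move/leq_trans; apply.
move=> /allPn[i + /allPn[j + /allPn[l + d0]]].
rewrite !mem_supp => /andP[i6 Ki] /andP[j6 Kj] /andP[l6 Kl].
exists (Ordinal (lt i i6)), (Ordinal (lt j j6)), (Ordinal (lt l l6)).
split=> //; rewrite det_vtx mulf_neq0 ?invr_neq0 ?expf_neq0 //.
by rewrite toR_eq0.
Qed.

Lemma step_coords K x b c : bary_spec t K x b ->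
  step (coords x) c = fun i j => \sum_n b n * step (vtx n) c i j.
Proof.
move=> bs; apply/netP => i j.
rewrite (coords_bary nd bs (f := fun X => step X c i j)) //.
by move=> X Y a; rewrite /step /= /GRing.scale /=; ring.
Qed.

Lemma eval_sum d c (I : finType) (b : I -> R) (N : I -> nat -> nat -> R) X :
  c = (fun i j => \sum_n b n * N n i j) ->
  eval d c X = \sum_n b n * eval d (N n) X.
Proof.
move=> ->; elim: d N => [|d IH] N; first by [].
have e : step X (fun i j => \sum_n b n * N n i j) =
    fun i j => \sum_n b n * step X (N n) i j.
  apply/netP => i j; rewrite /step !mulr_sumr -!big_split.
  by apply: eq_bigr => n _ /=; ring.
by rewrite eval_S e IH; apply: eq_bigr => n _; rewrite eval_S.
Qed.

Definition evalK d K (k : nat) x : R := eval d (rnet (net d K k)) (coords x).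

Lemma net_nil d K k : nets d K = [::] -> net d K k = fun _ _ => 0%BZ.
Proof.
move=> e; apply/funext => i; apply/funext => j.
by rewrite /net e /zrows !nth_nil.
Qed.

Lemma evalK_nil d K k x : nets d K = [::] -> evalK d K k x = 0.
Proof.
move=> /net_nil e; rewrite /evalK e.
have -> : rnet (fun _ _ => 0%BZ) = net_scale (0 : R) (rnet (fun _ _ => 0%BZ)).
  by apply/netP => i j; rewrite /net_scale mul0r.
by rewrite eval_scale mul0r.
Qed.

(** A generic point is on no side of the triangle of the knots, so that on the
pieces outside the characteristic function vanishes. *)
Lemma base_value K k x : base_ok K -> size K = 6%N -> ~~ collinear K ->
  piece k x -> generic t x ->
  \1_(knots_hull t (knots_of K)) x *
    (area (region t) / area (knots_hull t (knots_of K))) = evalK 0 K k x.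
Proof.
move=> /and3P[/eqP size3 zd /allP bk] sK ncol Pk gx.
set i := nth 0%N (supp K) 0; set j := nth 0%N (supp K) 1.
set l := nth 0%N (supp K) 2.
have sE : supp K = [:: i; j; l].
  by rewrite /i /j /l; case: (supp K) size3 => [|? [|? [|? []]]].
have lt (n : nat) : n \in supp K -> (n < 10)%N.
  by rewrite mem_supp => /andP[/leq_trans + _]; apply.
have i10 : (i < 10)%N by apply: lt; rewrite sE !inE eqxx.
have j10 : (j < 10)%N by apply: lt; rewrite sE !inE eqxx orbT.
have l10 : (l < 10)%N by apply: lt; rewrite sE !inE eqxx !orbT.
pose oi := Ordinal i10; pose oj := Ordinal j10; pose ol := Ordinal l10.
have KE (n : 'I_10) : (knots_of K n != 0%N) = (n \in [:: oi; oj; ol]).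
  have -> : (n \in [:: oi; oj; ol]) = (nat_of_ord n \in [:: i; j; l]).
    by rewrite !inE -!val_eqE.
  rewrite -sE mem_supp; apply/idP/andP => [h|[]//].
  by rewrite (knots_of_lt6 sK h).
have zd0 : det3 (vtx oi) (vtx oj) (vtx ol) != 0.
  by rewrite det_vtx mulf_neq0 ?invr_neq0 ?expf_neq0 // toR_eq0.
have nij : oi != oj.
  by apply: contraNneq zd0 => /(congr1 val)/= ->; apply/eqP; rewrite /det3; ring.
have nil : oi != ol.
  by apply: contraNneq zd0 => /(congr1 val)/= ->; apply/eqP; rewrite /det3; ring.
have njl : oj != ol.
  by apply: contraNneq zd0 => /(congr1 val)/= ->; apply/eqP; rewrite /det3; ring.
have [Ki Kj Kl] : [/\ knots_of K oi != 0%N, knots_of K oj != 0%N &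
    knots_of K ol != 0%N] by rewrite !KE !inE !eqxx !orbT.
have hullE : knots_hull t (knots_of K) =
    conv_hull [:: pt (vtx oi); pt (vtx oj); pt (vtx ol)].
  apply/seteqP; split; last exact: sub_knots_hull.
  move=> p /knots_hullP[b [b0 b1 -> bK]]; apply/conv_hull3.
  have bE : b = base oi oj ol (b oi) (b oj) (b ol).
    apply/funext => n; rewrite /base.
    have [->|ni] := eqVneq n oi.
      by rewrite (negbTE nij) (negbTE nil) !mulr0 !addr0 mulr1.
    have [->|nj] := eqVneq n oj.
      by rewrite (negbTE njl) !mulr0 addr0 add0r mulr1.
    have [->|nl] := eqVneq n ol; first by rewrite !mulr0 !add0r mulr1.
    rewrite !mulr0 !addr0; apply: bK; apply/eqP; rewrite -[_ == _]negbK KE !inE.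
    by rewrite (negbTE ni) (negbTE nj) (negbTE nl).
  exists (b oi), (b oj), (b ol); split=> //.
    by rewrite -b1 bE sum_base -bE.
  by rewrite {1}bE (sum_base_scale (vert t)) !vertE.
have [wi wj wl] : [/\ weight (vtx oi) = 1, weight (vtx oj) = 1 & weight (vtx ol) = 1].
  by split; exact: weight_vtx.
rewrite hullE (area_ratio nd) // {1}indicE.
have /bk : nat_of_ord k \in iota 0 12 by rewrite mem_iota leq0n add0n ltn_ord.
have -> : evalK 0 K k x = toR (net 0 K k 0%N 0%N) by [].
rewrite -/i -/j -/l.
have [w [w0 w1 e]] := piece_comb nd Pk.
have formX s : form (vtx oi) (vtx oj) (vtx ol) s (coords x) =
    12 ^- 6 * (w 0%N * toR (zform i j l s (pc k 0)) +
    w 1%N * toR (zform i j l s (pc k 1)) + w 2%N * toR (zform i j l s (pc k 2))).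
  by rewrite e form_comb !formE; ring.
have c0 : 0 < (12 : R) ^- 6 by rewrite invr_gt0 exprn_gt0.
case: (boolP (inside i j l k)) => [/allP ins /Z.eqb_spec aE|_ /andP[/Z.eqb_spec -> /hasP[s]]].
  rewrite mem_set ?mul1r.
    rewrite det_vtx normrM ger0_norm ?invr_ge0 ?exprn_ge0 //.
    have -> : `|toR (zdet (zv oi) (zv oj) (zv ol))| =
        toR (Z.abs (zdet (zv i) (zv j) (zv l))) :> R.
      rewrite -/i -/j -/l; case: (zdet _ _ _) => [|z|z] /=.
      - by rewrite toR0 normr0.
      - by rewrite ger0_norm // toR_ge0.
      - by rewrite ler0_norm ?toR_le0 // -toRN.
    have h := congr1 (@toR R) aE; rewrite toRM in h.
    set z := toR (Z.abs _) in h *.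
    have z0 : z != 0 by apply/eqP => z0; move: h; rewrite z0 mulr0 => /esym/eqP; rewrite toR_eq0.
    rewrite -[RHS](mulfK z0) h invfM invrK (_ : toR 1728 = 12 ^+ 3) //.
    by rewrite -natrX.
  apply/hull_form => // s s3; rewrite formX mulr_ge0 ?(ltW c0) //.
  have /ins/allP ps : s \in iota 0 3 by rewrite mem_iota.
  by do 2 ?apply: addr_ge0; apply: mulr_ge0 => //; apply: toR_ge0; exact: ps.
rewrite mem_iota add0n => s3 /allP neg; rewrite toR0 memNset ?mul0r //.
move=> /(hull_form nd _ wi wj wl zd0)/(_ s s3).
have : form (vtx oi) (vtx oj) (vtx ol) s (coords x) <= 0.
  rewrite formX mulr_ge0_le0 ?(ltW c0) //.
  have np r : (r < 3)%N -> w r * toR (zform i j l s (pc k r)) <= 0.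
    move=> r3; apply: mulr_ge0_le0 => //; apply: toR_le0; apply: neg.
    by rewrite mem_iota.
  by have := np 0%N isT; have := np 1%N isT; have := np 2%N isT; lra.
rewrite le_eqVlt => /orP[/eqP|]; last by rewrite ltNge => /negP.
have gd := (genericP nd x).1 gx.
move/eqP; rewrite /form mulf_eq0 (negbTE zd0) orbF => /eqP d0 _.
case: s s3 d0 {neg} => [|[|[|//]]] _ /= d0.
- by have := gd _ _ njl; rewrite d0 eqxx.
- have := gd _ _ nil; apply/negP; rewrite negbK -oppr_eq0 -d0.
  by apply/eqP; rewrite /det3; ring.
- have := gd _ _ nij; apply/negP; rewrite negbK -d0.
  by apply/eqP; rewrite /det3; ring.
Qed.

(** The coefficients of the recursion enter only through sum_j b_j v_j = x, as
the summand of index j is b_j times the value at x of step v_j applied to the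
net of K. *)
Lemma Qrec_net d K (k : 'I_12) x : (d < 6)%N -> size K = 6%N -> known d K ->
  piece k x -> generic t x -> Qrec t d (knots_of K) x = evalK d K k x.
Proof.
elim: d K => [|d IH] K d6 sK kK Pk gx.
  have [nE|[_ nc bk]] := table_entry K d6.
    move: kK; rewrite /known nE orbF => col.
    by rewrite /= (collinear_area sK col) eqxx evalK_nil.
  have [i [j [l [Ki Kj Kl d0]]]] := noncollinear_basis sK nc.
  rewrite /= (negbTE (area_knots_neq0 nd Ki Kj Kl d0)).
  exact: base_value.
have [nE|[_ nc sk]] := table_entry K d6.
  move: kK; rewrite /known nE orbF => col.
  by rewrite /= (collinear_area sK col) eqxx evalK_nil.
have [i [j [l [Ki Kj Kl d0]]]] := noncollinear_basis sK nc.
rewrite [LHS]/= (negbTE (area_knots_neq0 nd Ki Kj Kl d0)).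
have bs : bary_spec t (knots_of K) x (bary t (knots_of K) x).
  have [b hb] := bary_spec_exists nd Ki Kj Kl d0 x.
  exact: (xgetPex _ (ex_intro _ b hb)).
move: (bary t (knots_of K) x) bs => b bs.
rewrite /evalK eval_S (@eval_sum d _ _ b (fun n => step (vtx n) (rnet (net d.+1 K k)))); last first.
  exact: (step_coords _ bs).
apply: eq_bigr => n _.
have [K0|Kn] := eqVneq (knots_of K n) 0%N.
  by case: bs => _ _ /(_ n K0) ->; rewrite !mul0r.
congr (_ * _).
move: sk => /allP/(_ n); rewrite mem_iota add0n (knots_of_lt6 sK Kn) => /(_ isT).
case/orP => [/eqP K0|/andP[kn /allP/(_ k)]]; first by rewrite /knots_of K0 in Kn.
rewrite mem_iota add0n ltn_ord => /(_ isT)/zagreeP ag.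
rewrite knots_remove_of // IH ?size_mkseq ?(ltnW d6) //.
apply: eval_agree => p q pq.
have := ag R p q pq; rewrite rnet_step {1}/rnet toRM toR12E => h.
rewrite vtxE step_scalel /net_scale -[RHS]/(12^-1 * step _ _ p q).
by rewrite -h mulKf.
Qed.

End Recursion.

(** * A homogeneous linear system over the integers *)

(** A row stands for its extension by zeros, so rows of different lengths may be
combined. *)
Fixpoint eliminate (a b : Z) (r p : seq Z) : seq Z :=
  match r, p with
  | [::], _ => map (fun y => - (b * y))%BZ p
  | _, [::] => map (fun x => a * x)%BZ r
  | x :: r', y :: p' => (a * x - b * y)%BZ :: eliminate a b r' p'
  end.

Fixpoint content (g : Z) (r : seq Z) : Z :=
  if (g =? 1)%BZ then g else if r is x :: r' then content (Z.gcd g x) r' else g.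

(** Division by the greatest common divisor of the entries keeps the numbers
small during elimination; comparing after multiplication spares a proof that the
division is exact. *)
Definition primitive_row (r : seq Z) : seq Z :=
  let g := content 0 r in
  if (g <=? 1)%BZ then r else
  let r' := map (fun x => x / g)%BZ r in
  if all2 Z.eqb (map (Z.mul g) r') r then r' else r.

Definition head0 (r : seq Z) : bool := (head 0%BZ r =? 0)%BZ.

(** Gaussian elimination, one column at a time: the first row with a nonzero
head eliminates the head of the others, and all rows lose their first entry. *)
Fixpoint full_rank (n : nat) (rows : seq (seq Z)) : bool :=
  if n is n'.+1 then
    if [seq r <- rows | ~~ head0 r] is p :: hs then
      full_rank n' ([seq behead r | r <- rows & head0 r] ++
        [seq primitive_row (eliminate (head 0%BZ p) (head 0%BZ r) (behead r) (behead p))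
           | r <- hs])
    else false
  else true.

Section Elimination.
Context {R : realType}.
Implicit Types (x : nat -> R) (r p : seq Z).

Fixpoint dot r x : R := if r is a :: r' then toR a * x 0%N + dot r' (x \o S) else 0.

Lemma dot_scale (a : Z) r x : dot (map (Z.mul a) r) x = toR a * dot r x.
Proof. by elim: r x => [|b r IH] x /=; rewrite ?mulr0 // IH toRM; ring. Qed.

Lemma dot_eliminate a b r p x : dot (eliminate a b r p) x = toR a * dot r x - toR b * dot p x.
Proof.
elim: r p x => [|y r IH] p x.
  rewrite /= mulr0 add0r; elim: p x => [|z p IH] x /=.
    by rewrite mulr0 oppr0.
  by rewrite IH toRN toRM; ring.
case: p => [|z p] /=; last by rewrite IH toRB !toRM; ring.
rewrite mulr0 subr0 toRM mulrDr mulrA; congr (_ + _).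
exact: dot_scale.
Qed.

Lemma all2_Zeqb r p : all2 Z.eqb r p -> r = p.
Proof.
by elim: r p => [|a r IH] [|b p] //= /andP[/Z.eqb_spec -> /IH ->].
Qed.

Lemma dot_primitive_row r x : dot r x = 0 -> dot (primitive_row r) x = 0.
Proof.
rewrite /primitive_row; set g := content 0 r; case: ifP => // g1.
set r' := map _ r; case: ifP => // /all2_Zeqb rE.
rewrite -{1}rE dot_scale => /eqP; rewrite mulf_eq0 toR_eq0 => /orP[g0|/eqP //].
by move: g1; move/Z.eqb_spec: g0 => ->.
Qed.

Lemma dot_behead r x :
  dot r x = toR (head 0%BZ r) * x 0%N + dot (behead r) (x \o S).
Proof. by case: r => [|a r] //=; rewrite mul0r addr0. Qed.

(** The tails of the remaining rows annihilate the tail of x, which vanishes by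
induction; then the pivot row gives x 0 = 0. *)
Lemma full_rankP n rows x : full_rank n rows ->
  (forall r, r \in rows -> dot r x = 0) ->
  (forall i, (n <= i)%N -> x i = 0) -> forall i, x i = 0.
Proof.
elim: n rows x => [|n IH] rows x /=; first by move=> _ _ x0 i; exact: x0.
case E : [seq r <- rows | ~~ head0 r] => [//|p hs] fr rows0 xn.
have mem r : r \in p :: hs -> r \in rows /\ ~~ head0 r.
  by rewrite -E mem_filter => /andP[].
have [pr ph] := mem p (mem_head _ _).
have p0 := rows0 p pr; rewrite dot_behead in p0.
have tail i : (x \o S) i = 0.
  apply: (IH _ (x \o S) fr) => {i} [r|i ni]; last exact: xn.
  rewrite mem_cat => /orP[/mapP[r' + ->]|/mapP[r' r'h ->]].
    rewrite mem_filter => /andP[/Z.eqb_spec h /rows0].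
    by rewrite dot_behead h toR0 mul0r add0r.
  apply: dot_primitive_row; rewrite dot_eliminate.
  have [/rows0 + _] : r' \in rows /\ ~~ head0 r' by apply: mem; rewrite inE r'h orbT.
  rewrite dot_behead => r0.
  have e1 : dot (behead r') (x \o S) = - (toR (head 0%BZ r') * x 0%N) by lra.
  have e2 : dot (behead p) (x \o S) = - (toR (head 0%BZ p) * x 0%N) by lra.
  by rewrite e1 e2; ring.
move=> [|i]; last exact: tail.
have dot0 (r : seq Z) y : (forall i, y i = 0) -> dot r y = 0.
  elim: r y => //= a r IHr y y0; rewrite y0 mulr0 add0r.
  by apply: IHr => i; exact: y0.
move: p0; rewrite dot0 // addr0 => /eqP; rewrite mulf_eq0 toR_eq0.
by move: ph; rewrite /head0 => /negbTE -> /eqP.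
Qed.
End Elimination.

(** Linear forms in the unknowns, as lists of indices with coefficients; nets of
linear forms make the smoothness conditions symbolic. *)
Definition lform := seq (nat * Z).
Definition lscale (a : Z) (l : lform) : lform :=
  if (a =? 0)%BZ then [::] else [seq (e.1, (a * e.2)%BZ) | e <- l].
Definition lstep (w : Z * Z * Z) (c : nat -> nat -> lform) : nat -> nat -> lform :=
  fun i j => lscale w.1.1 (c i.+1 j) ++ lscale w.1.2 (c i j.+1) ++ lscale w.2 (c i j).

Fixpoint add_at (n : nat) (z : Z) (r : seq Z) : seq Z :=
  match n, r with
  | 0%N, [::] => [:: z]
  | 0%N, a :: r' => (a + z)%BZ :: r'
  | n'.+1, [::] => 0%BZ :: add_at n' z [::]
  | n'.+1, a :: r' => a :: add_at n' z r'
  end.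
Definition to_row (l : lform) : seq Z :=
  primitive_row (foldr (fun e r => add_at e.1 e.2 r) [::] l).

Definition exponents : seq (nat * nat) :=
  [seq (i, j) | i <- iota 0 6, j <- iota 0 (6 - i)].
(** The 21 coefficients of each of the twelve nets are numbered consecutively. *)
Definition unknown (k : nat) (i j : nat) : lform :=
  if (i + j <= 5)%N then [:: (k * 21 + index (i, j) exponents, 1%BZ)]%N else [::].

(** Two steps at points of an edge expand into steps at pairs of its end points, so
these pairs give all the conditions across the edge. *)
Definition edge_rows : seq lform := flatten
  [seq flatten [seq
    let f := nth [::] (nth [::] common_faces k) l in
    if f is [:: r; s] then
      let A := zv (pc k r) in let B := zv (pc k s) in
      flatten [seq let ck := lstep w.2 (lstep w.1 (unknown k)) in
        let cl := lstep w.2 (lstep w.1 (unknown l)) in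
        flatten [seq [seq ck i j ++ lscale (-1) (cl i j) | j <- iota 0 (4 - i)]
          | i <- iota 0 4]
        | w <- [:: (A, A); (A, B); (B, B)]]
    else [::]
    | l <- iota 0 k] | k <- iota 0 12].

(** Rotation of the vertices carries the functionals of one corner to those of the
next. *)
Definition zcomb (a b c : Z) (m : nat) : Z * Z * Z :=
  match m with 0%N => (a, b, c) | 1%N => (c, a, b) | _ => (b, c, a) end.

Definition orders : seq (nat * nat) :=
  [seq (i, j) | i <- iota 0 4, j <- iota 0 (4 - i)].

(** For the functional n at the vertex or edge of index m: a piece that contains
its point, its directions multiplied by 2, and its point multiplied by 4.  The
functionals n < 10 are the derivatives at a vertex; 10, 11 and 12 are those on
the edge that starts there. *)
Definition hermite_data (m n : nat) : nat * seq (Z * Z * Z) * (Z * Z * Z) :=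
  let u := zcomb (-1) (-1) 2 m in
  if (n < 10)%N then let ij := nth (0, 0)%N orders n in
    (nth 0 [:: 0; 2; 4] m,
     nseq ij.1 (zcomb (-2) 2 0 m) ++ nseq ij.2 (zcomb (-2) 0 2 m), zcomb 4 0 0 m)%N
  else if n == 10%N then (nth 0 [:: 0; 3; 5] m, [:: u; u], zcomb 3 1 0 m)%N
  else if n == 11%N then (nth 0 [:: 0; 3; 5] m, [:: u], zcomb 2 2 0 m)%N
  else (nth 0 [:: 2; 4; 1] m, [:: u; u], zcomb 1 3 0 m)%N.

Definition polar_points (us : seq (Z * Z * Z)) (P : Z * Z * Z) :=
  us ++ nseq (5 - size us) P.

Definition hermite_rows : seq lform :=
  flatten [seq [seq let: (k, us, P) := hermite_data m n in
    foldr lstep (unknown k) (polar_points us P) 0%N 0%N | n <- iota 0 13] | m <- iota 0 3].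

Definition all_rows : seq (seq Z) := map to_row (edge_rows ++ hermite_rows).

Lemma all_rows_full_rank : full_rank 252 all_rows.
Proof. by vm_compute. Qed.

(** * Unisolvence of the Hermite functionals *)

Section Unisolvence.
Context {R : realType}.
Variables v1 v2 v3 : R * R.
Hypothesis nd : nondegenerate_triangle (Triangle v1 v2 v3).
Local Notation coords := (coords v1 v2 v3).
Local Notation dcoords := (dcoords v1 v2 v3).
Local Notation pt := (pt v1 v2 v3).
Local Notation piece := (piece v1 v2 v3).
Local Notation vtx := (@vtx R).
Implicit Types (x : nat -> R).

Definition lval x (l : lform) : R := \sum_(e <- l) toR e.2 * x e.1.
Definition lnet x (s : nat -> nat -> lform) : nat -> nat -> R :=
  fun i j => lval x (s i j).

Lemma lval_cat x l l' : lval x (l ++ l') = lval x l + lval x l'.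
Proof. by rewrite /lval big_cat. Qed.

Lemma lval_scale x a l : lval x (lscale a l) = toR a * lval x l.
Proof.
rewrite /lscale; case: ifP => [/Z.eqb_spec ->|_].
  by rewrite toR0 mul0r /lval big_nil.
rewrite /lval big_map mulr_sumr; apply: eq_bigr => e _ /=.
by rewrite toRM mulrA.
Qed.

Lemma lnet_step x w s : lnet x (lstep w s) = step (toR3 w) (lnet x s).
Proof.
by apply/netP => i j; rewrite /lnet /lstep !lval_cat !lval_scale /step /= addrA.
Qed.

Lemma dot_add_at n z r x : dot (add_at n z r) x = toR z * x n + dot r x.
Proof.
elim: n r x => [|n IH] [|a r] x /=; rewrite ?toRD ?IH ?toR0 /=; try ring.
Qed.

Lemma dot_to_row x l : lval x l = 0 -> dot (to_row l) x = 0.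
Proof.
move=> l0; apply: dot_primitive_row; rewrite -l0 {l0} /lval.
elim: l => [|e l IH]; first by rewrite big_nil.
by rewrite big_cons /= dot_add_at IH.
Qed.

Lemma common_vertex k l r : (k < 12)%N -> (l < k)%N -> r \in common_face k l ->
  exists2 s, (s < 3)%N & pc k r = pc l s.
Proof.
move=> k12 lk rf.
have r3 : (r < 3)%N by move: rf; rewrite mem_filter mem_iota => /andP[].
pose f k l := (l < k)%N ==> all (fun r => has (fun s => pc k r == pc l s) (iota 0 3))
  (nth [::] (nth [::] common_faces k) l).
have := @all_iota2P 12 12 f isT k l k12 (ltn_trans lk k12).
rewrite /f lk common_facesE // => /allP/(_ r rf)/hasP[s].
by rewrite mem_iota => s3 /eqP; exists s.
Qed.

Lemma vertex_piece (k : 'I_12) s : (s < 3)%N -> piece k (pt (vtx (pc k s))).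
Proof.
have Z : forall a, pt 0 + a = a by move=> a; rewrite /pt !scale0r !add0r.
move=> s3; apply/conv_hull3.
exists (s == 0%N)%:R, (s == 1%N)%:R, (s == 2%N)%:R.
rewrite !ler0n; case: s s3 => [|[|[|//]]] _ /=; split => //;
  rewrite ?scale1r ?scale0r ?addr0 ?add0r //.
Qed.

Lemma midpoint_piece (k : 'I_12) (A B : R * R * R) : weight A = 1 -> weight B = 1 ->
  piece k (pt A) -> piece k (pt B) -> piece k (pt (2^-1 *: A + 2^-1 *: B)).
Proof.
move=> wA wB /(piece_form nd) fA /(piece_form nd) fB.
apply/(piece_form nd) => s s3; rewrite coords_pt //; last first.
  by move: wA wB; rewrite /weight /= /GRing.scale /=; lra.
rewrite -[X in form _ _ _ _ X]addr0 -[X in _ + X](scale0r A) form_comb.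
have := fA s s3; have := fB s s3; rewrite !coords_pt //; lra.
Qed.

Lemma weight_pc k r : weight (vtx (pc k r)) = 1. Proof. by rewrite weight_vtx ?pc_lt. Qed.

Section System.
Variable c : nat -> nat -> nat -> R.
Hypothesis cc : compat v1 v2 v3 piece 2 3 (fun k : 'I_12 => c k).

(** Polarization: the condition at the midpoint of an edge gives, together with
those at the end points, the mixed condition. *)
Lemma compat_edge (k l : 'I_12) (A B : R * R * R) : weight A = 1 -> weight B = 1 ->
  piece k (pt A) -> piece k (pt B) -> piece l (pt A) -> piece l (pt B) ->
  agree 3 (step A (step A (c k))) (step A (step A (c l))) /\
  agree 3 (step B (step A (c k))) (step B (step A (c l))).
Proof.
move=> wA wB kA kB lA lB; set M := 2^-1 *: A + 2^-1 *: B.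
have wM : weight M = 1 by move: wA wB; rewrite /M /weight /= /GRing.scale /=; lra.
have H C : weight C = 1 -> piece k (pt C) -> piece l (pt C) ->
    agree 3 (step C (step C (c k))) (step C (step C (c l))).
  by move=> wC kC lC; have := cc kC lC; rewrite coords_pt.
have hA := H A wA kA lA; have hB := H B wB kB lB.
have hM := H M wM (midpoint_piece wA wB kA kB) (midpoint_piece wA wB lA lB).
split=> // i j ij.
have E e : step B (step A e) i j = 2 * step M (step M e) i j -
    2^-1 * step A (step A e) i j - 2^-1 * step B (step B e) i j.
  by rewrite /step /M /= /GRing.scale /=; field.
by rewrite !E hA // hB // hM.
Qed.

(** The unknowns; the default 0 beyond the last one matters, as rows may be
longer than the number of unknowns. *)
Definition values : nat -> R := fun n =>
  if (n < 252)%N then let e := nth (0, 0)%N exponents (n %% 21) in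
    c (n %/ 21) e.1 e.2 else 0.

Lemma mem_exponents i j : (i + j <= 5)%N -> (i, j) \in exponents.
Proof.
move=> ij; have i5 : (i < 6)%N by rewrite ltnS (leq_trans _ ij) ?leq_addr.
have j5 : (j < 6)%N by rewrite ltnS (leq_trans _ ij) ?leq_addl.
have := @all_iota2P 6 6 (fun i j => (i + j <= 5)%N ==> ((i, j) \in exponents)) isT i j i5 j5.
by rewrite ij.
Qed.

(** The position of an entry in the enumeration is recovered from the index
modulo 21. *)
Lemma lnet_unknown (k : 'I_12) : agree 5 (lnet values (unknown k)) (c k).
Proof.
move=> i j ij; rewrite /lnet /unknown ij /lval big_seq1 /= mul1r /values.
have i21 : (index (i, j) exponents < 21)%N.
  by rewrite -[21%N]/(size exponents) index_mem mem_exponents.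
rewrite ifT; last first.
  rewrite (@leq_trans (k * 21 + 21)) ?ltn_add2l // -mulSnr.
  by rewrite (@leq_mul _ _ 12 21) // ltn_ord.
rewrite modnMDl modn_small // divnMDl // divn_small // addn0.
by rewrite nth_index ?mem_exponents.
Qed.

Lemma edge_rows0 l : l \in edge_rows -> lval values l = 0.
Proof.
move=> /flattenP[s /mapP[k + ->]]; rewrite mem_iota leq0n add0n => k12.
move=> /flattenP[s' /mapP[l' + ->]]; rewrite mem_iota leq0n add0n => lk.
rewrite common_facesE //; case E : common_face => [|r [|r' []]] //.
have rf : r \in common_face k l' by rewrite E mem_head.
have rf' : r' \in common_face k l' by rewrite E !inE eqxx orbT.
have r3 : (r < 3)%N by move: rf; rewrite mem_filter mem_iota => /andP[].
have r3' : (r' < 3)%N by move: rf'; rewrite mem_filter mem_iota => /andP[].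
have [a a3 ra] := common_vertex k12 lk rf.
have [b b3 rb] := common_vertex k12 lk rf'.
pose ok := Ordinal k12; pose ol := Ordinal (ltn_trans lk k12).
have kA := vertex_piece ok r3; have kB := vertex_piece ok r3'.
have lA := vertex_piece ol a3; have lB := vertex_piece ol b3.
rewrite /= -ra in lA; rewrite /= -rb in lB.
have [AA AB] := compat_edge (weight_pc k r) (weight_pc k r') kA kB lA lB.
have [BB _] := compat_edge (weight_pc k r') (weight_pc k r) kB kA lB lA.
move=> /flattenP[s'' /mapP[w wm ->]].
move=> /flattenP[s3 /mapP[i + ->]]; rewrite mem_iota leq0n add0n => i4.
move=> /mapP[j + ->]; rewrite mem_iota leq0n add0n => j4.
have ij : (i + j <= 3)%N by move: j4; rewrite ltn_subRL.
rewrite lval_cat lval_scale -!/(lnet values _ _ _) !lnet_step.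
have T k' : agree 3 (step (toR3 w.2) (step (toR3 w.1) (lnet values (unknown (k' : 'I_12)))))
    (step (toR3 w.2) (step (toR3 w.1) (c k'))).
  by do 2 apply: agree_step; exact: lnet_unknown.
rewrite (T ok i j ij) (T ol i j ij).
suff -> : step (toR3 w.2) (step (toR3 w.1) (c ok)) i j =
  step (toR3 w.2) (step (toR3 w.1) (c ol)) i j.
  by rewrite /toR /=; ring.
have U a' b' e e' :
    step (vtx a') (step (vtx b') e) i j = step (vtx a') (step (vtx b') e') i j ->
    step (toR3 (zv a')) (step (toR3 (zv b')) e) i j =
    step (toR3 (zv a')) (step (toR3 (zv b')) e') i j.
  rewrite !vtxE !step_scalel !step_scale /net_scale => h.
  have n0 : (12 : R)^-1 != 0 by rewrite invr_neq0.
  exact: (mulfI n0 (mulfI n0 h)).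
move: wm; rewrite !inE => /or3P[] /eqP -> /=; apply: U.
- exact: AA.
- exact: AB.
- exact: BB.
Qed.

Hypothesis hermite0 : forall m n, (m < 3)%N -> (n < 13)%N ->
  let: (k, us, P) := hermite_data m n in
  polar (map toR3 (polar_points us P)) (c k) = 0.

Lemma hermite_rows0 l : l \in hermite_rows -> lval values l = 0.
Proof.
move=> /flattenP[s /mapP[m + ->]]; rewrite mem_iota leq0n add0n => m3.
move=> /mapP[n + ->]; rewrite mem_iota leq0n add0n => n13.
have := hermite0 m3 n13.
have k12 : (((hermite_data m n).1).1 < 12)%N.
  exact: (@all_iota2P 3 13 (fun m n => ((hermite_data m n).1).1 < 12)%N isT).
have s5 : (size (hermite_data m n).1.2 <= 5)%N.
  exact: (@all_iota2P 3 13 (fun m n => (size (hermite_data m n).1.2 <= 5)%N) isT).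
case: (hermite_data m n) k12 s5 => [[k us] P] /= k12 s5 <-.
have sz : size (polar_points us P) = 5%N.
  by rewrite size_cat size_nseq subnKC.
rewrite -/(lnet values _ _ _).
have E (pts : seq (Z * Z * Z)) d : agree (d + size pts)
    (lnet values (unknown k)) (c k) ->
    agree d (lnet values (foldr lstep (unknown k) pts))
      (foldr step (c k) (map toR3 pts)).
  elim: pts d => [|p pts IH] d /=; first by rewrite addn0.
  by rewrite addnS -addSn => /IH; rewrite lnet_step; exact: agree_step.
apply: (E _ 0%N) => //; rewrite sz.
exact: (@lnet_unknown (Ordinal k12)).
Qed.

(** All coefficients satisfy a system of full rank. *)
Lemma unisolvent (k : 'I_12) i j : (i + j <= 5)%N -> c k i j = 0.
Proof.
have rows0 r : r \in all_rows -> dot r values = 0.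
  rewrite /all_rows => /mapP[l lr ->]; apply: dot_to_row.
  by move: lr; rewrite mem_cat => /orP[/edge_rows0|/hermite_rows0].
have big n : (252 <= n)%N -> values n = 0.
  by move=> n252; rewrite /values ltnNge n252.
have v0 := full_rankP all_rows_full_rank rows0 big.
move=> ij; rewrite -(@lnet_unknown k i j ij) /lnet /lval.
by apply: big1 => e _; rewrite v0 mulr0.
Qed.
End System.
End Unisolvence.

(** * Hermite functionals and dual splines *)

Section Final.
Context {R : realType}.
Variables v1 v2 v3 : R * R.
Hypothesis nd : nondegenerate_triangle (Triangle v1 v2 v3).
Let t := Triangle v1 v2 v3.
Local Notation coords := (coords v1 v2 v3).
Local Notation dcoords := (dcoords v1 v2 v3).
Local Notation pt := (pt v1 v2 v3).
Local Notation piece := (piece v1 v2 v3).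
Local Notation open_piece := (open_piece v1 v2 v3).
Local Notation vtx := (@vtx R).
Local Notation piecewise := (piecewise v1 v2 v3 piece).
Local Notation compat := (compat v1 v2 v3 piece).

Let pcl := piece_closed nd.
Let pop := @open_piece_open R v1 v2 v3.
Let psub := open_piece_sub nd.
Let pcls := piece_closure nd.
Let preg := region_pieces nd.

Lemma max_knots_ok K : K \in max_knots ->
  [/\ size K = 6%N, knots_card (knots_of K) = 8%N & known 5 K].
Proof.
move=> Km; have /andP[/andP[/eqP sK kK] _] := allP smooth_okP K Km; split=> //.
have -> : knots_card (knots_of K) = foldr addn 0%N (mkseq (multiplicity K) 10).
  by rewrite /knots_card /knots_of !big_ord_recl big_ord0.
have /allP/(_ K Km)/eqP // : all (fun K =>
  foldr addn 0%N (mkseq (multiplicity K) 10) == 8%N) max_knots by [].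
Qed.

(** Generic points are dense in T and there the spline is given by the forms of
the table, which agree on common points of the pieces. *)
Lemma Qext_piecewise K : K \in max_knots ->
  piecewise 5 (fun k => rnet (net 5 K k)) (Qext t (knots_of K)).
Proof.
move=> Km k p Pk; have [sK cK kK] := max_knots_ok Km.
have cc : compat 2 3 (fun k => rnet (net 5 K k)).
  by apply: zcompatP => //; have /andP[] := allP smooth_okP K Km.
have rp : region t p by apply/preg; exists k.
have pr := within_nbhs_proper (generic_dense nd rp).
apply: cvg_lim => //.
apply: (@cvg_paste R 'I_12 _ _ _ _
   (fun l q => eval 5 (rnet (net 5 K l)) (coords q)) (fun l => piece l p)).
  near=> q.
  have [rq gq] : (region t `&` generic t) q by near: q; exact: withinT.
  have [l Pl] := (preg q).1 rq.
  exists l.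
    suff : forall l, piece l q -> piece l p by apply.
    by near: q; apply: cvg_within; exact: near_pieces.
  by rewrite /Qgen cK (Qrec_net nd _ sK kK Pl gq).
move=> l Pl; rewrite (compat_eval cc Pk Pl).
apply: cvg_trans; first by apply: cvg_app; exact: cvg_within.
exact: eval_continuous.
Unshelve. all: by end_near. Qed.

(** Choosing nets on the pieces turns membership in the spline space into a
condition on nets. *)
Lemma S35P s : S35 t s <-> exists c : nat -> nat -> nat -> R,
  piecewise 5 (fun k => c k) s /\ compat 2 3 (fun k => c k).
Proof.
split=> [[Cs ps]|[c [pc cc]]].
  have H (k : 'I_12) : exists c, forall p, piece k p -> s p = eval 5 c (coords p).
    have [a pa] := ps k (ltn_ord k); rewrite split12E in pa.
    have [c e] := bipoly_is_net nd 5 a.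
    by exists c => p Pk; rewrite pa // -e.
  have [c ec] := choice H.
  exists (fun n => c (inord n)).
  have pc : piecewise 5 (fun k : 'I_12 => c (inord k)) s.
    by move=> k p Pk; rewrite inord_val; exact: ec.
  split=> //; exact: (Cn_compat nd pop psub pcls preg (n := 2) (r := 3) Cs pc).
split; first exact: (piecewise_Cn pcl pop psub pcls preg (n := 2) (r := 3) cc pc).
move=> k k12; have [a ea] := eval_is_bipoly v1 v2 v3 5 (c k).
exists a => p; rewrite -[k]/(nat_of_ord (Ordinal k12)) split12E => Pk.
by rewrite (pc _ _ Pk) ea.
Qed.

Definition dir_of (U : Z * Z * Z) : R * R := pt (2^-1 *: toR3 U).
Definition point_of (P : Z * Z * Z) : R * R := pt (4^-1 *: toR3 P).

Definition hermite (m n : nat) (f : R * R -> R) : R :=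
  let: (k, us, P) := hermite_data m n in
  foldr (dirD (region t)) f (map dir_of us) (point_of P).

Definition zwt (P : Z * Z * Z) : Z := (P.1.1 + P.1.2 + P.2)%BZ.

(** The analogue of [zform] for a point that need not be a vertex. *)
Definition zformP (a b c : nat) (s : nat) (P : Z * Z * Z) : Z :=
  let m := subst3 s P (zv a) (zv b) (zv c) in
  (zdet m.1.1 m.1.2 m.2 * zdet (zv a) (zv b) (zv c))%BZ.

Lemma formPE a b c s P : form (vtx a) (vtx b) (vtx c) s (4^-1 *: toR3 P) =
  4^-1 * 12 ^- 5 * toR (zformP a b c s P).
Proof.
rewrite /form /zformP toRM det_vtx.
set d := toR (zdet (zv a) (zv b) (zv c)).
by case: s => [|[|s]] /=; rewrite toR_det /det3 /vtx /= /GRing.scale /=; field.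
Qed.

Definition hermite_data_wf : bool := all (fun m => all (fun n =>
  let: (k, us, P) := hermite_data m n in
  [&& (k < 12)%N, (size us <= 3)%N, all (fun U => zwt U =? 0)%BZ us, (zwt P =? 4)%BZ &
   all (fun s => (0 <=? zformP (pc k 0) (pc k 1) (pc k 2) s P)%BZ) (iota 0 3)])
   (iota 0 13)) (iota 0 3).

Lemma hermite_data_wfP : hermite_data_wf. Proof. by vm_compute. Qed.

Lemma toR_wt P : weight (toR3 P) = toR (zwt P) :> R.
Proof. by rewrite /weight /zwt !toRD. Qed.

Lemma foldr_step_scale (a : R) (us : seq (Z * Z * Z)) c :
  foldr step c (map (fun U => a *: toR3 U) us) =
  net_scale (a ^+ size us) (foldr step c (map toR3 us)).
Proof.
elim: us => [|U us IH] /=.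
  by apply/netP => i j; rewrite /net_scale mul1r.
rewrite IH step_scalel step_scale; apply/netP => i j.
by rewrite /net_scale exprS mulrA.
Qed.

Lemma eval_foldr d (us : seq (R * R * R)) X c :
  eval d (foldr step c us) X = polar (us ++ nseq d X) c.
Proof.
rewrite /polar foldr_cat /eval foldr_nseq.
congr (_ 0%N 0%N); elim: us => //= U us IH.
by rewrite -IH step_iterC.
Qed.

Definition hermite_value (c : nat -> nat -> nat -> R) (m n : nat) : R :=
  let: (k, us, P) := hermite_data m n in
  (5 ^_ (size us))%:R * (2^-1 ^+ size us * 4^-1 ^+ (5 - size us)) *
  polar (map toR3 (polar_points us P)) (c k).

(** Derivatives become arguments of the polar form; the denominators 2 and 4 of
directions and point come out by multilinearity. *)
Lemma hermite_valueE (c : nat -> nat -> nat -> R) s m n : (m < 3)%N -> (n < 13)%N ->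
  piecewise 5 (fun k => c k) s -> compat 2 3 (fun k => c k) ->
  hermite m n s = hermite_value c m n.
Proof.
move=> m3 n13 ps cc; have := hermite_data_wfP => /all_iota2P/(_ m n m3 n13).
rewrite /hermite /hermite_value; case: (hermite_data m n) => [[k us] P].
move=> /and5P[k12 us3 us0 wP /allP fP].
have cP : coords (point_of P) = 4^-1 *: toR3 P.
  rewrite coords_pt // (_ : weight _ = 4^-1 * weight (toR3 P)); last first.
    by rewrite /weight /= /GRing.scale /=; ring.
  by rewrite toR_wt; move/Z.eqb_spec: wP => ->; rewrite toR4E mulVf.
have Pk : piece (Ordinal k12) (point_of P).
  apply/(piece_form nd) => r r3; rewrite cP formPE.
  apply: mulr_ge0; first by rewrite mulr_ge0 ?invr_ge0 ?exprn_ge0.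
  by apply: toR_ge0; apply: fP; rewrite mem_iota.
have dU : map dcoords (map dir_of us) = map (fun U => 2^-1 *: toR3 U) us.
  rewrite -map_comp; apply/eq_in_map => U Uus /=.
  rewrite dcoords_pt // (_ : weight _ = 2^-1 * weight (toR3 U)); last first.
    by rewrite /weight /= /GRing.scale /=; ring.
  by rewrite toR_wt; move/allP: us0 => /(_ U Uus)/Z.eqb_spec ->; rewrite toR0 mulr0.
have Cs : Cn (region t) (size (map dir_of us)) s.
  have : Cn (region t) 3 s.
    exact: (piecewise_Cn pcl pop psub pcls preg (n := 2) (r := 3) cc ps).
  rewrite size_map; have := us3.
  have le a b : (a <= b)%N -> Cn (region t) b s -> Cn (region t) a s.
    elim: b => [|b IH]; first by rewrite leqn0 => /eqP ->.
    by rewrite leq_eqVlt => /predU1P[-> //|]; rewrite ltnS => /IH + /Cn_le.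
  exact: le.
rewrite (piecewise_dirs pop psub pcls preg Cs ps Pk) /= eval_scale.
rewrite cP dU size_map foldr_step_scale eval_scale eval_foldr.
rewrite /polar_points map_cat map_nseq /polar !foldr_cat.
have nseqE (q : nat) (e : nat -> nat -> R) :
   foldr step e (nseq q (4^-1 *: toR3 P)) =
   net_scale (4^-1 ^+ q) (foldr step e (nseq q (toR3 P))).
  have := foldr_step_scale 4^-1 (nseq q P) e.
  by rewrite !map_nseq size_nseq.
rewrite nseqE.
have foldS a e (ws : seq (R * R * R)) :
    foldr step (net_scale a e) ws = net_scale a (foldr step e ws).
  by elim: ws => //= W ws ->; rewrite step_scale.
by rewrite foldS /net_scale; ring.
Qed.

Lemma mem_orders i j : (i + j <= 3)%N -> (i, j) \in orders.
Proof.
move=> ij; have i4 : (i < 4)%N by rewrite ltnS (leq_trans _ ij) ?leq_addr.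
have j4 : (j < 4)%N by rewrite ltnS (leq_trans _ ij) ?leq_addl.
have := @all_iota2P 4 4 (fun i j => (i + j <= 3)%N ==> ((i, j) \in orders)) isT i j i4 j4.
by rewrite ij.
Qed.

Lemma corner_dirs m a b c : (m < 3)%N -> (a, b, c) = nth (v1, v2, v3) (corners t) m ->
  [/\ point_of (zcomb 4 0 0 m) = a, dir_of (zcomb (-2) 2 0 m) = b - a,
      dir_of (zcomb (-2) 0 2 m) = c - a,
      point_of (zcomb 3 1 0 m) = 4^-1 *: (3 *: a + b) /\
      point_of (zcomb 1 3 0 m) = 4^-1 *: (a + 3 *: b) &
      point_of (zcomb 2 2 0 m) = midpoint a b /\
      dir_of (zcomb (-1) (-1) 2 m) = c - midpoint a b].
Proof.
have n1 : toR (-1) = -1 :> R by [].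
have n2 : toR (-2) = -2 :> R by [].
have n3 : toR 1 = 1 :> R by [].
have n4 : toR 2 = 2 :> R by [].
have nums := (n1, n2, n3, n4, @toR_num R).
by case: m => [|[|[|//]]] _ [-> -> ->]; split; try split;
  apply: pairE; rewrite /point_of /dir_of /pt /midpoint /= /GRing.scale /= ?nums; field.
Qed.

Lemma hermite_vertex m i j a b c : (m < 3)%N -> (i + j <= 3)%N ->
  (a, b, c) = nth (v1, v2, v3) (corners t) m ->
  hermite m (index (i, j) orders) = eps_vertex t a (b - a) (c - a) i j.
Proof.
move=> m3 ij abc; have [ea eb ec _ _] := corner_dirs m3 abc.
have i10 : (index (i, j) orders < 10)%N.
  by rewrite -[10%N]/(size orders) index_mem mem_orders.
apply/funext => f; rewrite /hermite /hermite_data i10 nth_index ?mem_orders //=.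
rewrite map_cat !map_nseq ea eb ec foldr_cat /eps_vertex.
by rewrite !foldr_nseq.
Qed.

Lemma hermite_q1 m a b c : (m < 3)%N -> (a, b, c) = nth (v1, v2, v3) (corners t) m ->
  hermite m 10 = eps_point t (4^-1 *: (3 *: a + b)) (c - midpoint a b) 2.
Proof.
move=> m3 abc; have [_ _ _ [e1 _] [_ e3]] := corner_dirs m3 abc.
by apply/funext => f; rewrite /hermite /hermite_data /= e1 e3.
Qed.

Lemma hermite_mid m a b c : (m < 3)%N -> (a, b, c) = nth (v1, v2, v3) (corners t) m ->
  hermite m 11 = eps_point t (midpoint a b) (c - midpoint a b) 1.
Proof.
move=> m3 abc; have [_ _ _ _ [e2 e3]] := corner_dirs m3 abc.
by apply/funext => f; rewrite /hermite /hermite_data /= e2 e3.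
Qed.

Lemma hermite_q2 m a b c : (m < 3)%N -> (a, b, c) = nth (v1, v2, v3) (corners t) m ->
  hermite m 12 = eps_point t (4^-1 *: (a + 3 *: b)) (c - midpoint a b) 2.
Proof.
move=> m3 abc; have [_ _ _ [_ e1] [_ e3]] := corner_dirs m3 abc.
by apply/funext => f; rewrite /hermite /hermite_data /= e1 e3.
Qed.

(** The functionals are enumerated by vertex or edge m and kind n. *)
Lemma LambdaP l : Lambda t l <->
  exists m n, [/\ (m < 3)%N, (n < 13)%N & l = hermite m n].
Proof.
split=> [[a [b [c [abc H]]]]|[m [n [m3 n13 ->]]]].
  have [m m3 e] : exists2 m, (m < 3)%N & (a, b, c) = nth (v1, v2, v3) (corners t) m.
    exists (index (a, b, c) (corners t)); last by rewrite nth_index.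
    by rewrite -[3%N]/(size (corners t)) index_mem.
  case: H => [[i [j [ij ->]]]|[->|->|->]].
  - exists m, (index (i, j) orders); rewrite (hermite_vertex m3 ij e); split=> //.
    by apply: (@leq_trans 10) => //; rewrite -[10%N]/(size orders) index_mem mem_orders.
  - by exists m, 10%N; rewrite (hermite_q1 m3 e).
  - by exists m, 11%N; rewrite (hermite_mid m3 e).
  - by exists m, 12%N; rewrite (hermite_q2 m3 e).
case E : (nth (v1, v2, v3) (corners t) m) => [[a b] c]; move/esym: E => e.
exists a, b, c; split; first by rewrite e mem_nth.
have [n10|n10] := ltnP n 10.
  left; set ij := nth (0, 0)%N orders n.
  have ij3 : (ij.1 + ij.2 <= 3)%N.
    have /allP : all (fun ij : nat * nat => ij.1 + ij.2 <= 3)%N orders by [].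
    by apply; rewrite mem_nth.
  exists ij.1, ij.2; split=> //; rewrite -(hermite_vertex m3 ij3 e).
  by rewrite -surjective_pairing index_uniq.
right; have : (n == 10) || (n == 11) || (n == 12).
  by move: n13 n10; do 13 (case: n => [//|n]).
case/orP => [/orP[]|] /eqP ->.
- by rewrite (hermite_q1 m3 e); constructor 1.
- by rewrite (hermite_mid m3 e); constructor 2.
- by rewrite (hermite_q2 m3 e); constructor 3.
Qed.

(** Two functionals that differ at g are distinct, so the spline s dual to
the functional has the same values as g on all functionals; the difference of s
and g then vanishes by unisolvence. *)
Lemma dual_eqP (g : R * R -> R) (c : nat -> nat -> nat -> R) m0 n0 :
  (m0 < 3)%N -> (n0 < 13)%N ->
  piecewise 5 (fun k => c k) g -> compat 2 3 (fun k => c k) ->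
  (forall m n, (m < 3)%N -> (n < 13)%N ->
     hermite_value c m n = ((m == m0) && (n == n0))%:R) ->
  dual_eq t (hermite m0 n0) g.
Proof.
move=> m03 n03 pg cg vg; split; first by apply/LambdaP; exists m0, n0.
move=> s; split=> [[/S35P[cs [ps ccs]] s1 s0] p /(piece_cover nd)[k Pk]|sg].
  have veq m n : (m < 3)%N -> (n < 13)%N -> hermite_value cs m n = hermite_value c m n.
    move=> m3 n13; rewrite -(hermite_valueE m3 n13 ps ccs).
    have [/andP[/eqP -> /eqP ->]|ne] := boolP ((m == m0) && (n == n0)).
      by rewrite s1 vg // !eqxx.
    have gv := hermite_valueE m3 n13 pg cg; rewrite vg // (negbTE ne) in gv.
    rewrite vg // (negbTE ne); apply: s0.
      by apply/LambdaP; exists m, n.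
    move=> e; move: gv; rewrite e (hermite_valueE m03 n03 pg cg) vg // !eqxx.
    by move/eqP; rewrite oner_eq0.
  pose d k := net_add (cs k) (net_scale (-1) (c k)).
  have cd : compat 2 3 (fun k : 'I_12 => d k).
    apply: compat_plus => //; exact: (compat_scale (-1) cg).
  have d0 m n : (m < 3)%N -> (n < 13)%N -> let: (k, us, P) := hermite_data m n in
      polar (map toR3 (polar_points us P)) (d k) = 0.
    move=> m3 n13; have := veq m n m3 n13; rewrite /hermite_value.
    have := hermite_data_wfP => /all_iota2P/(_ m n m3 n13).
    case: (hermite_data m n) => [[k' us] P] /and5P[_ us3 _ _ _].
    set w := _ * (_ * _) => e.
    have w0 : w != 0.
      rewrite !mulf_neq0 ?expf_neq0 ?invr_neq0 // pnatr_eq0 -lt0n ffact_gt0.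
      by rewrite (leq_trans us3).
    by rewrite polar_plus polar_scale (mulfI w0 e); ring.
  have zero := unisolvent nd cd d0.
  have : eval 5 (d k) (coords p) = 0.
    rewrite (@eval_agree _ 5 (coords p) (d k) (net_scale 0 (d k))).
      by rewrite eval_scale mul0r.
    by move=> i j ij; rewrite /net_scale mul0r zero.
  rewrite eval_plus eval_scale -(ps _ _ Pk) -(pg _ _ Pk) mulN1r.
  by move/eqP; rewrite subr_eq0 => /eqP.
have ps : piecewise 5 (fun k : 'I_12 => c k) s.
  by move=> k p Pk; rewrite sg; [exact: pg|exact: (piece_region nd Pk)].
split.
- by apply/S35P; exists c.
- by rewrite (hermite_valueE m03 n03 ps cg) vg // !eqxx.
- move=> l /LambdaP[m [n [m3 n13 ->]]] ne.
  rewrite (hermite_valueE m3 n13 ps cg) vg //.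
  have [/andP[/eqP e1 /eqP e2]|//] := boolP ((m == m0) && (n == n0)).
  by case: ne; rewrite e1 e2.
Qed.

End Final.

(** * Linear combinations of simplex splines *)

Definition term := (Z * Z * seq nat)%type.
(** The term a / b Q[v1^i v2^j v3^k v4^l v5^m v6^n]. *)
Definition tm (a b : Z) (i j k l m n : nat) : term := (a, b, [:: i; j; k; l; m; n]).

(** Coefficients brought to the common denominator N. *)
Definition scaled (N : Z) (T : seq term) : seq (Z * seq (seq (seq Z))) :=
  [seq ((e.1.1 * (N / e.1.2))%BZ, nets 5 e.2) | e <- T].

Definition zsum (L : seq (Z * seq (seq (seq Z)))) (k : nat) : znet :=
  fun i j => foldr (fun e s => e.1 * zrows (nth [::] e.2 k) i j + s)%BZ 0%BZ L.

Definition zpow (a : Z) (n : nat) : Z := iter n (Z.mul a) 1%BZ.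

(** Multiplication by N and by the denominators 2 and 4 of directions and points
makes the values of the functionals integers. *)
Definition dual_ok (N : Z) (T : seq term) (m0 n0 : nat) : bool :=
  [&& (0 <? N)%BZ,
   all (fun e => [&& e.2 \in max_knots, (0 <? e.1.2)%BZ & (e.1.2 * (N / e.1.2) =? N)%BZ]) T &
   let L := scaled N T in
   all (fun m => all (fun n => let: (k, us, P) := hermite_data m n in
     (Z.of_nat (5 ^_ (size us)) * foldr zstep (zsum L k) (polar_points us P) 0%N 0%N =?
      if (m == m0) && (n == n0) then N * (zpow 2 (size us) * zpow 4 (5 - size us)) else 0)%BZ)
     (iota 0 13)) (iota 0 3)].

Section Combinations.
Context {R : realType}.
Variables v1 v2 v3 : R * R.
Hypothesis nd : nondegenerate_triangle (Triangle v1 v2 v3).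
Let t := Triangle v1 v2 v3.
Local Notation piece := (piece v1 v2 v3).
Local Notation piecewise := (piecewise v1 v2 v3 piece).
Local Notation compat := (compat v1 v2 v3 piece).

Definition combination (T : seq term) (p : R * R) : R :=
  foldr (fun e s => toR e.1.1 / toR e.1.2 * Qext t (knots_of e.2) p + s) 0 T.

Definition combination_net (T : seq term) (k : nat) : nat -> nat -> R :=
  foldr (fun e s => net_add (net_scale (toR e.1.1 / toR e.1.2) (rnet (net 5 e.2 k))) s)
    (fun _ _ => 0) T.

Lemma eval_zero d (X : R * R * R) : eval d (fun _ _ => 0) X = 0.
Proof.
have -> : (fun _ _ => 0) = net_scale 0 (fun _ _ => 0) :> (nat -> nat -> R).
  by apply/netP => i j; rewrite /net_scale mul0r.
by rewrite eval_scale mul0r.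
Qed.

Lemma combination_piecewise T : all (fun e => e.2 \in max_knots) T ->
  piecewise 5 (fun k => combination_net T k) (combination T) /\
  compat 2 3 (fun k => combination_net T k).
Proof.
elim: T => [_|e T IH /= /andP[eK /IH[pT cT]]].
  by split=> [k p _|k l p _ _ i j _] //; rewrite eval_zero.
split.
  apply: piecewise_plus pT; apply: piecewise_scale; exact: Qext_piecewise.
apply: compat_plus cT; apply: compat_scale; apply: zcompatP => //.
by have /andP[] := allP smooth_okP e.2 eK.
Qed.

Lemma combination_netE N T k : (0 <? N)%BZ -> all (fun e : term =>
    [&& e.2 \in max_knots, (0 <? e.1.2)%BZ & (e.1.2 * (N / e.1.2) =? N)%BZ]) T ->
  combination_net T k = net_scale (toR N)^-1 (rnet (zsum (scaled N T) k)).
Proof.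
move=> N0; have N0' : toR N != 0 :> R by rewrite gt_eqF // toR_gt0.
elim: T => [_|e T IH /= /andP[/and3P[_ d0 /Z.eqb_spec dN] /IH ->]].
  by apply/netP => i j; rewrite /net_scale /rnet /= toR0 mulr0.
have d0' : toR e.1.2 != 0 :> R by rewrite gt_eqF // toR_gt0.
apply/netP => i j; rewrite /net_add /net_scale /rnet /= toRD !toRM.
rewrite mulrDr; congr (_ + _); rewrite -/(net 5 e.2 k i j).
have NE : toR N = toR e.1.2 * toR (N / e.1.2)%BZ :> R by rewrite -toRM dN.
move: NE N0'; set q := toR (N / e.1.2)%BZ => ->; rewrite mulf_eq0 negb_or => /andP[_ q0].
by field; rewrite d0' q0.
Qed.

Lemma toR_nat n : toR (Z.of_nat n) = n%:R :> R.
Proof.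
elim: n => [|n IH] //; rewrite Nat2Z.inj_succ -Z.add_1_r toRD IH.
by rewrite -[toR 1]/(1 : R) natr1.
Qed.

Lemma toR_pow a n : toR (zpow a n) = toR a ^+ n :> R.
Proof.
elim: n => [|n IH]; first by [].
by rewrite /zpow iterS toRM -/(zpow a n) IH exprS.
Qed.

Lemma polar_rnet pts c : polar (map toR3 pts) (rnet c) =
  toR (foldr zstep c pts 0%N 0%N) :> R.
Proof.
rewrite /polar -[RHS]/(rnet (foldr zstep c pts) 0%N 0%N); congr (_ 0%N 0%N).
by elim: pts => //= p pts ->; rewrite rnet_step.
Qed.

(** The nets of the combination are integer nets divided by N, so [dual_ok]
gives the values of the functionals and [dual_eqP] applies. *)
Lemma dual_combination N T m0 n0 : (m0 < 3)%N -> (n0 < 13)%N ->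
  dual_ok N T m0 n0 -> dual_eq t (hermite v1 v2 v3 m0 n0) (combination T).
Proof.
move=> m03 n03 /and3P[N0 Tok /all_iota2P chk].
have [|pT cT] := @combination_piecewise T.
  by apply: sub_all Tok => e /and3P[].
apply: (dual_eqP nd m03 n03 pT cT) => m n m3 n13.
have := chk m n m3 n13; rewrite /hermite_value.
case: (hermite_data m n) => [[k us] P] /Z.eqb_spec/(congr1 (@toR R)).
rewrite (combination_netE _ N0 Tok) polar_scale polar_rnet toRM toR_nat.
set q := toR (foldr _ _ _ _ _) => h.
rewrite mulrCA mulrA mulrAC -/q.
have N0' : toR N != 0 :> R by rewrite gt_eqF // toR_gt0.
have e4 : toR 4 = 4 :> R by [].
have e2 : toR 2 = 2 :> R by [].
rewrite (_ : _ * _ = (toR N)^-1 * (2 ^- size us * 4 ^- (5 - size us)) *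
   ((5 ^_ size us)%:R * q)); last by rewrite !exprVn; ring.
rewrite h; case: ifP => _; last by rewrite toR0 mulr0.
rewrite !toRM !toR_pow e4 e2.
have : (2 : R) ^+ size us != 0 by rewrite expf_neq0.
have : (4 : R) ^+ (5 - size us) != 0 by rewrite expf_neq0.
move: (2 ^+ _) (4 ^+ _) => a b b0 a0; rewrite -[RHS]/(1 : R); field.
by rewrite N0' a0 b0.
Qed.

End Combinations.
Definition terms_v : seq term :=
  [:: tm 1 4 6 0 0 1 0 1;
      tm 1 4 5 0 0 2 0 1;
      tm 1 4 5 0 0 1 0 2;
      tm 1 2 4 1 0 2 0 1;
      tm 1 2 4 0 1 1 0 2;
      tm 1 1 4 1 1 1 0 1;
      tm 1 2 3 1 1 2 0 1;
      tm 1 2 3 1 1 1 0 2;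
      tm 1 2 3 2 0 2 0 1;
      tm 1 2 3 0 2 1 0 2;
      tm 9 16 2 1 1 2 1 1;
      tm 9 16 2 1 1 1 1 2;
      tm 3 8 2 2 0 2 1 1;
      tm 3 8 2 0 2 1 1 2;
      tm 3 16 1 1 2 1 1 2;
      tm 3 16 1 2 1 2 1 1].
Definition terms_x : seq term :=
  [:: tm 1 40 5 0 0 2 0 1;
      tm 1 10 4 1 0 2 0 1;
      tm 1 5 3 2 0 2 0 1;
      tm 1 10 4 1 1 1 0 1;
      tm 3 20 3 1 1 2 0 1;
      tm 13 80 2 2 0 2 1 1;
      tm 1 20 3 1 1 1 0 2;
      tm 19 80 2 1 1 2 1 1;
      tm 1 10 1 2 1 2 1 1;
      tm (-1) 40 2 1 1 1 1 2;
      tm (-1) 40 2 0 2 1 1 2;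
      tm (-1) 20 1 1 2 1 1 2].
Definition terms_xx : seq term :=
  [:: tm 1 160 4 1 0 2 0 1;
      tm 1 32 3 2 0 2 0 1;
      tm 1 80 3 1 1 2 0 1;
      tm 17 640 2 2 0 2 1 1;
      tm 121 3840 2 1 1 2 1 1;
      tm 71 3840 1 2 1 2 1 1;
      tm (-1) 48 2 1 1 1 1 2;
      tm 1 480 1 1 2 1 1 2].
Definition terms_xy : seq term :=
  [:: tm 1 80 4 1 1 1 0 1;
      tm 3 160 3 1 1 2 0 1;
      tm 3 160 3 1 1 1 0 2;
      tm (-1) 160 2 2 0 2 1 1;
      tm (-1) 160 2 0 2 1 1 2;
      tm 17 960 2 1 1 1 1 2;
      tm 17 960 2 1 1 2 1 1;
      tm (-7) 480 1 1 2 1 1 2;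
      tm (-7) 480 1 2 1 2 1 1].
Definition terms_xxx : seq term :=
  [:: tm 1 480 3 2 0 2 0 1;
      tm 7 3840 2 2 0 2 1 1;
      tm 5 3072 2 1 1 2 1 1;
      tm 7 5120 1 2 1 2 1 1].
Definition terms_xxy : seq term :=
  [:: tm 1 480 3 1 1 2 0 1;
      tm (-1) 1920 2 2 0 2 1 1;
      tm (-1) 768 1 2 1 2 1 1;
      tm 11 3840 2 1 1 2 1 1;
      tm (-11) 3840 2 1 1 1 1 2;
      tm 1 3840 1 1 2 1 1 2].
Definition terms_q : seq term :=
  [:: tm 7 240 2 1 1 2 1 1;
      tm (-1) 240 1 2 1 2 1 1].
Definition terms_m : seq term :=
  [:: tm 1 10 2 2 0 2 1 1;
      tm 1 5 2 1 1 2 1 1;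
      tm 1 5 1 2 1 2 1 1].

(* The number 15360 is a common multiple of all denominators; the last argument
   is the position of the pair of orders of derivation in [orders], or 10, 11. *)
Lemma terms_v_ok : dual_ok 15360 terms_v 0 0. Proof. by vm_compute. Qed.
Lemma terms_x_ok : dual_ok 15360 terms_x 0 4. Proof. by vm_compute. Qed.
Lemma terms_xx_ok : dual_ok 15360 terms_xx 0 7. Proof. by vm_compute. Qed.
Lemma terms_xy_ok : dual_ok 15360 terms_xy 0 5. Proof. by vm_compute. Qed.
Lemma terms_xxx_ok : dual_ok 15360 terms_xxx 0 9. Proof. by vm_compute. Qed.
Lemma terms_xxy_ok : dual_ok 15360 terms_xxy 0 8. Proof. by vm_compute. Qed.
Lemma terms_q_ok : dual_ok 15360 terms_q 0 10. Proof. by vm_compute. Qed.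
Lemma terms_m_ok : dual_ok 15360 terms_m 0 11. Proof. by vm_compute. Qed.

(** * The Hermite dual basis *)

Section Match.
Context {R : realType}.
Variable t : triangle R.

Lemma Q_knots i j k l m n : Q t i j k l m n = Qext t (knots_of [:: i; j; k; l; m; n]).
Proof. by []. Qed.

Lemma dual_eq_ext l (f g : R * R -> R) : (forall p, f p = g p) ->
  dual_eq t l f -> dual_eq t l g.
Proof. by move=> fg; have -> : g = f by apply/funext => p; rewrite fg. Qed.
Lemma toR_lit (z : Z) (n : nat) : Z.to_nat z = n -> (0 <=? z)%BZ -> toR z = n%:R :> R.
Proof. by move=> <- z0; rewrite -toR_nat Z2Nat.id //; apply/Z.leb_le. Qed.
Lemma toR_neg p : toR (Z.neg p) = - toR (Z.pos p) :> R.
Proof. by rewrite -toRN. Qed.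
End Match.

Section Instances.
Context {R : realType}.
Variables v1 v2 v3 : R * R.
Hypothesis nd : nondegenerate_triangle (Triangle v1 v2 v3).
Let t := Triangle v1 v2 v3.

Lemma dual_vertex i j n T (g : R * R -> R) : (i + j <= 3)%N -> index (i, j) orders = n ->
  dual_ok 15360 T 0 n -> (forall p, combination v1 v2 v3 T p = g p) ->
  dual_eq t (eps_vertex t v1 (v2 - v1) (v3 - v1) i j) g.
Proof.
move=> ij ni ok gE; apply: dual_eq_ext gE _.
have e0 : (v1, v2, v3) = nth (v1, v2, v3) (corners t) 0 by [].
rewrite -(hermite_vertex (m := 0) isT ij e0) ni; apply: (dual_combination nd (m0 := 0) isT _ ok).
rewrite -ni (@leq_trans 10) // -[10%N]/(size orders) index_mem; exact: mem_orders.
Qed.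

Lemma dual_q1 T (g : R * R -> R) : dual_ok 15360 T 0 10 ->
  (forall p, combination v1 v2 v3 T p = g p) ->
  dual_eq t (eps_point t (4^-1 *: (3 *: v1 + v2)) (v3 - vert4 t) 2) g.
Proof.
move=> ok gE; apply: dual_eq_ext gE _.
have e0 : (v1, v2, v3) = nth (v1, v2, v3) (corners t) 0 by [].
have -> : vert4 t = midpoint v1 v2 by [].
rewrite -(hermite_q1 (m := 0) isT e0); exact: (dual_combination nd (m0 := 0) (n0 := 10) isT isT ok).
Qed.

Lemma dual_mid T (g : R * R -> R) : dual_ok 15360 T 0 11 ->
  (forall p, combination v1 v2 v3 T p = g p) ->
  dual_eq t (eps_point t (vert4 t) (v3 - vert4 t) 1) g.
Proof.
move=> ok gE; apply: dual_eq_ext gE _.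
have e0 : (v1, v2, v3) = nth (v1, v2, v3) (corners t) 0 by [].
have -> : vert4 t = midpoint v1 v2 by [].
rewrite -(hermite_mid (m := 0) isT e0); exact: (dual_combination nd (m0 := 0) (n0 := 11) isT isT ok).
Qed.
End Instances.

Theorem theorem10 (R : realType) (v1 v2 v3 : R * R)
    (ndT : nondegenerate_triangle (Triangle v1 v2 v3)) :
  let t := Triangle v1 v2 v3 in
  let v := v1 in
  let x := v2 - v1 in
  let y := v3 - v1 in
  let m := vert4 t in
  let u := v3 - vert4 t in
  let q1 := 4^-1 *: (3 *: v1 + v2) in
      (dual_eq t (eps_vertex t v x y 0 0) (fun p =>
         1 / 4 * Q t 6 0 0 1 0 1 p
         + 1 / 4 * (Q t 5 0 0 2 0 1 p + Q t 5 0 0 1 0 2 p)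
         + 1 / 2 * (Q t 4 1 0 2 0 1 p + Q t 4 0 1 1 0 2 p)
         + Q t 4 1 1 1 0 1 p
         + 1 / 2 * (Q t 3 1 1 2 0 1 p + Q t 3 1 1 1 0 2 p)
         + 1 / 2 * (Q t 3 2 0 2 0 1 p + Q t 3 0 2 1 0 2 p)
         + 9 / 16 * (Q t 2 1 1 2 1 1 p + Q t 2 1 1 1 1 2 p)
         + 3 / 8 * (Q t 2 2 0 2 1 1 p + Q t 2 0 2 1 1 2 p)
         + 3 / 16 * (Q t 1 1 2 1 1 2 p + Q t 1 2 1 2 1 1 p))) /\
      (dual_eq t (eps_vertex t v x y 1 0) (fun p =>
         1 / 40 * Q t 5 0 0 2 0 1 p
         + 1 / 10 * Q t 4 1 0 2 0 1 p
         + 1 / 5 * Q t 3 2 0 2 0 1 p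
         + 1 / 10 * Q t 4 1 1 1 0 1 p
         + 3 / 20 * Q t 3 1 1 2 0 1 p
         + 13 / 80 * Q t 2 2 0 2 1 1 p
         + 1 / 20 * Q t 3 1 1 1 0 2 p
         + 19 / 80 * Q t 2 1 1 2 1 1 p
         + 1 / 10 * Q t 1 2 1 2 1 1 p
         - 1 / 40 * Q t 2 1 1 1 1 2 p
         - 1 / 40 * Q t 2 0 2 1 1 2 p
         - 1 / 20 * Q t 1 1 2 1 1 2 p)) /\
      (dual_eq t (eps_vertex t v x y 2 0) (fun p =>
         1 / 160 * Q t 4 1 0 2 0 1 p
         + 1 / 32 * Q t 3 2 0 2 0 1 p
         + 1 / 80 * Q t 3 1 1 2 0 1 p
         + 17 / 640 * Q t 2 2 0 2 1 1 p
         + 121 / 3840 * Q t 2 1 1 2 1 1 p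
         + 71 / 3840 * Q t 1 2 1 2 1 1 p
         - 1 / 48 * Q t 2 1 1 1 1 2 p
         + 1 / 480 * Q t 1 1 2 1 1 2 p)) /\
      (dual_eq t (eps_vertex t v x y 1 1) (fun p =>
         1 / 80 * Q t 4 1 1 1 0 1 p
         + 3 / 160 * (Q t 3 1 1 2 0 1 p + Q t 3 1 1 1 0 2 p)
         - 1 / 160 * (Q t 2 2 0 2 1 1 p + Q t 2 0 2 1 1 2 p)
         + 17 / 960 * (Q t 2 1 1 1 1 2 p + Q t 2 1 1 2 1 1 p)
         - 7 / 480 * (Q t 1 1 2 1 1 2 p + Q t 1 2 1 2 1 1 p))) /\
      (dual_eq t (eps_vertex t v x y 3 0) (fun p =>
         1 / 480 * Q t 3 2 0 2 0 1 p
         + 7 / 3840 * Q t 2 2 0 2 1 1 p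
         + 5 / 3072 * Q t 2 1 1 2 1 1 p
         + 7 / 5120 * Q t 1 2 1 2 1 1 p)) /\
      (dual_eq t (eps_vertex t v x y 2 1) (fun p =>
         1 / 480 * Q t 3 1 1 2 0 1 p
         - 1 / 1920 * Q t 2 2 0 2 1 1 p
         - 1 / 768 * Q t 1 2 1 2 1 1 p
         + 11 / 3840 * Q t 2 1 1 2 1 1 p
         - 11 / 3840 * Q t 2 1 1 1 1 2 p
         + 1 / 3840 * Q t 1 1 2 1 1 2 p)) /\
      (dual_eq t (eps_point t q1 u 2) (fun p =>
         7 / 240 * Q t 2 1 1 2 1 1 p
         - 1 / 240 * Q t 1 2 1 2 1 1 p)) /\
      (dual_eq t (eps_point t m u 1) (fun p =>
         1 / 10 * Q t 2 2 0 2 1 1 p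
         + 1 / 5 * (Q t 2 1 1 2 1 1 p + Q t 1 2 1 2 1 1 p))).

Proof.
move=> t v x y m u q1.
split.
  apply: (dual_vertex ndT (i := 0%N) (j := 0%N) (n := 0%N) isT erefl terms_v_ok) => p.
  rewrite /combination /= -!Q_knots ?toR_neg.
  rewrite (@toR_lit R 1 1%N) // (@toR_lit R 2 2%N) // (@toR_lit R 3 3%N) // (@toR_lit R 4 4%N) // (@toR_lit R 8 8%N) // (@toR_lit R 9 9%N) // (@toR_lit R 16 16%N) //.
  by field.
split.
  apply: (dual_vertex ndT (i := 1%N) (j := 0%N) (n := 4%N) isT erefl terms_x_ok) => p.
  rewrite /combination /= -!Q_knots ?toR_neg.
  rewrite (@toR_lit R 1 1%N) // (@toR_lit R 3 3%N) // (@toR_lit R 5 5%N) // (@toR_lit R 10 10%N) // (@toR_lit R 13 13%N) // (@toR_lit R 19 19%N) // (@toR_lit R 20 20%N) // (@toR_lit R 40 40%N) // (@toR_lit R 80 80%N) //.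
  by field.
split.
  apply: (dual_vertex ndT (i := 2%N) (j := 0%N) (n := 7%N) isT erefl terms_xx_ok) => p.
  rewrite /combination /= -!Q_knots ?toR_neg.
  rewrite (@toR_lit R 1 1%N) // (@toR_lit R 17 17%N) // (@toR_lit R 32 32%N) // (@toR_lit R 48 48%N) // (@toR_lit R 71 71%N) // (@toR_lit R 80 80%N) // (@toR_lit R 121 121%N) // (@toR_lit R 160 160%N) // (@toR_lit R 480 480%N) // (@toR_lit R 640 640%N) // (@toR_lit R 3840 3840%N) //.
  by field.
split.
  apply: (dual_vertex ndT (i := 1%N) (j := 1%N) (n := 5%N) isT erefl terms_xy_ok) => p.
  rewrite /combination /= -!Q_knots ?toR_neg.
  rewrite (@toR_lit R 1 1%N) // (@toR_lit R 3 3%N) // (@toR_lit R 7 7%N) // (@toR_lit R 17 17%N) // (@toR_lit R 80 80%N) // (@toR_lit R 160 160%N) // (@toR_lit R 480 480%N) // (@toR_lit R 960 960%N) //.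
  by field.
split.
  apply: (dual_vertex ndT (i := 3%N) (j := 0%N) (n := 9%N) isT erefl terms_xxx_ok) => p.
  rewrite /combination /= -!Q_knots ?toR_neg.
  rewrite (@toR_lit R 1 1%N) // (@toR_lit R 5 5%N) // (@toR_lit R 7 7%N) // (@toR_lit R 480 480%N) // (@toR_lit R 3072 3072%N) // (@toR_lit R 3840 3840%N) // (@toR_lit R 5120 5120%N) //.
  by field.
split.
  apply: (dual_vertex ndT (i := 2%N) (j := 1%N) (n := 8%N) isT erefl terms_xxy_ok) => p.
  rewrite /combination /= -!Q_knots ?toR_neg.
  rewrite (@toR_lit R 1 1%N) // (@toR_lit R 11 11%N) // (@toR_lit R 480 480%N) // (@toR_lit R 768 768%N) // (@toR_lit R 1920 1920%N) // (@toR_lit R 3840 3840%N) //.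
  by field.
split.
  apply: (dual_q1 ndT terms_q_ok) => p.
  rewrite /combination /= -!Q_knots ?toR_neg.
  rewrite (@toR_lit R 1 1%N) // (@toR_lit R 7 7%N) // (@toR_lit R 240 240%N) //.
  by field.
apply: (dual_mid ndT terms_m_ok) => p.
rewrite /combination /= -!Q_knots ?toR_neg.
rewrite (@toR_lit R 1 1%N) // (@toR_lit R 5 5%N) // (@toR_lit R 10 10%N) //.
by field.
Qed.
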